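(* Let $(F_i)_{i\ge 0}$ be a Barlow–Evans sequence with projective limit $F_\infty$, let $(\mathcal{E}_0,\mathcal{F}_0)$ be a regular Dirichlet form on $L^2(F_0,\mu_{F_0})$, and let $\Delta_i$ ($i\ge 0$) and $\Delta_\infty$ be the Laplacians generated by the Dirichlet forms $(\mathcal{E}_i,\mathcal{F}_i)$ and $(\mathcal{E}_\infty,\mathcal{F}_\infty)$. Then the spectrum of $\Delta_\infty$ is given by $$\sigma(\Delta_\infty)=\overline{\bigcup_{i=0}^{\infty}\sigma(\Delta_i)}=\overline{\bigcup_{i=0}^{\infty}\sigma\big(\Delta_\infty|_{\mathfrak{D}'_i}\big)}.$$
   Context: Spaces. $C_0[X]$ denotes the space of continuous real-valued functions on $X$ with compact support. A Barlow–Evans sequence consists of the following. $F_0$ is a locally compact, second-countable, Hausdorff space with a $\sigma$-finite Borel measure $\mu_{F_0}$; for each $i\ge1$, $G_i$ is a compact, second-countable, Hausdorff space with a Borel probability measure $\mu_{G_i}$; all these measures are Radon with full support. Inductively, for $i\ge 1$, $B_i\subset F_{i-1}$ is a closed subset, $F_i=((F_{i-1}\setminus B_i)\times G_i)\cup B_i$ (disjoint union), and $\pi_i:F_{i-1}\times G_i\to F_i$ is the map $\pi_i(x,g)=(x,g)$ if $x\in F_{i-1}\setminus B_i$ and $\pi_i(x,g)=x$ if $x\in B_i$. $F_i$ has the quotient topology from $\pi_i$ (a set is open iff its $\pi_i$-preimage is open). The map $\phi_i:F_i\to F_{i-1}$ is $\phi_i(x,g)=x$ for $x\in F_{i-1}\setminus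 B_i$, and $\phi_i(x)=x$ for $x\in B_i$. The Borel measure $\mu_{F_i}$ is $\mu_{F_i}(A)=(\mu_{F_{i-1}}\times\mu_{G_i})(\pi_i^{-1}(A))$. Each $F_i$ is locally compact, second-countable, Hausdorff. For a map $p$, $p^*f=f\circ p$. $\|\cdot\|_i$ is the norm of $L^2(F_i,\mu_{F_i})$, $i=0,1,\dots,\infty$. Projective limit. $F_\infty=\{(x_i)_{i\ge0}\in\prod_i F_i:\phi_i(x_i)=x_{i-1}\ \forall i\ge1\}$ with the subspace topology of the product topology, and $\Phi_j:F_\infty\to F_j$ are the coordinate projections, so $\phi_j\circ\Phi_j=\Phi_{j-1}$. $\mu_{F_\infty}$ is the unique Borel measure on $F_\infty$ with $\mu_{F_\infty}(\Phi_i^{-1}(A))=\mu_{F_i}(A)$ for all $i\ge 0$ and all Borel $A\subset F_i$. Dirichlet forms. $(\mathcal{E}_0,\mathcal{F}_0)$ is a regular Dirichlet form on $L^2(F_0,\mu_{F_0})$ and $\mathfrak{F}_0=\mathcal{F}_0\cap C_0[F_0]$. For $i\ge1$, $\mathfrak{F}_i$ is the set of $f\in C_0[F_i]$ such that $\pi_i^*f(x,g)=\sum_{k=1}^n f_k(x)h_k(g)$ for some $n$, $f_k\in\mathfrak{F}_{i-1}$, $h_k\in C(G_i)$; for $f,h\in\mathfrak{F}_i$, $\mathcal{E}_i(f,h)=\int_{G_i}\mathcal{E}_{i-1}(\pi_i^*f(\cdot,g),\pi_i^*h(\cdot,g))\,d\mu_{G_i}(g)$; and $(\mathcal{E}_i,\mathcal{F}_i)$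 is the closure of $(\mathcal{E}_i,\mathfrak{F}_i)$, i.e. $\mathcal{F}_i$ is the completion of $\mathfrak{F}_i$ in the norm $\mathcal{E}_i(f,f)^{1/2}+\|f\|_i$. On $\bigcup_i\Phi_i^*\mathfrak{F}_i$ set $\mathcal{E}_\infty(\Phi_i^*u,\Phi_i^*u)=\mathcal{E}_i(u,u)$, and let $(\mathcal{E}_\infty,\mathcal{F}_\infty)$ be the closure of this form, i.e. $\mathcal{F}_\infty$ is the closure of $\bigcup_i\Phi_i^*\mathfrak{F}_i$ in the norm $\mathcal{E}_\infty(f,f)^{1/2}+\|f\|_\infty$. All of these are regular Dirichlet forms. Laplacians. For a Dirichlet form $(\mathcal{E},\mathcal{F})$ the generator (Laplacian) $\Delta$ is the nonnegative self-adjoint operator such that $h\in Dom(\Delta)$ with $\Delta h=f$ iff $h\in\mathcal{F}$, $f\in L^2$ and $\mathcal{E}(h,v)=\langle f,v\rangle_{L^2}$ for all $v\in\mathcal{F}$. $\Delta_i$ is the generator of $(\mathcal{E}_i,\mathcal{F}_i)$, $i=0,1,\dots,\infty$. The spaces $\mathfrak{D}'_i$. $\mathfrak{D}'_0=\Phi_0^*Dom(\Delta_0)$ and, for $i\ge1$, $\mathfrak{D}'_i$ is the set of elements of $\Phi_i^*Dom(\Delta_i)$ that are orthogonal in $L^2(F_\infty,\mu_{F_\infty})$ to $\mathfrak{D}'_0,\dots,\mathfrak{D}'_{i-1}$; thus $\Phi_i^*Dom(\Delta_i)=\bigoplus_{j=0}^i\mathfrak{D}'_j$. $\Delta_\infty|_{\mathfrak{D}'_i}$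 is regarded as a densely defined operator, with domain $\mathfrak{D}'_i$, in the Hilbert space $\overline{\mathfrak{D}'_i}$ (closure in $L^2(F_\infty,\mu_{F_\infty})$), which equals $\Phi_i^*L^2(F_i,\mu_{F_i})\cap(\Phi_{i-1}^*L^2(F_{i-1},\mu_{F_{i-1}}))^\perp$ for $i\ge1$ and $\Phi_0^*L^2(F_0,\mu_{F_0})$ for $i=0$. *)

(* Defs.v *)
From HB Require Import structures.
From mathcomp Require Import all_boot all_order all_algebra.
From mathcomp Require Import all_classical all_reals all_analysis.

Set Implicit Arguments.
Unset Strict Implicit.
Unset Printing Implicit Defensive.

Import Order.TTheory GRing.Theory Num.Theory.
Import numFieldNormedType.Exports.

Local Open Scope classical_set_scope.
Local Open Scope ring_scope.

Notation borel X := (g_sigma_algebraType (@open X)).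

Section borel_measures.
Context (R : realType) (X : ptopologicalType).

Definition radon (mu : {measure set (borel X) -> \bar R}) : Prop :=
  [/\ forall K : set X, compact K -> (mu K < +oo)%E,
      forall U : set X, open U ->
        mu U = ereal_sup [set mu K | K in [set K : set X | compact K /\ K `<=` U]]
    & forall A : set (borel X), measurable A ->
        mu A = ereal_inf [set mu U | U in [set U : set X | open U /\ A `<=` U]]].

Definition full_support (mu : {measure set (borel X) -> \bar R}) : Prop :=
  forall U : set X, open U -> U !=set0 -> (0 < mu U)%E.

End borel_measures.

(* The disjoint union ((X \ B) x G) + B; its topology is the final one for
   [glue_pi]. *)
Definition glued (X G : ptopologicalType) (B : set X) : Type :=
  (set_type (~` B) * G + set_type B)%type.

HB.instance Definition _ (X G : ptopologicalType) (B : set X) :=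
  Choice.on (glued G B).

Definition glue_pi (X G : ptopologicalType) (B : set X) (p : X * G) :
    glued G B :=
  match pselect (B p.1) with
  | left Bx => inr (exist _ p.1 (mem_set Bx))
  | right nBx => inl (exist _ p.1 (@mem_set _ (~` B) _ nBx), p.2)
  end.

Definition glue_phi (X G : ptopologicalType) (B : set X) (z : glued G B) : X :=
  match z with
  | inl xg => set_val xg.1
  | inr x => set_val x
  end.

Section glued_topology.
Context (X G : ptopologicalType) (B : set X).

Definition glued_open : set_system (glued G B) :=
  [set U | open (@glue_pi X G B @^-1` U)].

Let glued_openT : glued_open setT.
Proof. by rewrite /glued_open /= preimage_setT; exact: openT. Qed.

Let glued_openI : setI_closed glued_open.
Proof. by move=> U V; exact: openI. Qed.

Let glued_open_bigU (I : Type) (f : I -> set (glued G B)) :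
  (forall i, glued_open (f i)) -> glued_open (\bigcup_i f i).
Proof.
move=> of_; rewrite /glued_open /= preimage_bigcup.
by apply: bigcup_open => i _; exact: of_.
Qed.

HB.instance Definition _ :=
  isOpenTopological.Build (glued G B) glued_openT glued_openI glued_open_bigU.

HB.instance Definition _ :=
  isPointed.Build (glued G B) (glue_pi B (point : X * G)).

Lemma glue_piK (p : X * G) : glue_phi (glue_pi B p) = p.1.
Proof. by rewrite /glue_pi; case: pselect. Qed.

End glued_topology.

(* A Barlow-Evans sequence issued from X: a fibre G and a subset B of X,
   followed by a sequence issued from the space glued from X, G and B. *)
CoInductive barlow_evans (X : ptopologicalType) : Type :=
  BarlowEvans (G : ptopologicalType) (B : set X) of barlow_evans (glued G B).

Section projective_limit.

Definition be_fibre (X : ptopologicalType) (s : barlow_evans X) :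
  ptopologicalType := let: @BarlowEvans _ G _ _ := s in G.

Definition be_set (X : ptopologicalType) (s : barlow_evans X) : set X :=
  let: @BarlowEvans _ _ B _ := s in B.

Definition be_tail (X : ptopologicalType) (s : barlow_evans X) :
    barlow_evans (glued (be_fibre s) (be_set s)) :=
  let: @BarlowEvans _ _ _ t := s in t.

Definition be_step (p : {X : ptopologicalType & barlow_evans X}) :
    {X : ptopologicalType & barlow_evans X} :=
  existT barlow_evans
    (glued (be_fibre (projT2 p)) (be_set (projT2 p)) : ptopologicalType)
    (be_tail (projT2 p)).

Context (X : ptopologicalType) (s : barlow_evans X).

Definition be_nth (i : nat) : {X : ptopologicalType & barlow_evans X} :=
  iter i be_step (existT barlow_evans X s).

Definition beF (i : nat) : ptopologicalType := projT1 (be_nth i).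

(* With beF i standing for F_i, [beG i] and [beB i] stand for G_(i+1) and
   B_(i+1), and [bepi i] and [bephi i] for pi_(i+1) and phi_(i+1). *)
Definition beG (i : nat) : ptopologicalType := be_fibre (projT2 (be_nth i)).

Definition beB (i : nat) : set (beF i) := be_set (projT2 (be_nth i)).

Definition bepi (i : nat) : beF i * beG i -> beF i.+1 := @glue_pi _ _ (@beB i).

Definition bephi (i : nat) : beF i.+1 -> beF i := @glue_phi _ _ (@beB i).

Definition be_threads : set (prod_topology beF) :=
  [set x : prod_topology beF | forall i, bephi (x i.+1 : beF i.+1) = x i].

Definition beFoo : Type := set_type be_threads.

HB.instance Definition _ := Topological.on beFoo.

Fixpoint be_point (i : nat) : beF i :=
  match i return beF i with
  | 0 => point
  | j.+1 => @bepi j (be_point j, point)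
  end.

Lemma be_pointP : be_threads be_point.
Proof. by move=> i; exact: glue_piK. Qed.

HB.instance Definition _ :=
  isPointed.Build beFoo (SigSub (mem_set be_pointP) : set_type be_threads).

Definition bePhi (i : nat) (x : beFoo) : beF i := set_val x i.

End projective_limit.

Arguments beB {X} s i.
Arguments bepi {X} s i.
Arguments bephi {X} s i.
Arguments bePhi {X} s i.

(* Elements of L^2 are represented by square integrable functions, and equality
   in L^2 by equality almost everywhere. *)
Section L2.
Context (R : realType) d (T : measurableType d).
Variable mu : {measure set T -> \bar R}.

Definition L2 : set (T -> R) := [set f | f \in Lfun mu 2%:E].

Definition L2norm (f : T -> R) : R := fine ('N[mu]_2%:E[EFin \o f])%E.

Definition L2dot (f g : T -> R) : R := \int[mu]_x (f x * g x).

Definition L2closure (D : set (T -> R)) : set (T -> R) :=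
  [set f | L2 f /\ forall e : R, 0 < e -> exists2 g, D g & L2norm (f \- g) < e].

End L2.

Record bform (R : realType) (T : Type) := BForm {
  fdom : set (T -> R) ;
  fval :> (T -> R) -> (T -> R) -> R }.

Section forms.
Context (R : realType) (X : ptopologicalType).
Variable mu : {measure set (borel X) -> \bar R}.
Implicit Types (E : bform R X) (f g h : X -> R) (u v : nat -> X -> R)
  (c e : R).

(* C_0[X]: continuous functions with compact support. *)
Definition Cc : set (X -> R) :=
  [set f | continuous f /\ compact (closure [set x | f x != 0])].

Definition form1 E f g : R := E f g + L2dot mu f g.

Definition dirichlet_form E : Prop :=
  [/\ [/\ fdom E `<=` L2 mu,
          (* E is defined on classes modulo equality almost everywhere *)
          forall f g, fdom E f -> L2 mu g -> (f = g %[ae mu]) ->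
            fdom E g /\ forall h, fdom E h -> E f h = E g h,
          forall c f g, fdom E f -> fdom E g -> fdom E (c \*o f \+ g)
        & L2 mu `<=` L2closure mu (fdom E)],
      [/\ forall c f g h, fdom E f -> fdom E g -> fdom E h ->
            E (c \*o f \+ g) h = c * E f h + E g h,
          forall f g, fdom E f -> fdom E g -> E f g = E g f
        & forall f, fdom E f -> 0 <= E f f],
      forall u, (forall n, fdom E (u n)) ->
        (forall e, 0 < e -> exists N, forall m n, (N <= m)%N -> (N <= n)%N ->
           form1 E (u m \- u n) (u m \- u n) < e) ->
        exists2 f, fdom E f &
          (fun n => form1 E (u n \- f) (u n \- f)) @ \oo --> (0 : R)
    & forall f, fdom E f ->
        let g := fun x => Num.min (Num.max (f x) 0) 1 in
        fdom E g /\ E g g <= E f f].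

Definition regular_dirichlet_form E : Prop :=
  [/\ dirichlet_form E,
      forall f, fdom E f -> forall e, 0 < e ->
        exists2 g, (fdom E `&` Cc) g & form1 E (f \- g) (f \- g) < e
    & forall f, Cc f -> forall e, 0 < e ->
        exists2 g, (fdom E `&` Cc) g & forall x, `|f x - g x| < e].

Definition form_approx E u f : Prop :=
  [/\ forall n, fdom E (u n),
      forall e, 0 < e -> exists N, forall m n, (N <= m)%N -> (N <= n)%N ->
        E (u m \- u n) (u m \- u n) < e
    & (fun n => L2norm mu (u n \- f)) @ \oo --> (0 : R)].

(* For a closable form, the limit in the definition of the value is independent
   of the approximating sequences. *)
Definition form_closure E : bform R X := BForm
  [set f | L2 mu f /\ exists u, form_approx E u f]
  (fun f g => xget 0 [set l : R | exists u v,
     [/\ form_approx E u f, form_approx E v g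
       & (fun n => E (u n) (v n)) @ \oo --> l]]).

(* [generator E h f] means that h is in Dom(Delta) and Delta h = f. *)
Definition generator E (h f : X -> R) : Prop :=
  [/\ fdom E h, L2 mu f & forall w, fdom E w -> E h w = L2dot mu f w].

End forms.

Definition op_dom (V : Type) (A : V -> V -> Prop) : set V :=
  [set h | exists f, A h f].

Definition op_restrict (V : Type) (A : V -> V -> Prop) (D : set V) (h f : V) :
  Prop := D h /\ A h f.

Section operators.
Context (R : realType) d (T : measurableType d).
Variable mu : {measure set T -> \bar R}.
Implicit Types (A : (T -> R) -> (T -> R) -> Prop) (H : set (T -> R)).

(* l is in the resolvent set of the operator A of the Hilbert space H when
   A - l maps Dom(A) onto H and has a bounded inverse (the bound entails the
   injectivity of A - l). *)
Definition resolvent_set H A : set R :=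
  [set l | (forall f, H f ->
              exists h k, A h k /\ (f = k \- l \*o h %[ae mu]))
        /\ (exists C, forall h k, A h k ->
              L2norm mu h <= C * L2norm mu (k \- l \*o h))].

Definition spectrum H A : set R := ~` resolvent_set H A.

End operators.

Section barlow_evans_forms.
Context (R : realType) (X : ptopologicalType) (s : barlow_evans X).
Variable mu : forall i, {measure set (borel (beF s i)) -> \bar R}.
Variable muG : forall i, probability (borel (beG s i)) R.
Variable muoo : {measure set (borel (beFoo s)) -> \bar R}.
Variable E0 : bform R X.

(* (E_i, \mathfrak{F}_i) *)
Fixpoint core_form (i : nat) : bform R (beF s i) :=
  match i return bform R (beF s i) with
  | 0 => BForm (fdom E0 `&` @Cc R X) E0
  | j.+1 => BForm
      [set f | Cc f /\ exists n (fk : 'I_n -> beF s j -> R)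
                              (hk : 'I_n -> beG s j -> R),
         [/\ forall k, fdom (core_form j) (fk k),
             forall k, continuous (hk k)
           & forall x g, f (bepi s j (x, g)) = \sum_(k < n) fk k x * hk k g]]
      (fun f h => \int[muG j]_g core_form j (fun x => f (bepi s j (x, g)))
                                            (fun x => h (bepi s j (x, g))))
  end.

(* (E_i, F_i) *)
Definition be_form (i : nat) : bform R (beF s i) :=
  match i return bform R (beF s i) with
  | 0 => E0
  | j.+1 => form_closure (mu j.+1) (core_form j.+1)
  end.

(* The value E_oo(Phi_i^* u, Phi_i^* v) = E_i(u, v) does not depend on the level
   i at which both arguments are represented. *)
Definition core_form_oo : bform R (beFoo s) := BForm
  [set f | exists i, exists2 u, fdom (core_form i) u & f = u \o bePhi s i]
  (fun f h => xget 0 [set l : R | exists i u v,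
     [/\ fdom (core_form i) u, fdom (core_form i) v,
         f = u \o bePhi s i, h = v \o bePhi s i & l = core_form i u v]]).

Definition be_form_oo : bform R (beFoo s) := form_closure muoo core_form_oo.

Definition Laplacian (i : nat) := generator (mu i) (be_form i).

Definition Laplacian_oo := generator muoo be_form_oo.

(* Phi_i^* D, as a set of elements of L^2(F_oo) *)
Definition pullback (i : nat) (D : set (beF s i -> R)) : set (beFoo s -> R) :=
  [set f | L2 muoo f /\ exists2 u, D u & f = u \o bePhi s i %[ae muoo]].

Definition orthogonal_part (S V : set (beFoo s -> R)) : set (beFoo s -> R) :=
  [set f | V f /\ forall g, S g -> L2dot muoo f g = 0].

(* D'_0 `|` ... `|` D'_(i-1) *)
Fixpoint Dprime_below (i : nat) : set (beFoo s -> R) :=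
  match i with
  | 0 => set0
  | j.+1 => Dprime_below j `|`
      orthogonal_part (Dprime_below j) (pullback (op_dom (@Laplacian j)))
  end.

Definition Dprime (i : nat) : set (beFoo s -> R) :=
  orthogonal_part (Dprime_below i) (pullback (op_dom (@Laplacian i))).

End barlow_evans_forms.

Arguments Laplacian {R X s} mu muG E0 i.

(* Main.v *)
Require Import Defs.
From HB Require Import structures.
From mathcomp Require Import all_boot all_order all_algebra.
From mathcomp Require Import all_classical all_reals all_analysis.
From mathcomp Require Import measurable_realfun ring lra.

Set Implicit Arguments.
Unset Strict Implicit.
Unset Printing Implicit Defensive.

Import Order.TTheory GRing.Theory Num.Theory.
Import numFieldNormedType.Exports.

Local Open Scope classical_set_scope.
Local Open Scope ring_scope.

(** Pull-back by the coordinate map [bePhi s i] embeds L^2(F_i) isometrically into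
L^2(F_oo); the images increase with i and their union is dense. The theorem is a
statement about such towers of Hilbert spaces, as soon as the embeddings carry the
graph of Delta_i into the graph of Delta_oo.

That they do ([op_pull]) comes from averaging over the fibres. For a function u of the
core of level j >= i there is a function q of the core of level i with
E_oo(Phi_i^* x, Phi_j^* u) = E_i(x, q) and <Phi_i^* x, Phi_j^* u> = <x, q> for all x in
the core of level i ([coreoo_project]): the same averaging operator is adjoint to the
pull-back for the forms and for the L^2 products. Testing E_i(h, q) = <Delta_i h, q>
against all u gives E_oo(Phi_i^* h, .) = <Phi_i^* Delta_i h, .> on the whole core at
infinity.

For the operators, let A be positive and self-adjoint. A real l is in the resolvent set
of A if and only if c |h| <= |(A - l) h| on the domain for some c > 0, since the
orthogonal of the range of A - l consists of eigenvectors ([regular_valueP]). If A is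
reduced by each image with restriction a_i, then such a bound for A passes to all the
a_i. Conversely, when the whole interval of radius d around l is in the resolvent set of
every a_i, the bound holds for a_i with the constant d ([lbound_gap]), which does not
depend on i; projecting onto the images and letting i grow gives the bound for A.
Hence the resolvent set of Delta_oo is the interior of the intersection of those of the
Delta_i ([tower_regular]), which is the first equality. For the second one, the image of
level i + 1 is the orthogonal sum of the image of level i and of the closure of
D'_(i+1), both reducing: by Pythagoras a bound on the sum amounts to a bound on each
summand, so that the spectrum of Delta_i is the union of the spectra of the increments
up to i ([increment_regular]).

Two choices shape the development. Elements of L^2 are functions and not classes, so
Hilbert spaces are modules with a semi-definite product, and equality of vectors is
replaced by nullity of the difference. And the closure of a closable form is never
constructed as a space: the core with the form as product is itself a pre-Hilbert space,
mapped into L^2, and the graph of the generator is described by sequences of the core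
([form_gen]), which the Riesz theorem produces directly ([approx_riesz]).

What this requires of the spaces F_i is gathered in [core_form_on]: the core consists of
compactly supported continuous functions, the form is closable on it, and the core
approximates the indicators of open sets in L^2. A regular Dirichlet form has these
properties ([core0_core]) and they pass from F_i to F_(i+1) ([step_core]); at infinity
density follows from the approximation of cylinders ([joo_dense]) and closability from
the adjoint of the pull-back ([joo_closable]). *)

(** * Spaces with a semi-definite product *)

(** The product is only semi-definite, so that square integrable functions form such a
    space without passing to classes: [null (x - y)] plays the role of equality. *)
Record prehilbert (R : realType) := PreHilbert {
  phsort :> lmodType R;
  dot : phsort -> phsort -> R;
  dotC : forall x y, dot x y = dot y x;
  dotP : forall a x y z, dot (a *: x + y) z = a * dot x z + dot y z;
  dot_ge0 : forall x, 0 <= dot x x }.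

Arguments dot {R p}.

Section prehilbert_theory.
Context {R : realType} {V : prehilbert R}.
Implicit Types (x y z : V) (u v : nat -> V).

Lemma dotDl x y z : dot (x + y) z = dot x z + dot y z.
Proof. by have := dotP 1 x y z; rewrite scale1r mul1r. Qed.

Lemma dot0l z : dot 0 z = 0.
Proof. by have := dotDl 0 0 z; rewrite addr0; lra. Qed.

Lemma dotZl a x z : dot (a *: x) z = a * dot x z.
Proof. by have := dotP a x 0 z; rewrite addr0 dot0l addr0. Qed.

Lemma dotNl x z : dot (- x) z = - dot x z.
Proof. by rewrite -scaleN1r dotZl mulN1r. Qed.

Lemma dotDr x y z : dot z (x + y) = dot z x + dot z y.
Proof. by rewrite dotC dotDl !(dotC z). Qed.

Lemma dot0r z : dot z 0 = 0. Proof. by rewrite dotC dot0l. Qed.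

Lemma dotZr a x z : dot z (a *: x) = a * dot z x.
Proof. by rewrite dotC dotZl dotC. Qed.

Lemma dotNr x z : dot z (- x) = - dot z x.
Proof. by rewrite dotC dotNl dotC. Qed.

Definition dotE := (dotDl, dotDr, dotZl, dotZr, dotNl, dotNr, dot0l, dot0r).

Definition nrm x : R := Num.sqrt (dot x x).

Definition null x : Prop := nrm x = 0.

Lemma nrm_ge0 x : 0 <= nrm x. Proof. exact: sqrtr_ge0. Qed.

Lemma sqr_nrm x : nrm x ^+ 2 = dot x x.
Proof. by rewrite sqr_sqrtr // dot_ge0. Qed.

Lemma ler_nrm x y : (nrm x <= nrm y) = (dot x x <= dot y y).
Proof. by rewrite ler_sqrt// dot_ge0. Qed.

Lemma dot_nrm_le x y : dot x y <= nrm x * nrm y.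
Proof.
have [x0|x0] := eqVneq (nrm x) 0.
  have xx : dot x x = 0 by rewrite -sqr_nrm x0 expr0n.
  rewrite x0 mul0r leNgt; apply/negP => xy.
  (* x has norm 0: moving y far enough along x would make its square norm negative *)
  have := dot_ge0 (- ((dot y y + 1) / dot x y) *: x + y).
  rewrite !dotE xx (dotC y x).
  have -> : - ((dot y y + 1) / dot x y) * dot x y = - (dot y y + 1).
    by rewrite mulNr divfK// gt_eqF.
  by have := dot_ge0 y; lra.
have xp : 0 < nrm x by rewrite lt_neqAle eq_sym x0 nrm_ge0.
have [xy|xy] := leP (dot x y) 0.
  by rewrite (le_trans xy)// mulr_ge0// nrm_ge0.
rewrite -(@ler_pXn2r _ 2)// ?nnegrE ?mulr_ge0 ?nrm_ge0 ?(ltW xy)//.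
rewrite exprMn !sqr_nrm.
have := dot_ge0 (- (dot x y / dot x x) *: x + y).
have xx : 0 < dot x x by rewrite -sqr_nrm exprn_gt0.
rewrite !dotE (dotC y x).
have -> : - (dot x y / dot x x) * (- (dot x y / dot x x) * dot x x)
  = dot x y ^+ 2 / dot x x by field; rewrite gt_eqF.
have -> : - (dot x y / dot x x) * dot x y = - (dot x y ^+ 2 / dot x x).
  by field; rewrite gt_eqF.
by rewrite subrr add0r addrC subr_ge0 ler_pdivrMr// mulrC.
Qed.

Lemma dot_norm_le x y : `|dot x y| <= nrm x * nrm y.
Proof.
rewrite ler_norml dot_nrm_le andbT lerNl -dotNl.
apply: (le_trans (dot_nrm_le _ _)).
by rewrite {1}/nrm dotNl dotNr opprK.
Qed.

Lemma nrm0 : nrm 0 = 0. Proof. by rewrite /nrm dot0l sqrtr0. Qed.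

Lemma nrmN x : nrm (- x) = nrm x.
Proof. by rewrite /nrm dotNl dotNr opprK. Qed.

Lemma nrmZ a x : nrm (a *: x) = `|a| * nrm x.
Proof.
by rewrite /nrm dotZl dotZr mulrA -expr2 sqrtrM ?sqr_ge0// sqrtr_sqr.
Qed.

Lemma nrm_le_sq x c : 0 <= c -> (nrm x <= c) = (dot x x <= c ^+ 2).
Proof.
by move=> c0; rewrite -(@ler_pXn2r _ 2)// ?nnegrE ?nrm_ge0// sqr_nrm.
Qed.

Lemma nrm_lt_sq x c : 0 <= c -> (nrm x < c) = (dot x x < c ^+ 2).
Proof.
by move=> c0; rewrite -(@ltr_pXn2r _ 2)// ?nnegrE ?nrm_ge0// sqr_nrm.
Qed.

Lemma nrmD x y : nrm (x + y) <= nrm x + nrm y.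
Proof.
rewrite nrm_le_sq ?addr_ge0 ?nrm_ge0// !dotE (dotC y x) sqrrD !sqr_nrm.
by have := dot_nrm_le x y; lra.
Qed.

Lemma nrmB x y : nrm (x - y) = nrm (y - x).
Proof. by rewrite -nrmN opprB. Qed.

Lemma nrm_tri z x y : nrm (x - y) <= nrm (x - z) + nrm (z - y).
Proof. by rewrite -[x - y](@subrKA _ z) nrmD. Qed.

Lemma nrm_sub x y : nrm x - nrm y <= nrm (x - y).
Proof. by rewrite lerBlDr; have := nrmD (x - y) y; rewrite subrK. Qed.

Lemma null_dot x y : null x -> dot x y = 0.
Proof.
move=> x0; apply/eqP; rewrite -normr_le0.
by apply: (le_trans (dot_norm_le _ _)); rewrite x0 mul0r.
Qed.

Lemma nullP x : null x <-> dot x x = 0.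
Proof.
split=> [|xx]; first exact: null_dot.
by rewrite /null /nrm xx sqrtr0.
Qed.

Lemma null0 : null 0. Proof. exact: nrm0. Qed.

Lemma nullD x y : null x -> null y -> null (x + y).
Proof.
rewrite /null => x0 y0; apply/eqP; rewrite eq_le nrm_ge0 andbT.
by have := nrmD x y; rewrite x0 y0 addr0.
Qed.

Lemma nullZ a x : null x -> null (a *: x).
Proof. by rewrite /null nrmZ => ->; rewrite mulr0. Qed.

Lemma nullN x : null x -> null (- x).
Proof. by rewrite /null nrmN. Qed.

Lemma nullB x y : null x -> null y -> null (x - y).
Proof. by move=> ? ?; apply: nullD => //; exact: nullN. Qed.

Lemma null_sym x y : null (x - y) -> null (y - x).
Proof. by rewrite /null nrmB. Qed.

Lemma null_small x : (forall e, 0 < e -> nrm x <= e) -> null x.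
Proof.
move=> h; apply/eqP; rewrite eq_le nrm_ge0 andbT.
by apply/ler_addgt0Pl => e e0; rewrite addr0 h.
Qed.

Lemma null_dot_eq x y z : null (x - y) -> dot x z = dot y z.
Proof.
by move=> /null_dot => /(_ z); rewrite dotDl dotNl => /eqP; rewrite subr_eq0 => /eqP.
Qed.

Lemma null_nrm_eq x y : null (x - y) -> nrm x = nrm y.
Proof.
move=> h; rewrite /nrm (null_dot_eq _ h) [dot y x]dotC.
by rewrite (null_dot_eq _ h).
Qed.

Lemma pythagoras x y : dot x y = 0 -> dot (x + y) (x + y) = dot x x + dot y y.
Proof. by move=> xy; rewrite !dotE (dotC y x) xy addr0 add0r. Qed.

Definition cauchy u : Prop := forall e, 0 < e ->
  exists N, forall m n, (N <= m)%N -> (N <= n)%N -> nrm (u m - u n) < e.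

Definition tends u x : Prop := forall e, 0 < e ->
  exists N, forall n, (N <= n)%N -> nrm (u n - x) < e.

Lemma tends_cauchy u x : tends u x -> cauchy u.
Proof.
move=> ux e e0; have [N hN] := ux (e / 2) ltac:(lra).
exists N => m n Nm Nn; rewrite (le_lt_trans (nrm_tri x _ _))//.
by have := hN m Nm; have := hN n Nn; rewrite (nrmB x); lra.
Qed.

Lemma cauchy_bounded u : cauchy u ->
  exists2 M, 0 < M & exists N, forall n, (N <= n)%N -> nrm (u n) <= M.
Proof.
move=> cu; have [N hN] := cu 1 ltr01.
exists (1 + nrm (u N)); first by rewrite ltr_pwDl// nrm_ge0.
exists N => n Nn; have := hN n N Nn (leqnn _); have := nrm_sub (u n) (u N); lra.
Qed.

Lemma tends_unique u x y : tends u x -> tends u y -> null (x - y).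
Proof.
move=> ux uy; apply: null_small => e e0.
have [N hN] := ux (e / 2) ltac:(lra); have [M hM] := uy (e / 2) ltac:(lra).
have := hN (maxn N M) (leq_maxl _ _); have := hM (maxn N M) (leq_maxr _ _).
by have := nrm_tri (u (maxn N M)) x y; rewrite (nrmB x (u _)); lra.
Qed.

End prehilbert_theory.

Definition complete_ph (R : realType) (V : prehilbert R) : Prop :=
  forall u : nat -> V, cauchy u -> exists x, tends u x.

Definition rtends (R : realType) (a : nat -> R) (l : R) : Prop :=
  forall e, 0 < e -> exists N, forall n, (N <= n)%N -> `|a n - l| < e.

Section rtends.
Context {R : realType}.
Implicit Types (a b : nat -> R).

Lemma rtends_unique a l l' : rtends a l -> rtends a l' -> l = l'.
Proof.
move=> al al'; apply/eqP; rewrite -subr_eq0 -normr_le0.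
apply/ler_addgt0Pl => e e0; rewrite addr0.
have [N hN] := al (e / 2) ltac:(lra); have [M hM] := al' (e / 2) ltac:(lra).
have := hN (maxn N M) (leq_maxl _ _); have := hM (maxn N M) (leq_maxr _ _).
have := ler_distD (a (maxn N M)) l l'.
by rewrite (distrC l (a _)); lra.
Qed.

Lemma rtendsD a b l l' : rtends a l -> rtends b l' ->
  rtends (fun n => a n + b n) (l + l').
Proof.
move=> al bl e e0.
have [N hN] := al (e / 2) ltac:(lra); have [M hM] := bl (e / 2) ltac:(lra).
exists (maxn N M) => n; rewrite geq_max => /andP[/hN h1 /hM h2].
rewrite opprD addrACA (le_lt_trans (ler_normD _ _))//; lra.
Qed.

Lemma rtends_cst (l : R) : rtends (fun=> l) l.
Proof. by move=> e e0; exists 0%N => n _; rewrite subrr normr0. Qed.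

Lemma rtendsZ (c : R) a l : rtends a l -> rtends (fun n => c * a n) (c * l).
Proof.
move=> al e e0.
have [N hN] := al (e / (`|c| + 1)) ltac:(by rewrite divr_gt0// ltr_wpDl).
exists N => n /hN; rewrite -mulrBr normrM => h.
apply: (@le_lt_trans _ _ ((`|c| + 1) * `|a n - l|)).
  by rewrite ler_wpM2r// lerDl.
by rewrite mulrC -ltr_pdivlMr// ltr_wpDl.
Qed.

Lemma rtends_sum (n : nat) (a : 'I_n -> nat -> R) (l : 'I_n -> R) :
  (forall k, rtends (a k) (l k)) -> rtends (fun m => \sum_k a k m) (\sum_k l k).
Proof.
elim: n a l => [|n ih] a l h.
  rewrite big_ord0 (_ : (fun _ => _) = fun=> 0); first exact: rtends_cst.
  by apply/funext => m; rewrite big_ord0.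
rewrite big_ord_recl (_ : (fun _ => _) =
  fun m => a ord0 m + \sum_k a (lift ord0 k) m); last first.
  by apply/funext => m; rewrite big_ord_recl.
by apply: rtendsD => //; exact: ih.
Qed.

Lemma rtends_ge0 a l : (forall n, 0 <= a n) -> rtends a l -> 0 <= l.
Proof.
move=> a0 al; rewrite leNgt; apply/negP => l0.
have [N hN] := al (- l) ltac:(lra); have := hN N (leqnn _).
by have := a0 N; have := ler_norm (a N - l); lra.
Qed.

Lemma rtends_dot (V : prehilbert R) (u : nat -> V) x y :
  tends u x -> rtends (fun n => dot (u n) y) (dot x y).
Proof.
move=> ux e e0.
have y1 : 0 < nrm y + 1 by rewrite ltr_wpDl// nrm_ge0.
have [N hN] := ux (e / (nrm y + 1)) ltac:(by rewrite divr_gt0).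
exists N => n /hN h; rewrite -dotNl -dotDl (le_lt_trans (dot_norm_le _ _))//.
apply: (@le_lt_trans _ _ (nrm (u n - x) * (nrm y + 1))).
  by rewrite ler_wpM2l// ?nrm_ge0// lerDl.
by rewrite -ltr_pdivlMr.
Qed.

End rtends.

(** A bounded functional l is represented by a minimizing sequence of
    dot u u - 2 * l u: the parallelogram law makes it Cauchy, and the first variation at
    the infimum makes the products converge to l. When K is the core of a form this
    sequence is exactly what describes an element of the domain of the closure. *)
Section riesz.
Context {R : realType} {K : prehilbert R}.
Variable l : K -> R.
Hypothesis linl : forall a x y, l (a *: x + y) = a * l x + l y.
Hypothesis bndl : exists M, forall u : K, M <= dot u u - 2 * l u.

Lemma approx_riesz : exists u : nat -> K,
  cauchy u /\ forall w, rtends (fun n => dot (u n) w) (l w).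
Proof.
have lD x y : l (x + y) = l x + l y by have := linl 1 x y; rewrite scale1r mul1r.
have l0 : l 0 = 0 by have := lD 0 0; rewrite addr0; lra.
have lZ a x : l (a *: x) = a * l x by have := linl a x 0; rewrite addr0 l0 addr0.
pose J (u : K) := dot u u - 2 * l u.
have [M hM] := bndl.
have hi : has_inf (range J).
  by split; [exists (J 0), 0 | exists M => _ [u _ <-]; exact: hM].
set m := inf (range J).
have mJ u : m <= J u by apply: ge_inf; [exact: hi.2 | exists u].
have /choice[u hu] : forall n : nat, exists u, J u < m + n.+1%:R^-1.
  move=> n; have e0 : 0 < (n.+1%:R : R)^-1 by rewrite invr_gt0 ltr0n.
  by have [_ [u _ <-] h] := inf_adherent e0 hi; exists u.
exists u.
have small e : 0 < e -> exists N, forall n, (N <= n)%N -> J (u n) < m + e.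
  move=> e0; exists (Num.trunc e^-1) => n Nn; apply: (lt_trans (hu n)).
  rewrite ltrD2l invf_plt ?posrE ?ltr0n//.
  apply: (lt_le_trans (truncnS_gt _)).
  by rewrite ler_nat ltnS.
split.
  move=> e e0; have e4 : 0 < e ^+ 2 / 4 by rewrite divr_gt0// exprn_gt0.
  have [N hN] := small _ e4; exists N => p q Np Nq.
  rewrite nrm_lt_sq ?(ltW e0)//.
  have := mJ (2^-1 *: (u p + u q)); have := hN p Np; have := hN q Nq.
  rewrite /J !dotE lZ lD (dotC (u q) (u p)); lra.
move=> w e e0.
(* comparing u n with u n - (d / c) w bounds the defect d = dot (u n) w - l w *)
pose c := dot w w + 1.
have c0 : 0 < c by rewrite ltr_wpDl// dot_ge0.
have e2 : 0 < e ^+ 2 / c by rewrite divr_gt0// exprn_gt0.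
have [N hN] := small _ e2; exists N => n /hN Jn.
set d := dot (u n) w - l w.
have := mJ (u n + (- (d / c)) *: w).
rewrite /J in Jn *; rewrite !dotE lD lZ (dotC w (u n)).
have -> : dot (u n) w = d + l w by rewrite /d subrK.
have -> : dot w w = c - 1 by rewrite /c addrK.
have -> : - (d / c) * (- (d / c) * (c - 1)) = d ^+ 2 / c - (d / c) ^+ 2.
  by field; rewrite gt_eqF.
have -> : 2 * (l (u n) + - (d / c) * l w) = 2 * l (u n) - 2 * (d / c) * l w by ring.
have -> : - (d / c) * (d + l w) = - (d ^+ 2 / c) - (d / c) * l w by field; rewrite gt_eqF.
have dc := sqr_ge0 (d / c).
move=> h; have : d ^+ 2 / c < e ^+ 2 / c by lra.
rewrite ltr_pM2r ?invr_gt0// => dd.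
by rewrite -(@ltr_pXn2r _ 2)// ?nnegrE ?(ltW e0)// -normrX ger0_norm// sqr_ge0.
Qed.

End riesz.

(** * Positive self-adjoint operators *)

(** Subspaces are bundled so that their elements form a module, which is then given
    another product than the one of the ambient space. *)
Record linset (R : realType) (V : lmodType R) := LinSet {
  lset :> V -> Prop ;
  lset0 : lset 0 ;
  lsetP : forall a x y, lset x -> lset y -> lset (a *: x + y) }.

Section sublmod.
Context {R : realType} {V : lmodType R}.

Definition linset_pred (D : linset V) : {pred V} := mem (lset D : set V).

Lemma linset_closed (D : linset V) : submod_closed (linset_pred D).
Proof.
split=> [|a x y]; rewrite /linset_pred !inE; first exact: lset0.
exact: lsetP.
Qed.

HB.instance Definition _ (D : linset V) :=
  GRing.isSubmodClosed.Build R V (linset_pred D) (linset_closed D).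

Record sublmod (D : linset V) := SubLmod {
  slval :> V ; slvalP : slval \in linset_pred D }.

HB.instance Definition _ (D : linset V) := [isSub for @slval D].
HB.instance Definition _ (D : linset V) := [Choice of sublmod D by <:].
HB.instance Definition _ (D : linset V) :=
  [SubChoice_isSubLmodule of sublmod D by <:].

Lemma sublmod_in (D : linset V) (x : sublmod D) : D (\val x).
Proof. by have := valP x; rewrite inE. Qed.

Definition insl (D : linset V) (x : V) (Dx : D x) : sublmod D :=
  SubLmod (mem_set Dx : x \in linset_pred D).

End sublmod.

Lemma sub_dotP (R : realType) (V : prehilbert R) (D : linset V) a
  (x y z : sublmod D) :
  dot (\val (a *: x + y)) (\val z) = a * dot (\val x) (\val z) + dot (\val y) (\val z).
Proof. by rewrite linearP dotP. Qed.

Definition subph (R : realType) (V : prehilbert R) (D : linset V) : prehilbert R :=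
  @PreHilbert R (sublmod D) (fun x y => dot (\val x) (\val y))
    (fun x y => dotC _ _) (@sub_dotP R V D) (fun x => dot_ge0 _).

Lemma subph_nrmB (R : realType) (V : prehilbert R) (D : linset V) (x y : subph D) :
  nrm (x - y) = nrm (\val x - \val y).
Proof. by rewrite -linearB. Qed.

(** The projection is the limit in V of the sequence that represents [dot f] on D; it
    belongs to the closure of D. *)
Lemma projection (R : realType) (V : prehilbert R) (D : linset V) (f : V) :
  complete_ph V -> exists p : V, (forall d, D d -> dot (f - p) d = 0) /\
    forall e, 0 < e -> exists2 d, D d & nrm (p - d) < e.
Proof.
move=> cV; have [||u [cu uw]] := @approx_riesz R (subph D) (fun x => dot f (\val x)).
- by move=> a x y; rewrite linearP dotDr dotZr.
- exists (- dot f f) => x /=.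
  have := dot_ge0 (f - \val x); rewrite !dotE (dotC (\val x) f); lra.
have [|p up] := cV (fun n => \val (u n)).
  move=> e e0; have [N hN] := cu e e0; exists N => m n Nm Nn.
  by have := hN m n Nm Nn; rewrite subph_nrmB.
exists p; split=> [d Dd|e e0].
  rewrite dotDl dotNl; apply/eqP; rewrite subr_eq0; apply/eqP.
  exact: rtends_unique (uw (insl Dd)) (rtends_dot d up).
have [N hN] := up e e0; exists (\val (u N)); first exact: sublmod_in.
by rewrite nrmB; exact: hN.
Qed.

Lemma subr_swap (V : zmodType) (x y z t : V) : (x - y) - (z - t) = (x - z) - (y - t).
Proof. by rewrite !opprD !opprK addrACA. Qed.

Section selfadjoint.
Context {R : realType} {V : prehilbert R}.
Implicit Types (H : set V) (A : V -> V -> Prop) (h k f : V) (l c e : R).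

Definition rclosure H : set V :=
  [set x | forall e, 0 < e -> exists2 y, H y & nrm (x - y) < e].

Definition closed_subspace H : Prop :=
  [/\ H 0, (forall a x y, H x -> H y -> H (a *: x + y)) & rclosure H `<=` H].

(** A positive self-adjoint operator of H, given by its graph up to null vectors. For a
    positive symmetric operator, self-adjointness amounts to the surjectivity of A + 1,
    which is [sa_surj]. *)
Record selfadjoint H A : Prop := SelfAdjoint {
  sa_sub : forall h k, A h k -> H h /\ H k ;
  sa_lin : forall a h k h' k', A h k -> A h' k' ->
    A (a *: h + h') (a *: k + k') ;
  sa_sym : forall h k h' k', A h k -> A h' k' -> dot k h' = dot h k' ;
  sa_ge0 : forall h k, A h k -> 0 <= dot k h ;
  sa_sat : forall h k h' k', A h k -> null (h - h') -> null (k - k') -> A h' k' ;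
  sa_surj : forall f, H f -> exists h, A h (f - h) ;
  sa_fun : forall h k, A h k -> null h -> null k }.

Definition lbound A l c := forall h k, A h k -> c * nrm h <= nrm (k - l *: h).

Lemma lbound_le A l c c' : c <= c' -> lbound A l c' -> lbound A l c.
Proof.
by move=> cc lb h k /lb; apply: le_trans; rewrite ler_wpM2r// nrm_ge0.
Qed.

(** For self-adjoint operators this is membership in the resolvent set, see
    [regular_valueP]. *)
Definition regular_value A l : Prop := exists2 e, 0 < e & lbound A l e.

Section theory.
Variables (H : set V) (A : V -> V -> Prop).
Hypothesis cH : closed_subspace H.
Hypothesis sA : selfadjoint H A.

Lemma cs_lin a x y : H x -> H y -> H (a *: x + y). Proof. by case: cH => _ + _; exact. Qed.

Lemma cs_sub x y : H x -> H y -> H (x - y).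
Proof. by move=> Hx Hy; rewrite addrC -scaleN1r; exact: cs_lin. Qed.

Lemma cs_scale a x : H x -> H (a *: x).
Proof. by move=> Hx; rewrite -[a *: x]addr0; apply: cs_lin => //; case: cH. Qed.

Lemma sa_00 : A 0 0.
Proof.
have [h Ah] := sa_surj sA (let: And3 h _ _ := cH in h).
by have := sa_lin sA (-1) Ah Ah; rewrite !scaleN1r !addNr.
Qed.

Lemma sa_diff h k h' k' : A h k -> A h' k' -> A (h - h') (k - k').
Proof.
by move=> a b; have := sa_lin sA (-1) b a; rewrite !scaleN1r addrC [_ + k]addrC.
Qed.

Lemma sa_bound h k : A h k -> nrm h <= nrm (k + h).
Proof.
move=> Ahk; rewrite ler_nrm !dotE (dotC h k).
by have := sa_ge0 sA Ahk; have := dot_ge0 k; lra.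
Qed.

Lemma sa_inj h k h' k' : A h k -> A h' k' -> null (k + h - (k' + h')) ->
  null (h - h') /\ null (k - k').
Proof.
move=> a b n; have d := sa_diff a b.
have hh : null (h - h').
  apply/eqP; rewrite eq_le nrm_ge0 andbT (le_trans (sa_bound d))//.
  by rewrite (_ : _ + _ = k + h - (k' + h')) ?n// opprD addrACA.
by split=> //; exact: sa_fun sA _ _ d hh.
Qed.

(** If g solves A g = k + h - g exactly, positivity bounds g - h by the error of the
    approximation of (h, k) by the graph. *)
Lemma sa_closed (u v : nat -> V) h k : H h -> H k ->
  (forall n, A (u n) (v n)) -> tends u h -> tends v k -> A h k.
Proof.
move=> Hh Hk Auv uh vk.
have Hkh : H (k + h) by rewrite -[k]scale1r; apply: cs_lin.
have [g Ag] := sa_surj sA Hkh.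
suff gh : null (g - h).
  apply: (sa_sat sA Ag gh).
  rewrite (_ : _ - k = - (g - h)); first exact: nullN.
  by rewrite opprB addrC addrA addKr.
apply: null_small => e e0.
have [N hN] := uh (e / 3) ltac:(lra); have [M hM] := vk (e / 3) ltac:(lra).
set n := maxn N M.
have hn := hN n (leq_maxl _ _); have kn := hM n (leq_maxr _ _).
have := sa_bound (sa_diff Ag (Auv n)).
have -> : k + h - g - v n + (g - u n) = (k - v n) + (h - u n).
  by rewrite [X in X + _]addrAC subrKA (addrAC k h) -(addrA _ h).
move=> b; have := nrm_tri (u n) g h; have := nrmD (k - v n) (h - u n).
by rewrite (nrmB k) (nrmB h (u n)); lra.
Qed.

(** Write y = A h + h: then 0 = dot y h = dot (A h) h + dot h h, so h is null. *)
Lemma sa_dense y : H y -> (forall h k, A h k -> dot y h = 0) -> null y.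
Proof.
move=> Hy yA; have [h Ah] := sa_surj sA Hy.
have hh : null h.
  apply/nullP; have := yA _ _ Ah; have := sa_ge0 sA Ah.
  by rewrite dotDl dotNl; have := dot_ge0 h; lra.
by have := nullD (sa_fun sA Ah hh) hh; rewrite subrK.
Qed.

Lemma sa_dom_dense : complete_ph V ->
  forall y e, H y -> 0 < e -> exists h k, A h k /\ nrm (y - h) < e.
Proof.
move=> cV y e Hy e0.
pose D := @LinSet R V [set h | exists k, A h k] (ex_intro _ 0 sa_00)
  (fun a x y hx hy => let: ex_intro k p := hx in let: ex_intro k' p' := hy in
     ex_intro _ (a *: k + k') (sa_lin sA a p p')).
have [p [yp pD]] := @projection R V D y cV.
have Hp : H p.
  case: cH => _ _; apply => d d0; have [x [k /(sa_sub sA)[Hx _]] px] := pD d d0.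
  by exists x.
have n : null (y - p).
  by apply: sa_dense => [|h k Ahk]; [exact: cs_sub | apply: yp; exists k].
have [h [k Ahk] ph] := pD e e0; exists h, k; split=> //.
by rewrite (le_lt_trans (nrm_tri p _ _))// n add0r.
Qed.

Let range_set l : V -> Prop := fun g => exists h k, A h k /\ g = k - l *: h.

Let range0 l : range_set l 0.
Proof. by exists 0, 0; split; [exact: sa_00 | rewrite scaler0 subr0]. Qed.

Let rangeP l a x y : range_set l x -> range_set l y -> range_set l (a *: x + y).
Proof.
move=> [h [k [Ahk ->]]] [h' [k' [Ahk' ->]]].
exists (a *: h + h'), (a *: k + k'); split; first exact: (sa_lin sA).
by rewrite scalerBr scalerDr !scalerA opprD addrACA (mulrC l).
Qed.

Let range_linset l := LinSet (range0 l) (@rangeP l).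

(** The bound makes the range closed. A vector orthogonal to it is an eigenvector, by
    self-adjointness, hence is null by the bound. *)
Lemma lbound_surj l c : complete_ph V -> 0 < c -> lbound A l c ->
  forall f, H f -> exists h, A h (f + l *: h).
Proof.
move=> cV c0 lb f Hf.
have [p [fp pD]] := @projection R V (range_linset l) f cV.
have Hp : H p.
  case: cH => _ _; apply => d d0; have [x [h [k [/(sa_sub sA)[Hh Hk] ->]]] px] := pD d d0.
  by exists (k - l *: h) => //; apply: cs_sub => //; exact: cs_scale.
move: fp; move yE : (f - p) => y fp.
have Hy : H y by rewrite -yE; exact: cs_sub.
(* y is orthogonal to the range, hence an eigenvector of A *)
have yr h k : A h k -> dot y k = l * dot y h.
  move=> Ahk; have := fp (k - l *: h) ltac:(by exists h, k).
  by rewrite !dotE; lra.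
have Ay : A y (l *: y).
  have [h0 Ah0] := sa_surj sA (cs_scale (l + 1) Hy).
  have n : null (h0 - y).
    apply/nullP; have [h Ah] := sa_surj sA (cs_sub (proj1 (sa_sub sA Ah0)) Hy).
    have := sa_sym sA Ah Ah0; have := yr _ _ Ah.
    rewrite !dotE (dotC h0 y) (dotC h y); lra.
  apply: (sa_sat sA Ah0) => //.
  by rewrite scalerDl scale1r -(addrA (l *: y) y) (addrC (l *: y) (y - _)) addrK; exact: null_sym.
have yn : null y.
  apply/eqP; rewrite eq_le nrm_ge0 andbT -(pmulr_rle0 _ c0).
  by rewrite (le_trans (lb _ _ Ay))// subrr nrm0.
have /choice[u hu] : forall n : nat, exists u : V * V, A u.1 u.2 /\
    nrm (p - (u.2 - l *: u.1)) < n.+1%:R^-1.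
  move=> n; have [g [h [k [Ahk ->]]] pg] := pD (n.+1%:R^-1) ltac:(by rewrite invr_gt0 ltr0n).
  by exists (h, k).
have rp : tends (fun n => (u n).2 - l *: (u n).1) p.
  move=> e e0; exists (Num.trunc e^-1) => n Nn; rewrite nrmB.
  apply: (lt_trans (hu n).2); rewrite invf_plt ?posrE ?ltr0n//.
  by apply: (lt_le_trans (truncnS_gt _)); rewrite ler_nat ltnS.
have [h uh] : exists h, tends (fun n => (u n).1) h.
  apply: cV => e e0; have [N hN] := tends_cauchy rp (mulr_gt0 c0 e0).
  exists N => m n Nm Nn; rewrite -(ltr_pM2l c0).
  apply: le_lt_trans (hN m n Nm Nn).
  apply: (le_trans (lb _ _ (sa_diff (hu m).1 (hu n).1))).
  by rewrite scalerBr subr_swap.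
exists h.
have Hh : H h.
  case: cH => _ _; apply => e e0; have [N hN] := uh e e0.
  exists (u N).1; first exact: (proj1 (sa_sub sA (hu N).1)).
  by rewrite nrmB; exact: hN.
have Ahp : A h (p + l *: h).
  apply: (sa_closed Hh _ (fun n => (hu n).1) uh).
    by rewrite addrC; exact: cs_lin.
  move=> e e0; have l1 : 0 < `|l| + 1 by rewrite ltr_wpDl.
  have [N hN] := uh (e / 2 / (`|l| + 1)) ltac:(by rewrite divr_gt0// divr_gt0).
  have [M hM] := rp (e / 2) ltac:(by rewrite divr_gt0).
  exists (maxn N M) => n; rewrite geq_max => /andP[/hN h1 /hM h2].
  have -> : (u n).2 - (p + l *: h) = ((u n).2 - l *: (u n).1 - p) + l *: ((u n).1 - h).
    by rewrite scalerBr (addrAC _ (- (l *: _)) (- p)) subrKA opprD addrA.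
  have := nrmD ((u n).2 - l *: (u n).1 - p) (l *: ((u n).1 - h)).
  rewrite nrmZ; move: h1; rewrite ltr_pdivlMr// => h1.
  by have := nrm_ge0 ((u n).1 - h); nra.
apply: (sa_sat sA Ahp); first by rewrite subrr; exact: null0.
by rewrite opprD addrACA subrr addr0; apply: null_sym; rewrite yE.
Qed.

Lemma lbound_shift l l' c : lbound A l c -> lbound A l' (c - `|l' - l|).
Proof.
move=> lb h k Ahk; rewrite mulrBl.
have := lb _ _ Ahk; have := nrm_sub (k - l *: h) (k - l' *: h).
have -> : k - l *: h - (k - l' *: h) = (l' - l) *: h.
  by rewrite subr_swap subrr sub0r opprB scalerBl.
by rewrite nrmZ; lra.
Qed.

(** Since A - l - c and A - l + c are bounded below, so is their product
    (A - l)^2 - c^2, and |(A - l) h| exceeds c |h| by a fixed proportion. In order to stay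
    in the domain the product is applied to h' = (A - l)^-1 h, and g = (A - l + c) h'. *)
Lemma lbound_improve l c e : complete_ph V -> 0 < c -> 0 < e -> lbound A l c ->
  lbound A (l + c) e -> lbound A (l - c) e -> exists2 c', c < c' & lbound A l c'.
Proof.
move=> cV c0 e0 lb lbp lbm.
pose t := (1 + c ^+ 2 / e ^+ 2)^-1.
have q0 : 0 < 1 + c ^+ 2 / e ^+ 2 by rewrite ltr_wpDr// divr_ge0// exprn_ge0// ltW.
have t0 : 0 < t by rewrite invr_gt0.
exists (c * Num.sqrt (1 + t ^+ 2)).
  rewrite ltr_pMr// -[ltLHS]sqrtr1 ltr_sqrt ?ltrDl ?exprn_gt0//.
  by rewrite addr_gt0// exprn_gt0.
move=> h k Ahk; move fE : (k - l *: h) => f.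
have [h' Ah'] := lbound_surj cV c0 lb (proj1 (sa_sub sA Ahk)).
have ff : dot f h' = dot h h.
  have := sa_sym sA Ahk Ah'; rewrite -fE !dotE; lra.
have hh' : c * nrm h' <= nrm h by have := lb _ _ Ah'; rewrite addrK.
set g := h + c *: h'.
have Ag : A g (k + c *: (h + l *: h')) by rewrite /g addrC [k + _]addrC; exact: (sa_lin sA).
have b1 : e * nrm g <= nrm (f - c ^+ 2 *: h').
  have := lbp _ _ Ag; congr (_ <= nrm _); rewrite /g -fE.
  have -> : (l + c) *: (h + c *: h') = c *: (h + l *: h') + (l *: h + c ^+ 2 *: h').
    rewrite !scalerDr !scalerDl !scalerA -expr2 (mulrC c l).
    by rewrite (addrC (l *: h) (c *: h)) addrACA.
  by rewrite opprD addrA addrK opprD addrA.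
have b2 : e * nrm h' <= nrm g.
  have := lbm _ _ Ah'; congr (_ <= nrm _).
  by rewrite /g scalerBl opprB addrA addrAC addrK.
have e20 : 0 < e ^+ 2 by rewrite exprn_gt0.
set D := nrm (f - c ^+ 2 *: h') in b1.
have b3 : e ^+ 2 * nrm h' <= D.
  by rewrite expr2 -mulrA (le_trans _ b1)// ler_pM2l.
have b4 : D ^+ 2 <= nrm f ^+ 2 - c ^+ 2 * nrm h ^+ 2.
  rewrite !sqr_nrm /D !dotE (dotC h' f) ff.
  have : c ^+ 2 * dot h' h' <= dot h h.
    rewrite -!sqr_nrm -exprMn ler_pXn2r// ?nnegrE ?mulr_ge0 ?nrm_ge0//.
    exact: ltW.
  have : 0 < c ^+ 2 by rewrite exprn_gt0.
  nra.
have b5 : nrm f <= t^-1 * D.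
  have : nrm f <= D + c ^+ 2 * nrm h'.
    have := nrm_sub f (c ^+ 2 *: h').
    by rewrite nrmZ ger0_norm ?exprn_ge0 ?(ltW c0)// lerBlDr.
  move=> /le_trans; apply; rewrite /t invrK mulrDl mul1r lerD2l -[leRHS]mulrA.
  by rewrite ler_pM2l ?exprn_gt0// [leRHS]mulrC ler_pdivlMr// mulrC.
have b6 : t * nrm f <= D by rewrite mulrC -ler_pdivlMr// [leRHS]mulrC.
rewrite -(@ler_pXn2r _ 2)// ?nnegrE ?nrm_ge0 ?mulr_ge0 ?nrm_ge0 ?sqrtr_ge0 ?(ltW c0)//.
rewrite exprMn exprMn sqr_sqrtr ?addr_ge0 ?exprn_ge0 ?(ltW t0)//.
have b7 : t ^+ 2 * nrm f ^+ 2 <= D ^+ 2.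
  by rewrite -exprMn ler_pXn2r// ?nnegrE ?mulr_ge0 ?nrm_ge0 ?(ltW t0).
have b8 : c ^+ 2 * nrm h ^+ 2 <= nrm f ^+ 2.
  rewrite -exprMn ler_pXn2r// ?nnegrE ?mulr_ge0 ?nrm_ge0 ?(ltW c0)//.
  by rewrite -fE; exact: lb.
have : t ^+ 2 * (c ^+ 2 * nrm h ^+ 2) <= t ^+ 2 * nrm f ^+ 2.
  by rewrite ler_pM2l// exprn_gt0.
move: b4 b7; set x := nrm f ^+ 2; set z := c ^+ 2 * nrm h ^+ 2; set w := t ^+ 2.
rewrite mulrAC -/z; lra.
Qed.

(** The norm of the resolvent at l is at most the inverse of the distance to the
    spectrum: the best constant is attained and, were it less than d, [lbound_improve]
    would give a better one. *)
Lemma lbound_gap l d : complete_ph V -> 0 < d ->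
  (forall l', `|l' - l| < d -> regular_value A l') -> lbound A l d.
Proof.
move=> cV d0 reg.
pose S := [set c | 0 <= c <= d /\ lbound A l c].
have [e e0 lbe] := reg l ltac:(by rewrite subrr normr0).
have Se : S (Num.min e d).
  split; first by rewrite ge_min lexx orbT le_min !ltW.
  by apply: lbound_le lbe; rewrite ge_min lexx.
have hS : has_sup S.
  by split; [exists (Num.min e d) | exists d => c [/andP[]]].
have s0 : 0 < sup S.
  apply: (lt_le_trans _ (ub_le_sup hS.2 Se)); by rewrite lt_min e0.
have sd : sup S <= d by apply: ge_sup => [|c [/andP[]//]]; exact: hS.1.
have lbs : lbound A l (sup S).
  move=> h k Ahk; apply/ler_addgt0Pl => x x0.
  have y0 : 0 < x / (nrm h + 1) by rewrite divr_gt0// ltr_wpDl// nrm_ge0.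
  have [c Sc sc] := sup_adherent y0 hS.
  have h1 := Sc.2 _ _ Ahk.
  have : (sup S - c) * nrm h <= x.
    apply: (@le_trans _ _ ((sup S - c) * (nrm h + 1))).
      rewrite ler_wpM2l ?lerDl// subr_ge0.
      exact: (ub_le_sup hS.2 Sc).
    rewrite -ler_pdivlMr ?ltr_wpDl ?nrm_ge0//; lra.
  lra.
have [sd'|] := ltP (sup S) d; last first.
  by move=> ds; apply: lbound_le lbs.
have [e1 e10 lb1] := reg (l + sup S) ltac:(by rewrite addrC addKr gtr0_norm).
have [e2 e20 lb2] := reg (l - sup S) ltac:(by rewrite addrC addKr normrN gtr0_norm).
have m0 : 0 < Num.min e1 e2 by rewrite lt_min e10.
have [||c' sc' lbc'] := @lbound_improve l (sup S) _ cV s0 m0 lbs.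
- by apply: lbound_le lb1; rewrite ge_min lexx.
- by apply: lbound_le lb2; rewrite ge_min lexx orbT.
have : S (Num.min c' d).
  split; first by rewrite ge_min lexx orbT le_min (ltW d0) (ltW (lt_trans s0 sc')).
  by apply: lbound_le lbc'; rewrite ge_min lexx.
move=> /(ub_le_sup hS.2); rewrite leNgt => /negP; case.
by rewrite lt_min sc'.
Qed.

End theory.
End selfadjoint.

(** * Towers of reduced operators *)

Section resolvent.
Context {R : realType} {V : prehilbert R}.
Implicit Types (H : set V) (A : V -> V -> Prop).

Lemma regular_valueP H A l : complete_ph V -> closed_subspace H -> selfadjoint H A ->
  regular_value A l <->
  (forall f, H f -> exists h k, A h k /\ null (f - (k - l *: h))) /\
  (exists C, forall h k, A h k -> nrm h <= C * nrm (k - l *: h)).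
Proof.
move=> cV cH sA; split=> [[e e0 lb]|[_ [C hC]]].
  split=> [f /(lbound_surj cH sA cV e0 lb)[h Ah]|].
    by exists h, (f + l *: h); split=> //; rewrite addrK subrr; exact: null0.
  by exists e^-1 => h k Ahk; rewrite mulrC ler_pdivlMr// mulrC; exact: lb.
have C1 : 0 < `|C| + 1 by rewrite ltr_wpDl.
exists (`|C| + 1)^-1; rewrite ?invr_gt0// => h k Ahk.
rewrite mulrC ler_pdivrMr// mulrC (le_trans (hC _ _ Ahk))// ler_wpM2r ?nrm_ge0//.
by rewrite (le_trans (ler_norm _))// lerDl.
Qed.

Lemma closed_setT : closed_subspace [set: V].
Proof. by split. Qed.

Lemma regular_value_open A l : regular_value A l ->
  exists2 d, 0 < d & forall l', `|l' - l| < d -> regular_value A l'.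
Proof.
move=> [e e0 lb]; exists e => // l' ll'.
by exists (e - `|l' - l|); rewrite ?subr_gt0//; exact: lbound_shift.
Qed.

Definition orth (S H : set V) : set V := [set f | H f /\ forall g, S g -> dot f g = 0].

End resolvent.

(** An increasing sequence of isometric embeddings J of W i into V, with dense union, and
    operators a i that J carries into A. *)
Section tower.
Context {R : realType} {V : prehilbert R}.
Variable A : V -> V -> Prop.
Variables (W : nat -> prehilbert R) (a : forall i, W i -> W i -> Prop).
Variable J : forall i, W i -> V.
Arguments J {i}.
Arguments a {i}.
Hypotheses (cV : complete_ph V) (cW : forall i, complete_ph (W i)).
Hypotheses (sA : selfadjoint setT A) (sa : forall i, selfadjoint setT (@a i)).
Hypothesis JP : forall i c (x y : W i), J (c *: x + y) = c *: J x + J y.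
Hypothesis Jdot : forall i (x y : W i), dot (J x) (J y) = dot x y.
Hypothesis Ja : forall i (h k : W i), a h k -> A (J h) (J k).
Hypothesis Jup : forall i (x : W i), exists y : W i.+1, null (J x - J y).
Hypothesis Jdense : forall v e, 0 < e -> exists i (x : W i), nrm (v - J x) < e.

Let cT (U : prehilbert R) : closed_subspace [set: U] := @closed_setT R U.

Lemma tower_B i (x y : W i) : J (x - y) = J x - J y.
Proof. by rewrite addrC -scaleN1r JP scaleN1r addrC. Qed.

Lemma tower_0 i : J (0 : W i) = 0.
Proof. by rewrite -[0](subrr 0) tower_B subrr. Qed.

Lemma tower_Z i c (x : W i) : J (c *: x) = c *: J x.
Proof. by rewrite -[c *: x]addr0 JP tower_0 addr0. Qed.

Lemma tower_D i (x y : W i) : J (x + y) = J x + J y.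
Proof. by have := JP 1 x y; rewrite !scale1r. Qed.

Lemma tower_nrm i (x : W i) : nrm (J x) = nrm x.
Proof. by rewrite /nrm Jdot. Qed.

Lemma tower_null i (x y : W i) : null (J x - J y) <-> null (x - y).
Proof. by rewrite /null -tower_B tower_nrm. Qed.

(** A self-adjoint operator has no proper self-adjoint extension: the solution h0 of
    a h0 = k + h - h0 also solves the equation in V, where it is unique. *)
Lemma tower_op_inv i (h k : W i) : A (J h) (J k) -> a h k.
Proof.
move=> Ahk; have [h0 ah0] := sa_surj (sa i) (I : setT (k + h)).
have [] := sa_inj sA Ahk (Ja ah0).
  by rewrite -!tower_D subrK subrr; exact: null0.
by move=> /tower_null/null_sym hh /tower_null/null_sym kk; exact: (sa_sat (sa i) ah0 hh kk).
Qed.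

Lemma tower_proj i v : exists q : W i, forall z : W i, dot (v - J q) (J z) = 0.
Proof.
have [||u [cu uw]] := @approx_riesz R (W i) (fun z => dot v (J z)).
- by move=> c x y; rewrite JP dotDr dotZr.
- exists (- dot v v) => x; have := dot_ge0 (v - J x).
  by rewrite !dotE (dotC (J x) v) -(Jdot x x); lra.
have [q uq] := cW cu; exists q => z.
rewrite dotDl dotNl Jdot; apply/eqP; rewrite subr_eq0; apply/eqP.
exact: (rtends_unique (uw z) (rtends_dot z uq)).
Qed.

(** The images reduce A: if q is the projection of A h + h, then h0 = (a + 1)^-1 q is the
    projection of h, as one sees by testing against the vectors (a + 1) h1. *)
Lemma tower_reduces i h k : A h k -> exists h0 k0 : W i, a h0 k0 /\
  forall z : W i, dot (h - J h0) (J z) = 0 /\ dot (k - J k0) (J z) = 0.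
Proof.
move=> Ahk; have [q qP] := tower_proj i (k + h).
have [h0 ah0] := sa_surj (sa i) (I : setT q); exists h0, (q - h0); split=> // z.
have hz : dot (h - J h0) (J z) = 0.
  have [h1 ah1] := sa_surj (sa i) (I : setT z).
  have := sa_sym sA Ahk (Ja ah1); have := sa_sym (sa i) ah0 ah1.
  have := qP h1.
  rewrite !tower_B !dotE !Jdot; lra.
split=> //; have := qP z; move: hz; rewrite tower_B !dotE; lra.
Qed.

Lemma tower_proj_le i v (q z : W i) : (forall z : W i, dot (v - J q) (J z) = 0) ->
  nrm (v - J q) <= nrm (v - J z).
Proof.
move=> qP; rewrite ler_nrm -[v - J z](subrKA (J q)) -tower_B.
by rewrite [leRHS]pythagoras ?qP// lerDl dot_ge0.
Qed.

Lemma tower_proj_contr i v (q : W i) : (forall z : W i, dot (v - J q) (J z) = 0) ->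
  nrm q <= nrm v.
Proof.
move=> qP; rewrite -tower_nrm ler_nrm -[v](subrK (J q)) [leRHS]pythagoras ?qP//.
by rewrite lerDr dot_ge0.
Qed.

Lemma regular_restrict i l e : lbound A l e -> lbound (@a i) l e.
Proof. by move=> lb h k /Ja/lb; rewrite -tower_Z -tower_B !tower_nrm. Qed.

(** Projections do not increase the norm of (A - l) h and converge to h, so a bound that
    is uniform in i passes to the limit. *)
Lemma regular_extend l e : 0 < e -> (forall i, lbound (@a i) l e) -> lbound A l e.
Proof.
move=> e0 lb h k Ahk; apply/ler_addgt0Pl => x x0.
have [i [z hz]] := Jdense h (divr_gt0 x0 e0).
have [h0 [k0 [ah0 P]]] := tower_reduces i Ahk.
have h1 := le_lt_trans (tower_proj_le z (fun z => (P z).1)) hz.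
have h2 : nrm (k0 - l *: h0) <= nrm (k - l *: h).
  apply: tower_proj_contr => w; rewrite tower_B tower_Z subr_swap -scalerBr.
  by rewrite dotDl dotNl dotZl (P w).1 (P w).2 mulr0 subr0.
have h3 := lb _ _ _ ah0.
have := nrm_sub h (J h0); rewrite tower_nrm => h4.
move: h1; rewrite ltr_pdivlMr// => h1.
have : e * (nrm h - nrm h0) <= x.
  by rewrite mulrC (le_trans _ (ltW h1))// ler_wpM2r// ltW.
by lra.
Qed.

(** Regularity on an interval of radius d gives the bound with the constant d at every
    level, by [lbound_gap]; this uniformity is the reason for the closure in the
    description of the spectrum of A. *)
Theorem tower_regular l : regular_value A l <->
  exists2 d, 0 < d & forall i l', `|l' - l| < d -> regular_value (@a i) l'.
Proof.
split=> [/regular_value_open[d d0 h]|[d d0 h]].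
  by exists d => // i l' /h[e e0 lb]; exists e => //; exact: regular_restrict.
exists d => //; apply: regular_extend => // i.
exact: (lbound_gap (cT _) (sa i) (cW (i := i)) d0 (h i)).
Qed.

Definition tower_dom i : set V := [set v | exists u k : W i, a u k /\ null (v - J u)].

Fixpoint below i : set V :=
  if i is j.+1 then below j `|` orth (below j) (tower_dom j) else set0.

Definition increment i : set V := orth (below i) (tower_dom i).

Definition increment_op i h k := increment i h /\ A h k.

Lemma orth_tower_dom i v : (forall d, tower_dom i d -> dot v d = 0) ->
  forall z : W i, dot v (J z) = 0.
Proof.
move=> vd z; have [q qP] := tower_proj i v.
have qn : null q.
  apply: (sa_dense (sa i)) => // h k ahk.
  have := vd (J h) ltac:(by exists h, k; rewrite subrr; split=> //; exact: null0).
  by have := qP h; rewrite dotDl dotNl Jdot; lra.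
by have := qP z; rewrite dotDl dotNl Jdot (null_dot _ qn) subr0.
Qed.

Lemma lift_op i (h k : W i) : a h k -> exists h' k' : W i.+1,
  [/\ a h' k', null (J h - J h') & null (J k - J k')].
Proof.
move=> ahk; have [h' hh'] := Jup h; have [k' kk'] := Jup k.
by exists h', k'; split=> //; apply: tower_op_inv; exact: (sa_sat sA (Ja ahk) hh' kk').
Qed.

Lemma below_sub i v : below i.+1 v -> exists u : W i, null (v - J u).
Proof.
elim: i v => [|i ih] v /=; first by move=> [//|[[u [k [_ uv]]] _]]; exists u.
move=> [/ih[u uv]|[[u [k [_ uv]]] _]]; last by exists u.
have [u' uu'] := Jup u; exists u'.
by rewrite -[v - _](subrKA (J u)); exact: nullD.
Qed.

(** A vector of the domain of level i + 1 is the sum of its projection on level i, which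
    is in the domain of level i, and of an element of the increment. *)
Lemma tower_dom_split i u k : a u k -> exists d (h0 k0 : W i),
  [/\ a h0 k0, d = J (u : W i.+1) - J h0, tower_dom i.+1 d,
      A d (J k - J k0) & forall z : W i, dot d (J z) = 0 /\ dot (J k - J k0) (J z) = 0].
Proof.
move=> auk; have [h0 [k0 [ah0 P]]] := tower_reduces i (Ja auk).
exists (J u - J h0), h0, k0; split=> //; last exact: (sa_diff sA (Ja auk) (Ja ah0)).
have [h' [k' [ah' hh' _]]] := lift_op ah0.
exists (u - h'), (k - k'); split; first exact: (sa_diff (sa _) auk ah').
by rewrite tower_B subr_swap subrr sub0r; exact: nullN.
Qed.

(** The increments up to i span a dense subspace of the image of W i: by
    [tower_dom_split] they span the image of its domain. *)
Lemma belowP i v : (forall g, below i.+1 g -> dot v g = 0) <->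
  forall z : W i, dot v (J z) = 0.
Proof.
elim: i v => [|i ih] v; split.
- move=> vb; apply: orth_tower_dom => d dd; apply: vb; right; split=> // g [].
- by move=> vz g /below_sub[u gu]; rewrite dotC (null_dot_eq _ gu) dotC vz.
- move=> vb; apply: orth_tower_dom => g [u [k [auk dv]]].
  rewrite dotC (null_dot_eq _ dv) dotC.
  have /ih vi : forall g, below i.+1 g -> dot v g = 0 by move=> g' gb; apply: vb; left.
  have [d [h0 [k0 [ah0 dE dd Ad dz]]]] := tower_dom_split auk.
  have : dot v d = 0.
    by apply: vb; right; split=> //; apply/ih => z; have [] := dz z.
  by rewrite dE dotDr dotNr vi subr0.
- by move=> vz g /below_sub[u gu]; rewrite dotC (null_dot_eq _ gu) dotC vz.
Qed.

Definition orth_below i : set V :=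
  if i is j.+1 then [set v | forall z : W j, dot v (J z) = 0] else setT.

Lemma incrementP i v : increment i v <-> tower_dom i v /\ orth_below i v.
Proof.
case: i => [|i] /=; first by split=> -[].
by split=> -[dv vb]; split=> //; exact/belowP.
Qed.

(** The closure of [increment i], see [increment_closure]. *)
Definition increment_space i : set V :=
  [set v | (exists u : W i, null (v - J u)) /\ orth_below i v].

Lemma tower_dom_op i h k : tower_dom i h -> A h k -> exists u k0 : W i,
  [/\ a u k0, null (h - J u) & null (k - J k0)].
Proof.
move=> [u [k0 [auk hu]]] Ahk; exists u, k0; split=> //.
exact: (sa_fun sA (sa_diff sA Ahk (Ja auk)) hu).
Qed.

Lemma orth_below_lin i c x y : orth_below i x -> orth_below i y -> orth_below i (c *: x + y).
Proof. by case: i => //= i hx hy z; rewrite dotP hx hy mulr0 addr0. Qed.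

Lemma orth_below_null i x y : orth_below i x -> null (x - y) -> orth_below i y.
Proof. by case: i => //= i hx xy z; rewrite -(null_dot_eq _ xy). Qed.

Lemma increment_space_closed i : closed_subspace (increment_space i).
Proof.
split.
- split; first by exists 0; rewrite tower_0 subrr; exact: null0.
  by case: i => //= i z; rewrite dot0l.
- move=> c x y [[u xu] ox] [[v yv] oy]; split; last exact: orth_below_lin.
  exists (c *: u + v); rewrite JP opprD addrACA -scalerBr.
  by apply: nullD => //; exact: nullZ.
- move=> x xcl; split.
    have [q qP] := tower_proj i x; exists q; apply: null_small => e e0.
    have [y [[u yu] _] xy] := xcl e e0.
    apply: (le_trans (tower_proj_le u qP)); apply: (le_trans (nrm_tri y _ _)).
    by rewrite yu addr0 ltW.
  case: i xcl => //= i xcl z; apply/eqP; rewrite -normr_le0.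
  apply/ler_addgt0Pl => e e0; rewrite addr0.
  have z1 : 0 < nrm z + 1 by rewrite ltr_wpDl// nrm_ge0.
  have [y [_ oy] xy] := xcl (e / (nrm z + 1)) (divr_gt0 e0 z1).
  rewrite -[x](subrK y) dotDl oy addr0 (le_trans (dot_norm_le _ _))// tower_nrm.
  move: xy; rewrite ltr_pdivlMr// => /ltW; apply: le_trans.
  by rewrite ler_wpM2l ?nrm_ge0// lerDl.
Qed.

Lemma increment_sub i : increment i `<=` increment_space i.
Proof.
by move=> v /incrementP[[u [k [_ vu]]] ov]; split=> //; exists u.
Qed.

(** The domain is dense in W i, and projecting an approximation from the domain onto the
    orthogonal of the previous level brings it into the increment. *)
Lemma increment_closure i : rclosure (increment i) = increment_space i.
Proof.
apply/seteqP; split=> v.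
  move=> vcl; have [_ _ cl] := increment_space_closed i; apply: cl => e e0.
  by have [y /increment_sub] := vcl e e0; exists y.
move=> [[u vu] ov] e e0.
have [d [k [adk ud]]] := sa_dom_dense (cT _) (sa i) (cW (i := i)) (I : setT u) e0.
have vd : nrm (v - J d) < e.
  by rewrite (le_lt_trans (nrm_tri (J u) _ _))// vu add0r -tower_B tower_nrm.
case: i u vu ov d k adk ud vd => [|i] u vu ov d k adk ud vd.
  exists (J d) => //; apply/incrementP; split=> //.
  by exists d, k; rewrite subrr; split=> //; exact: null0.
have [g [h0 [k0 [ah0 gE dg _ gz]]]] := tower_dom_split adk.
exists g; first by apply/incrementP; split=> // z; have [] := gz z.
apply: le_lt_trans vd; rewrite ler_nrm.
have -> : v - J d = (v - g) - J h0 by rewrite gE opprD opprK addrA addrK.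
rewrite [leRHS]pythagoras ?lerDl ?dot_ge0//.
by rewrite dotNr dotDl dotNl ov (gz h0).1 subrr oppr0.
Qed.

(** The solution of A h = f - h stays in the image of level i and orthogonal to level
    i - 1 when f is so, because both levels reduce A. *)
Lemma increment_selfadjoint i : selfadjoint (increment_space i) (increment_op i).
Proof.
split.
- move=> h k [ih Ahk]; split; first exact: increment_sub.
  have [dh oh] := (incrementP _ _).1 ih.
  have [u [k0 [auk hu kk]]] := tower_dom_op dh Ahk; split; first by exists k0.
  case: i oh {ih dh u k0 auk hu kk} => //= i oh.
  apply: orth_tower_dom => d [u [w [auw du]]].
  by rewrite dotC (null_dot_eq _ du) dotC (sa_sym sA Ahk (Ja auw)) oh.
- move=> c h k h' k' [/incrementP[dh oh] Ahk] [/incrementP[dh' oh'] Ahk'].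
  split; last exact: (sa_lin sA).
  apply/incrementP; split; last exact: orth_below_lin.
  case: dh => u [w [auw hu]]; case: dh' => u' [w' [auw' hu']].
  exists (c *: u + u'), (c *: w + w'); split; first exact: (sa_lin (sa i)).
  rewrite JP opprD addrACA -scalerBr.
  by apply: nullD => //; exact: nullZ.
- by move=> h k h' k' [_ Ahk] [_ Ahk']; exact: (sa_sym sA Ahk Ahk').
- by move=> h k [_ Ahk]; exact: (sa_ge0 sA Ahk).
- move=> h k h' k' [/incrementP[[u [w [auw hu]]] oh] Ahk] hh kk.
  split; last exact: (sa_sat sA Ahk hh kk).
  apply/incrementP; split; last exact: orth_below_null oh hh.
  exists u, w; split=> //; rewrite -[h' - _](subrKA h).
  by apply: nullD => //; exact: null_sym.
- move=> f [[q fq] of_]; have [h Ah] := sa_surj sA (I : setT f).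
  exists h; split=> //.
  have [h0 ah0] := sa_surj (sa i) (I : setT q).
  have [hh _] : null (h - J h0) /\ null (f - h - J (q - h0)).
    by apply: (sa_inj sA Ah (Ja ah0)); rewrite -tower_D !subrK.
  apply/incrementP; split; first by exists h0, (q - h0).
  case: i of_ {q fq h0 ah0 hh} => //= i of_ z.
  have [h1 ah1] := sa_surj (sa i) (I : setT z).
  have := sa_sym sA Ah (Ja ah1); have := of_ h1.
  rewrite tower_B !dotE; lra.
- by move=> h k [_ Ahk]; exact: (sa_fun sA Ahk).
Qed.

Lemma regular_increment i l : regular_value (@a i) l -> regular_value (increment_op i) l.
Proof.
move=> [e e0 lb]; exists e => // h k [/incrementP[dh _] Ahk].
have [u [k0 [auk hu kk]]] := tower_dom_op dh Ahk.
rewrite (null_nrm_eq hu) tower_nrm (le_trans (lb _ _ auk))// -tower_nrm tower_B tower_Z le_eqVlt.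
apply/orP; left; apply/eqP/null_nrm_eq; rewrite subr_swap -scalerBr.
apply: nullB; first exact: null_sym.
by apply: nullZ; exact: null_sym.
Qed.

(** Both sides of the bound split orthogonally. *)
Lemma regular_up i l : regular_value (@a i) l -> regular_value (increment_op i.+1) l ->
  regular_value (@a i.+1) l.
Proof.
move=> [e e0 lb] [e' e'0 lb']; set m := Num.min e e'.
have m0 : 0 < m by rewrite lt_min e0.
have {}lb : lbound (@a i) l m by apply: lbound_le lb; rewrite ge_min lexx.
have {}lb' : lbound (increment_op i.+1) l m.
  by apply: lbound_le lb'; rewrite ge_min lexx orbT.
exists m => // u k auk.
have [d [h0 [k0 [ah0 dE dd Ad dz]]]] := tower_dom_split auk.
have id : increment_op i.+1 d (J k - J k0).
  by split=> //; apply/incrementP; split=> // z; have [] := dz z.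
have Ju : J u = d + J h0 by rewrite dE subrK.
have Jk : J (k - l *: u) = (J k - J k0 - l *: d) + J (k0 - l *: h0).
  by rewrite !tower_B !tower_Z dE scalerBr subr_swap subrK.
have Pu : dot u u = dot d d + dot h0 h0.
  by rewrite -!(Jdot u) Ju pythagoras ?Jdot// (dz _).1.
have Pk : dot (k - l *: u) (k - l *: u) =
    dot (J k - J k0 - l *: d) (J k - J k0 - l *: d) + dot (k0 - l *: h0) (k0 - l *: h0).
  rewrite -!(Jdot (k - _)) Jk pythagoras ?Jdot//.
  by rewrite dotDl dotNl dotZl (dz _).1 (dz _).2 mulr0 subrr.
have sq (U : prehilbert R) (x y : U) : m * nrm x <= nrm y -> m ^+ 2 * dot x x <= dot y y.
  by rewrite -!sqr_nrm -exprMn ler_pXn2r// ?nnegrE ?mulr_ge0 ?nrm_ge0 ?(ltW m0).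
rewrite -(@ler_pXn2r _ 2)// ?nnegrE ?mulr_ge0 ?nrm_ge0 ?(ltW m0)//.
rewrite exprMn !sqr_nrm Pu Pk mulrDr lerD//; apply: sq; first exact: lb'.
exact: lb.
Qed.

(** Level i + 1 is regular at l exactly when level i and the next increment are. *)
Theorem increment_regular l : (forall i, regular_value (@a i) l) <->
  forall i, regular_value (increment_op i) l.
Proof.
split=> [h i|h]; first exact: regular_increment.
elim=> [|i ih]; last exact: regular_up.
have [e e0 lb] := h 0%N; exists e => // u k auk.
rewrite -(tower_nrm u) -(tower_nrm (k - _)) tower_B tower_Z; apply: lb; split; last exact: Ja.
by apply/incrementP; split=> //; exists u, k; rewrite subrr; split=> //; exact: null0.
Qed.

End tower.

(** * Generators of closable forms *)

(** A form on a core is a linear map j of pre-Hilbert spaces: the product of K is the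
    form and j reads elements of the core in V. *)
Section form_generator.
Context {R : realType} {V K : prehilbert R}.
Variable j : K -> V.
Hypothesis jP : forall a x y, j (a *: x + y) = a *: j x + j y.

Definition closable_form : Prop := forall u : nat -> K, cauchy u ->
  tends (j \o u) 0 -> forall w, rtends (fun n => dot (u n) w) 0.

(** The graph of the generator of the closure of the form: a Cauchy sequence u
    represents an element h of the domain of the closure, and the form of h against the
    core is the product with k. *)
Definition form_gen (h k : V) : Prop := exists u : nat -> K,
  [/\ cauchy u, tends (j \o u) h
    & forall w, rtends (fun n => dot (u n) w) (dot k (j w))].

Hypothesis cV : complete_ph V.
Hypothesis jdense : forall v e, 0 < e -> exists x, nrm (v - j x) < e.
Hypothesis closj : closable_form.

Lemma jB x y : j (x - y) = j x - j y.
Proof. by rewrite addrC -scaleN1r jP scaleN1r addrC. Qed.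

(** Weak convergence on the core extends to limits w of Cauchy sequences because u is
    bounded; this is E(h, w) = dot k w on the domain of the closure. *)
Lemma form_gen_pair k (u : nat -> K) (w : nat -> K) w0 :
  cauchy u -> (forall x, rtends (fun n => dot (u n) x) (dot k (j x))) ->
  cauchy w -> tends (j \o w) w0 -> rtends (fun n => dot (u n) (w n)) (dot k w0).
Proof.
move=> cu uk cw ww e e0.
have [M M0 [N1 hM]] := cauchy_bounded cu.
have k1 : 0 < nrm k + 1 by rewrite ltr_wpDl// nrm_ge0.
have [N2 h2] := cw (e / 3 / M) ltac:(by rewrite !divr_gt0).
have [N3 h3] := ww (e / 3 / (nrm k + 1)) ltac:(by rewrite !divr_gt0).
pose m := maxn N2 N3.
have [N4 h4] := uk (w m) (e / 3) ltac:(by rewrite divr_gt0).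
exists (maxn N1 (maxn m N4)) => n; rewrite !geq_max => /and3P[n1 nm n4].
have -> : dot (u n) (w n) - dot k w0 = dot (u n) (w n - w m) +
    ((dot (u n) (w m) - dot k (j (w m))) + dot k (j (w m) - w0)).
  by rewrite !dotE; ring.
have a1 : `|dot (u n) (w n - w m)| < e / 3.
  apply: (le_lt_trans (dot_norm_le _ _)).
  have h := h2 n m ltac:(by case/andP: nm) (leq_maxl _ _).
  rewrite ltr_pdivlMr// in h; rewrite (le_lt_trans _ h)// mulrC.
  by rewrite ler_wpM2l ?nrm_ge0// hM.
have a3 : `|dot k (j (w m) - w0)| < e / 3.
  apply: (le_lt_trans (dot_norm_le _ _)).
  have h := h3 m (leq_maxr _ _).
  rewrite ltr_pdivlMr// in h; rewrite (le_lt_trans _ h)// mulrC.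
  by rewrite ler_wpM2l ?nrm_ge0// lerDl.
have a2 := h4 n n4.
apply: (le_lt_trans (ler_normD _ _)).
have := ler_normD (dot (u n) (w m) - dot k (j (w m))) (dot k (j (w m) - w0)).
by lra.
Qed.

Let K1P a (x y z : K) : dot (a *: x + y) z + dot (j (a *: x + y)) (j z) =
  a * (dot x z + dot (j x) (j z)) + (dot y z + dot (j y) (j z)).
Proof. by rewrite jP !dotP; ring. Qed.

Let K1 : prehilbert R := @PreHilbert R K (fun x y => dot x y + dot (j x) (j y))
  (fun x y => congr2 +%R (dotC x y) (dotC (j x) (j y)))
  K1P
  (fun x => addr_ge0 (dot_ge0 x) (dot_ge0 (j x))).

(** The Riesz theorem for the product E(x, y) + dot (j x) (j y) on the core. *)
Lemma form_gen_surj (f : V) : exists h, form_gen h (f - h).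
Proof.
have [||u1 [cu uw]] := @approx_riesz R K1 (fun x => dot f (j x)).
- by move=> a x y; rewrite jP dotDr dotZr.
- exists (- dot f f) => x /=.
  have := dot_ge0 (f - j x); have := @dot_ge0 R K x.
  rewrite !dotE (dotC (j x) f); lra.
pose u : nat -> K := u1.
have dn (x : K) : dot x x <= nrm (x : K1) ^+ 2 /\ dot (j x) (j x) <= nrm (x : K1) ^+ 2.
  by rewrite sqr_nrm /= lerDl lerDr !dot_ge0.
have cK : cauchy (u : nat -> K).
  move=> e e0; have [N hN] := cu e e0; exists N => m n Nm Nn.
  apply: le_lt_trans (hN m n Nm Nn); rewrite nrm_le_sq ?nrm_ge0//.
  exact: (dn (u m - u n)).1.
have [h uh] : exists h, tends (j \o u) h.
  apply: cV => e e0; have [N hN] := cu e e0; exists N => m n Nm Nn.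
  apply: le_lt_trans (hN m n Nm Nn); rewrite nrm_le_sq ?nrm_ge0//= -jB.
  exact: (dn (u m - u n)).2.
exists h, u; split=> // w.
rewrite (_ : (fun n => _) = fun n => (dot (u n) w + dot (j (u n)) (j w))
    + (- 1) * dot (j (u n)) (j w)); last by apply/funext => n; ring.
rewrite (_ : dot (f - h) (j w) = dot f (j w) + (-1) * dot h (j w)); last first.
  by rewrite !dotE; ring.
apply: rtendsD; first exact: uw.
by apply: rtendsZ; exact: rtends_dot uh.
Qed.

Lemma tends_null (u : nat -> V) x y : tends u x -> null (x - y) -> tends u y.
Proof.
move=> ux xy e e0; have [N hN] := ux e e0; exists N => n Nn.
by rewrite (le_lt_trans (nrm_tri x _ _))// xy addr0 hN.
Qed.

(** Closability is what makes the generator single-valued. *)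
Lemma form_gen_selfadjoint : selfadjoint setT form_gen.
Proof.
split=> //.
- move=> a h k h' k' [u [cu uh uk]] [v [cv vh vk]].
  have a1 : 0 < `|a| + 1 by rewrite ltr_wpDl.
  have small (U : prehilbert R) (x y : U) e : nrm x < e / 2 / (`|a| + 1) -> nrm y < e / 2 ->
      nrm (a *: x + y) < e.
    rewrite ltr_pdivlMr// => xe ye; apply: (le_lt_trans (nrmD _ _)).
    by rewrite nrmZ; have := nrm_ge0 x; nra.
  exists (fun n => a *: u n + v n); split.
  + move=> e e0; have e2 : 0 < e / 2 by lra.
    have [N hN] := cu _ (divr_gt0 e2 a1); have [M hM] := cv _ e2.
    exists (maxn N M) => m n; rewrite !geq_max => /andP[Nm Mm] /andP[Nn Mn].
    rewrite opprD addrACA -scalerBr; apply: small; [exact: hN|exact: hM].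
  + move=> e e0; have e2 : 0 < e / 2 by lra.
    have [N hN] := uh _ (divr_gt0 e2 a1); have [M hM] := vh _ e2.
    exists (maxn N M) => n; rewrite !geq_max => /andP[Nn Mn] /=.
    rewrite jP opprD addrACA -scalerBr; apply: small; [exact: hN|exact: hM].
  + move=> w; rewrite dotP.
    rewrite (_ : (fun n => _) = fun n => a * dot (u n) w + dot (v n) w); last first.
      by apply/funext => n; rewrite dotP.
    by apply: rtendsD => //; exact: rtendsZ.
- move=> h k h' k' [u [cu uh uk]] [v [cv vh vk]].
  apply: (rtends_unique (form_gen_pair cu uk cv vh)).
  rewrite (_ : (fun n => _) = fun n => dot (v n) (u n)); last first.
    by apply/funext => n; exact: dotC.
  by rewrite dotC; exact: (form_gen_pair cv vk cu uh).
- move=> h k [u [cu uh uk]].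
  by apply: rtends_ge0 (form_gen_pair cu uk cu uh) => n; exact: dot_ge0.
- move=> h k h' k' [u [cu uh uk]] hh kk; exists u; split=> //.
    exact: tends_null uh hh.
  by move=> w; rewrite -(null_dot_eq _ kk).
- by move=> f _; exact: form_gen_surj.
- move=> h k [u [cu uh uk]] h0.
  have u0 : tends (j \o u) 0 by apply: (tends_null uh); rewrite subr0.
  have kj w : dot k (j w) = 0 by exact: rtends_unique (uk w) (closj cu u0 w).
  apply: null_small => e e0; have [x kx] := jdense k e0.
  apply: ltW; apply: le_lt_trans kx.
  by rewrite ler_nrm !dotE (dotC _ k) kj; have := dot_ge0 (j x); lra.
Qed.

End form_generator.

(** A map P of cores over an isometry J, with a map Q that is adjoint to P for the forms
    and to J for the ambient products. *)
Section form_transport.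
Context {R : realType} {V K V' K' : prehilbert R}.
Variables (j : K -> V) (j' : K' -> V') (J : V' -> V) (P : K' -> K) (Q : K -> K').
Hypothesis jP : forall a x y, j (a *: x + y) = a *: j x + j y.
Hypothesis j'P : forall a x y, j' (a *: x + y) = a *: j' x + j' y.
Hypothesis JP : forall a x y, J (a *: x + y) = a *: J x + J y.
Hypothesis PP : forall a x y, P (a *: x + y) = a *: P x + P y.
Hypothesis Jdot : forall x y, dot (J x) (J y) = dot x y.
Hypothesis Pdot : forall x y, dot (P x) (P y) = dot x y.
Hypothesis Pj : forall x, j (P x) = J (j' x).
Hypothesis PQ : forall x y, dot (P x) y = dot x (Q y).
Hypothesis PQj : forall x y, dot (J (j' x)) (j y) = dot (j' x) (j' (Q y)).

Lemma linear_nrmB (U U' : prehilbert R) (f : U -> U') x y :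
  (forall a x y, f (a *: x + y) = a *: f x + f y) ->
  (forall x y, dot (f x) (f y) = dot x y) -> nrm (f x - f y) = nrm (x - y).
Proof.
move=> fP fdot; have -> : f x - f y = f (x - y).
  by rewrite [in RHS]addrC -[- y]scaleN1r fP scaleN1r addrC.
by rewrite /nrm fdot.
Qed.

(** If E'(h, .) = dot k (j' .), then the form of J h against w is E'(h, Q w), that is
    dot k (j' (Q w)) = dot (J k) (j w). *)
Lemma form_gen_transport h k : (forall v e, 0 < e -> exists x, nrm (v - j' x) < e) ->
  form_gen j' h k -> form_gen j (J h) (J k).
Proof.
move=> dj' [u [cu uh uk]]; exists (P \o u); split.
- move=> e e0; have [N hN] := cu e e0; exists N => m n Nm Nn.
  by rewrite /= linear_nrmB// hN.
- move=> e e0; have [N hN] := uh e e0; exists N => n Nn.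
  by rewrite /= Pj linear_nrmB//; exact: hN.
- move=> w.
  rewrite (_ : (fun n => _) = fun n => dot (u n) (Q w)); last first.
    by apply/funext => n; rewrite /= PQ.
  suff -> : dot (J k) (j w) = dot k (j' (Q w)) by [].
  apply/eqP; rewrite -subr_eq0 -normr_le0; apply/ler_addgt0Pl => e e0; rewrite addr0.
  pose M := nrm (j w) + nrm (j' (Q w)) + 1.
  have M0 : 0 < M by rewrite ltr_wpDl// addr_ge0// nrm_ge0.
  have [x] := dj' k (e / M) (divr_gt0 e0 M0); rewrite ltr_pdivlMr// => kx.
  have := dot_norm_le (J k - J (j' x)) (j w); have := dot_norm_le (k - j' x) (j' (Q w)).
  rewrite linear_nrmB// !dotDl !dotNl PQj.
  set a := dot (J k) _; set b := dot k _; set c := dot (j' x) _.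
  move=> h1 h2; have := ler_distD c a b; rewrite (distrC c b).
  move: kx; rewrite /M !mulrDr mulr1; have := nrm_ge0 (k - j' x); lra.
Qed.

(** Q does not increase either norm, so it maps u to a sequence of K' to which
    closability applies. *)
Lemma closable_project (u : nat -> K) : closable_form j' -> cauchy u ->
  tends (j \o u) 0 -> forall x, rtends (fun n => dot (u n) (P x)) 0.
Proof.
move=> cl cu u0 x.
rewrite (_ : (fun n => _) = fun n => dot (Q (u n)) x); last first.
  by apply/funext => n; rewrite dotC PQ dotC.
have Qnrm y z : nrm (Q y - Q z) <= nrm (y - z).
  set q := Q y - Q z.
  have h : dot q q = dot (P q) (y - z).
    by rewrite {2}/q !(dotDr, dotNr) !PQ.
  have := dot_nrm_le (P q) (y - z); rewrite -h -sqr_nrm expr2.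
  have -> : nrm (P q) = nrm q by rewrite /nrm Pdot.
  have [->|n0] := eqVneq (nrm q) 0; first by rewrite nrm_ge0.
  by rewrite ler_pM2l// lt_neqAle eq_sym n0 nrm_ge0.
have jQnrm y : nrm (j' (Q y)) <= nrm (j y).
  have h : dot (j' (Q y)) (j' (Q y)) = dot (J (j' (Q y))) (j y) by rewrite PQj.
  have := dot_nrm_le (J (j' (Q y))) (j y); rewrite -h -sqr_nrm expr2.
  have -> : nrm (J (j' (Q y))) = nrm (j' (Q y)) by rewrite /nrm Jdot.
  have [->|n0] := eqVneq (nrm (j' (Q y))) 0; first by rewrite nrm_ge0.
  by rewrite ler_pM2l// lt_neqAle eq_sym n0 nrm_ge0.
apply: (cl (Q \o u)).
- move=> e e0; have [N hN] := cu e e0; exists N => m n Nm Nn.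
  by rewrite /= (le_lt_trans (Qnrm _ _))// hN.
- move=> e e0; have [N hN] := u0 e e0; exists N => n Nn.
  by have := hN n Nn; rewrite /= !subr0; apply: le_lt_trans.
Qed.

End form_transport.

(** * L^2 spaces *)

Section L2_space.
Context {R : realType} d {T : measurableType d}.
Variable mu : {measure set T -> \bar R}.
Implicit Types f g : T -> R.

Lemma L2P f : L2 mu f <-> measurable_fun setT f /\
  mu.-integrable setT (EFin \o (fun x => f x ^+ 2)).
Proof.
split=> [L2f|[mf fi]].
  split; last exact: Lfun2_integrable_sqr.
  by move: L2f; rewrite /L2 /= inE => /andP[/[!inE]].
rewrite /L2 /= inE; apply/andP; split; rewrite inE//=.
rewrite /finite_norm unlock poweR_lty//.
move/integrableP : fi => [_]; apply: le_lt_trans.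
rewrite le_eqVlt; apply/orP; left; apply/eqP; apply: eq_integral => x _ /=.
by rewrite powR_mulrn// normrX.
Qed.

Lemma L2_measurable f : L2 mu f -> measurable_fun setT f.
Proof. by case/L2P. Qed.

Lemma L2_mul f g : L2 mu f -> L2 mu g ->
  mu.-integrable setT (EFin \o (fun x => f x * g x)).
Proof. by move=> Lf Lg; apply/Lfun1_integrable; exact: Lfun2_mul_Lfun1. Qed.

Lemma L2_linear c f g : L2 mu f -> L2 mu g -> L2 mu (c *: f + g).
Proof. by move=> Lf Lg; exact: (Lfun_submod_closed mu (lee1n 2)).2. Qed.

Lemma L20 : L2 mu (0 : T -> R).
Proof. exact: (Lfun_submod_closed mu (lee1n 2)).1. Qed.

Lemma L2D f g : L2 mu f -> L2 mu g -> L2 mu (f + g).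
Proof. by move=> Lf Lg; rewrite -[f]scale1r; exact: L2_linear. Qed.

Lemma L2Z c f : L2 mu f -> L2 mu (c *: f).
Proof. by move=> Lf; rewrite -[_ *: _]addr0; apply: L2_linear => //; exact: L20. Qed.

Lemma L2B f g : L2 mu f -> L2 mu g -> L2 mu (f - g).
Proof. by move=> Lf Lg; rewrite addrC -scaleN1r; exact: L2_linear. Qed.

Lemma L2dotC f g : L2dot mu f g = L2dot mu g f.
Proof. by apply: eq_Rintegral => x _; rewrite mulrC. Qed.

Lemma L2dotP c f g h : L2 mu f -> L2 mu g -> L2 mu h ->
  L2dot mu (c *: f + g) h = c * L2dot mu f h + L2dot mu g h.
Proof.
move=> Lf Lg Lh; rewrite /L2dot -RintegralZl//; last exact: L2_mul.
rewrite -RintegralD//; last exact: L2_mul.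
  by apply: eq_Rintegral => x _; rewrite mulrDl mulrA.
have := L2_mul (L2Z c Lf) Lh; congr (_ .-integrable _ _).
by apply/funext => x /=; rewrite mulrA.
Qed.

Lemma L2dot_ge0 f : 0 <= L2dot mu f f.
Proof. by apply: Rintegral_ge0 => x _; rewrite -expr2 sqr_ge0. Qed.

Definition L2vec := LfunType mu (lee1n 2).

Definition L2ph : prehilbert R := @PreHilbert R L2vec (fun f g : L2vec => L2dot mu f g)
  (fun f g : L2vec => L2dotC f g)
  (fun c (f g h : L2vec) => L2dotP c (LfunP f) (LfunP g) (LfunP h))
  (fun f : L2vec => L2dot_ge0 f).

Definition L2fun (v : L2ph) : T -> R := (v : L2vec).

Lemma L2funP v : L2 mu (L2fun v).
Proof. exact: LfunP. Qed.

Lemma L2fun_lin c u v : L2fun (c *: u + v) = c *: L2fun u + L2fun v.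
Proof. by []. Qed.

Definition toL2 f (Lf : L2 mu f) : L2ph := Lfun_Sub (lee1n 2) Lf.

Lemma EFin_L2dot f g : L2 mu f -> L2 mu g ->
  (L2dot mu f g)%:E = (\int[mu]_x (f x * g x)%:E)%E.
Proof.
move=> Lf Lg; rewrite /L2dot /Rintegral fineK//.
exact: (integrable_fin_num _ (L2_mul Lf Lg)).
Qed.

Lemma L2normE f : L2norm mu f = Num.sqrt (L2dot mu f f).
Proof.
rewrite /L2norm /L2dot /Rintegral.
have <- : (\int[mu]_x `|(EFin \o f) x| `^ 2)%E = (\int[mu]_x (f x * f x)%:E)%E.
  apply: eq_integral => x _ /=.
  by rewrite powR_mulrn// -normrX ger0_norm ?sqr_ge0// expr2.
rewrite -powR_Lnorm ?gt_eqF//.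
set N := ('N[_]_2[_])%E.
have : (0 <= N)%E by exact: Lnorm_ge0.
case: N => [r| |]//= r0; first by rewrite powR_mulrn// sqrtr_sqr ger0_norm.
by rewrite gt_eqF//= sqrtr0.
Qed.

Lemma L2ph_nrm (f : L2ph) : nrm f = L2norm mu (L2fun f).
Proof. by rewrite L2normE. Qed.

Lemma L2dot_ae_eq f f' g : L2 mu f -> L2 mu f' -> L2 mu g ->
  f = f' %[ae mu] -> L2dot mu f g = L2dot mu f' g.
Proof.
move=> Lf Lf' Lg ff; congr fine; apply: ae_eq_integral => //.
- by apply/measurable_EFinP/measurable_funM; exact: L2_measurable.
- by apply/measurable_EFinP/measurable_funM; exact: L2_measurable.
- by apply: filterS ff => x /= -> .
Qed.

Lemma L2dot_eq0 f : L2 mu f -> L2dot mu f f = 0 <-> f = 0 %[ae mu].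
Proof.
move=> Lf; split=> [f0|f0]; last first.
  rewrite (L2dot_ae_eq Lf L20 Lf f0) /L2dot.
  by under eq_Rintegral do rewrite mul0r; rewrite Rintegral_cst// mul0r.
have mf := L2_measurable Lf.
have : (\int[mu]_x `|(f x * f x)%:E| = 0)%E.
  under eq_integral do rewrite gee0_abs ?lee_fin -?expr2 ?sqr_ge0//.
  under eq_integral do rewrite expr2.
  by rewrite -EFin_L2dot// f0.
move=> /ae_eq_integral_abs h.
have := h measurableT ltac:(by apply/measurable_EFinP/measurable_funM).
apply: filterS => x /= /(_ I) [] /eqP; rewrite mulf_eq0 orbb => /eqP ->.
by [].
Qed.

Lemma L2ph_null (u v : L2ph) : null (u - v) <-> L2fun u = L2fun v %[ae mu].
Proof.
rewrite nullP.
have -> : dot (u - v) (u - v) = L2dot mu (L2fun u - L2fun v) (L2fun u - L2fun v) by [].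
have Luv : L2 mu (L2fun u - L2fun v) by apply: L2B; exact: L2funP.
split.
  move/(L2dot_eq0 Luv); apply: filterS => x h /h.
  by rewrite fctE => /eqP; rewrite subr_eq0 => /eqP.
move=> uv; apply/(L2dot_eq0 Luv); apply: filterS uv => x h /h uv.
by rewrite fctE uv [LHS]subrr.
Qed.

End L2_space.

(** The induction step in the estimate of a sum of terms 4^-k by 2 - 4/3 * 4^-n. *)
Lemma geometric_step (R : realFieldType) (a b c y : R) :
  c <= a + b -> a < y -> b <= 2 - 4 / 3 * y -> c <= 2 - 4 / 3 * (4^-1 * y).
Proof. by move=> *; lra. Qed.

(** A Cauchy sequence has a subsequence with steps less than 4^-n, and converges when the
    subsequence does. *)
Lemma complete_fast (R : realType) (V : prehilbert R) :
  (forall v : nat -> V, (forall n, nrm (v n.+1 - v n) < 4^-1 ^+ n) ->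
    exists f, forall n e, 0 <= e ->
      (exists N, forall m, (N <= m)%N -> nrm (v m - v n) <= e) -> nrm (f - v n) <= e) ->
  complete_ph V.
Proof.
move=> fast u cu.
have /choice[N hN] : forall j : nat, exists N, forall m n, (N <= m)%N -> (N <= n)%N ->
    nrm (u m - u n) < 4^-1 ^+ j by move=> j; apply: cu; rewrite exprn_gt0.
pose k j := (\sum_(i < j.+1) N i)%N.
have kN j : (N j <= k j)%N by rewrite /k big_ord_recr /= leq_addl.
have kS j : (N j <= k j.+1)%N by rewrite /k big_ord_recr /= (leq_trans (kN j))// leq_addr.
have [|f hf] := fast (u \o k).
  by move=> j; exact: hN.
exists f => e e0; have [M hM] := cu (e / 2) ltac:(lra).
have [J kJ] : exists J, forall j, (J <= j)%N -> nrm (f - u (k j)) <= 4^-1 ^+ j.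
  exists 0%N => j _; apply: hf; first by rewrite exprn_ge0.
  exists j => m jm; rewrite ltW//=; apply: hN; last exact: kN.
  rewrite (leq_trans (kN j))// /k.
  elim: m jm => [|m ih]; first by rewrite leqn0 => /eqP ->.
  rewrite leq_eqVlt => /predU1P[->//|]; rewrite ltnS => /ih h.
  by rewrite (leq_trans h)// [leqRHS]big_ord_recr /= leq_addr.
have [j [jJ je]] : exists j, (J <= j)%N /\ 4^-1 ^+ j < e / 2 :> R.
  have := @cvg_expr R 4^-1 ltac:(by rewrite ger0_norm// invf_lt1// ltr1n).
  move=> /cvgrPdist_lt /(_ (e / 2) ltac:(lra))[j0 _ h].
  exists (maxn J j0); split; first exact: leq_maxl.
  have := h (maxn J j0) (leq_maxr _ _).
  by rewrite sub0r normrN ger0_norm// exprn_ge0.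
exists (maxn M (k j)) => n; rewrite geq_max => /andP[Mn kn].
have := kJ j jJ.
have nk : nrm (u n - u (k j)) < 4^-1 ^+ j by apply: hN; rewrite ?kN// (leq_trans (kN j)).
have := nrm_tri (u (k j)) (u n) f.
rewrite (nrmB (u (k j)) f); lra.
Qed.

Section L2_complete.
Context {R : realType} d {T : measurableType d}.
Variable mu : {measure set T -> \bar R}.

Lemma geometric_cvg (w : nat -> R) (c : R) :
  (forall n, `|w n.+1 - w n| <= c * 2^-1 ^+ n) -> cvgn w.
Proof.
move=> wc.
have -> : w = fun n => w 0%N + series (telescope w) n.
  by apply/funext => n; rewrite -eq_sum_telescope.
apply: is_cvgD; first exact: is_cvg_cst.
apply: normed_cvg; apply: (@series_le_cvg _ _ (geometric c 2^-1)).
- by move=> n; exact: normr_ge0.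
- by move=> n; exact: le_trans (wc n).
- by move=> n; exact: wc.
- by apply: is_cvg_geometric_series; rewrite ger0_norm// invf_lt1// ltr1n.
Qed.

Variable v : nat -> L2ph mu.
Hypothesis fastv : forall n, nrm (v n.+1 - v n) < 4^-1 ^+ n.

Let w n : T -> R := L2fun (v n).

Let mw n : measurable_fun setT (w n).
Proof. exact: L2_measurable (L2funP _). Qed.

(* The steps have square norms less than 16^-n, so the sum of the a n has finite integral
   and is finite almost everywhere; there the steps decrease like 2^-n. Fatou's lemma
   then bounds the distance to the limit. *)
Let a n x : R := 4 ^+ n * (w n.+1 x - w n x) ^+ 2.

Let ma n : measurable_fun setT (EFin \o a n).
Proof.
apply/measurable_EFinP; apply: measurable_funM => //.
by apply: measurable_funX; exact: measurable_funB.
Qed.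

Let a0 n x : (0 <= (a n x)%:E)%E.
Proof. by rewrite lee_fin mulr_ge0 ?sqr_ge0// exprn_ge0. Qed.

Let inta n : (\int[mu]_x (a n x)%:E <= (4^-1 ^+ n)%:E)%E.
Proof.
under eq_integral do rewrite EFinM.
rewrite ge0_integralZl//; last 2 first.
- by apply/measurable_EFinP/measurable_funX; exact: measurable_funB.
- by move=> x _; rewrite lee_fin sqr_ge0.
have -> : (\int[mu]_x ((w n.+1 x - w n x) ^+ 2)%:E)%E = (dot (v n.+1 - v n) (v n.+1 - v n))%:E.
  rewrite EFin_L2dot; [|exact: L2funP (v n.+1 - v n)..].
  by apply: eq_integral => x _; rewrite expr2.
rewrite -EFinM lee_fin -sqr_nrm.
have := fastv n; have := nrm_ge0 (v n.+1 - v n); set r := nrm _ => r0 rn.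
have rr : r ^+ 2 <= (4^-1 ^+ n) ^+ 2 by rewrite ler_pXn2r ?nnegrE ?exprn_ge0// ltW.
apply: (@le_trans _ _ (4 ^+ n * (4^-1 ^+ n) ^+ 2)); first by rewrite ler_wpM2l// exprn_ge0.
by rewrite expr2 mulrA -exprMn divff// expr1n mul1r.
Qed.

Let S x : \bar R := (\sum_(n <oo) (a n x)%:E)%E.

Let intS : (\int[mu]_x S x < +oo)%E.
Proof.
rewrite integral_nneseries//.
apply: (@le_lt_trans _ _ 2%:E); last exact: ltry.
apply: lime_le; first by apply: is_cvg_ereal_nneg_natsum => n _; exact: integral_ge0.
apply: nearW => n.
apply: (@le_trans _ _ (\sum_(0 <= i < n) (4^-1 ^+ i : R)%:E)%E).
  by apply: lee_sum => i _; exact: inta.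
rewrite sumEFin lee_fin.
suff : \sum_(0 <= i < n) (4^-1 ^+ i : R) <= 2 - 4 / 3 * 4^-1 ^+ n.
  by move=> /le_trans; apply; rewrite gerBl mulr_ge0// exprn_ge0.
elim: n => [|n ih]; first by rewrite big_geq// expr0 mulr1; lra.
rewrite big_nat_recr//= exprS; have : 0 <= (4^-1 : R) ^+ n by rewrite exprn_ge0.
by move: ih; set y := (4^-1 : R) ^+ n; lra.
Qed.

Let S_fin : {ae mu, forall x, S x < +oo}%E.
Proof.
have mS : measurable_fun setT S.
  by apply: ge0_emeasurable_sum => [n x _ _|n _]; [exact: a0|exact: ma].
have iS : mu.-integrable setT S.
  apply/integrableP; split => //; under eq_integral => x _.
    rewrite gee0_abs; last by apply: nneseries_ge0 => n _ _; exact: a0.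
    over.
  exact: intS.
have := integrable_ae measurableT iS; apply: filterS => x /(_ I).
by case: (S x) => //= r _; exact: ltry.
Qed.

Let cvg_w : {ae mu, forall x, cvgn (w ^~ x)}.
Proof.
apply: filterS S_fin => x Sx.
have S0 : (0 <= S x)%E by apply: nneseries_ge0 => n _ _; exact: a0.
have aS n : a n x <= fine (S x).
  rewrite -lee_fin fineK ?ge0_fin_numE//.
  apply: (@le_trans _ _ (\sum_(0 <= i < n.+1) (a i x)%:E)%E).
    by rewrite big_nat_recr//= leeDr// sume_ge0.
  by apply: nneseries_lim_ge => i _ _; exact: a0.
have fS : 0 <= fine (S x) by exact: fine_ge0.
apply: (@geometric_cvg _ (fine (S x) + 1)) => n.
have p0 : 0 < (2 : R) ^+ n by rewrite exprn_gt0.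
rewrite exprVn ler_pdivlMr//.
rewrite -(@ler_pXn2r _ 2)// ?nnegrE ?mulr_ge0 ?(ltW p0)//; last by lra.
have := aS n; rewrite /a exprMn -normrX ger0_norm ?sqr_ge0//.
have -> : (2 ^+ n) ^+ 2 = 4 ^+ n :> R by rewrite exprAC; congr (_ ^+ _); ring.
rewrite mulrC => /le_trans; apply; nra.
Qed.

Let g x : R := fine (limn_esup (fun n => (w n x)%:E)).

Let mg : measurable_fun setT g.
Proof.
apply: measurableT_comp => //; apply: measurable_fun_limn_esup => n.
exact/measurable_EFinP.
Qed.

Let w_cvg : {ae mu, forall x, w ^~ x @ \oo --> g x}.
Proof.
apply: filterS cvg_w => x cw.
suff -> : g x = limn (w ^~ x) by [].
have : (fun n => (w n x)%:E) @ \oo --> (limn (w ^~ x))%:E.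
  by apply: cvg_EFin; [exact: nearW|exact: cw].
by move=> /cvg_limn_einf_sup[_]; rewrite /g => ->.
Qed.

Let fatou_bound n e : 0 <= e -> (exists N, forall m, (N <= m)%N -> nrm (v m - v n) <= e) ->
  (\int[mu]_x ((g x - w n x) ^+ 2)%:E <= (e ^+ 2)%:E)%E.
Proof.
move=> e0 [N hN].
pose h m x := ((w m x - w n x) ^+ 2)%:E.
have mh m : measurable_fun setT (h m).
  by apply/measurable_EFinP/measurable_funX; exact: measurable_funB.
have h0 m x : (0 <= h m x)%E by rewrite lee_fin sqr_ge0.
have -> : (\int[mu]_x ((g x - w n x) ^+ 2)%:E)%E = (\int[mu]_x limn_einf (h ^~ x))%E.
  apply: ae_eq_integral => //.
  - by apply/measurable_EFinP/measurable_funX; exact: measurable_funB.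
  - apply: measurableT_comp => //; apply: measurable_fun_limn_esup => m.
    exact: measurableT_comp.
  - apply: filterS w_cvg => x gx _.
    have : h ^~ x @ \oo --> ((g x - w n x) ^+ 2)%:E.
      apply: cvg_EFin; first exact: nearW.
      have c : (fun m => w m x - w n x) @ \oo --> g x - w n x.
        by apply: cvgB gx _; exact: cvg_cst.
      rewrite expr2 (_ : fine \o _ = (fun m => w m x - w n x) \* (fun m => w m x - w n x)).
        exact: (cvgM c c).
      by apply/funext => m /=; rewrite expr2.
    by move=> /cvg_limn_einf_sup[-> _].
apply: (le_trans (fatou mu measurableT mh (fun m x _ => h0 m x))).
rewrite limn_einf_lim; apply: lime_le; first exact: is_cvg_einfs.
apply: nearW => m; apply: ereal_inf_le.
exists (\int[mu]_x h (maxn m N) x)%E; first by exists (maxn m N) => //=; rewrite leq_maxl.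
have hm := hN (maxn m N) (leq_maxr _ _).
have -> : (\int[mu]_x h (maxn m N) x)%E = (dot (v (maxn m N) - v n) (v (maxn m N) - v n))%:E.
  rewrite EFin_L2dot; [|exact: L2funP (v _ - v n)..].
  by apply: eq_integral => x _; rewrite /h expr2.
by rewrite lee_fin -nrm_le_sq.
Qed.

Let Lgw n e : 0 <= e -> (exists N, forall m, (N <= m)%N -> nrm (v m - v n) <= e) ->
  L2 mu (g - w n).
Proof.
move=> e0 he; apply/L2P; split; first exact: measurable_funB.
apply/integrableP; split.
  by apply/measurable_EFinP/measurable_funX; exact: measurable_funB.
apply: le_lt_trans (ltry (e ^+ 2)).
under eq_integral do rewrite gee0_abs ?lee_fin ?sqr_ge0//.
exact: fatou_bound.
Qed.

Lemma fast_limit : exists f : L2ph mu, forall n e, 0 <= e ->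
  (exists N, forall m, (N <= m)%N -> nrm (v m - v n) <= e) -> nrm (f - v n) <= e.
Proof.
have tail m : nrm (v m - v 0%N) <= 2.
  suff : nrm (v m - v 0%N) <= 2 - 4 / 3 * 4^-1 ^+ m.
    by move=> /le_trans; apply; rewrite gerBl mulr_ge0// exprn_ge0.
  elim: m => [|m ih]; first by rewrite subrr nrm0 expr0; lra.
  rewrite exprS; exact: geometric_step (nrm_tri (v m) _ _) (fastv m) ih.
have Lg : L2 mu g.
  have := L2D (@Lgw 0%N 2 ltac:(by []) ltac:(by exists 0%N => m _; exact: tail)) (L2funP (v 0%N)).
  by rewrite subrK.
exists (toL2 Lg) => n e e0 he; rewrite nrm_le_sq// -lee_fin.
rewrite EFin_L2dot; [|exact: L2funP (toL2 Lg - v n)..].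
apply: le_trans (fatou_bound e0 he); rewrite le_eqVlt; apply/orP; left; apply/eqP.
by apply: eq_integral => x _; rewrite expr2.
Qed.

End L2_complete.


Lemma L2_complete (R : realType) d (T : measurableType d)
  (mu : {measure set T -> \bar R}) : complete_ph (L2ph mu).
Proof. by apply: complete_fast => v; exact: fast_limit. Qed.

Lemma dot_limit0 (R : realType) (V : prehilbert R) (D : linset V) (y v : V) :
  (forall d, D d -> dot y d = 0) ->
  (forall e, 0 < e -> exists2 g, D g & nrm (v - g) < e) -> dot y v = 0.
Proof.
move=> yD vD; apply/eqP; rewrite -normr_le0; apply/ler_addgt0Pl => e e0.
have y1 : 0 < nrm y + 1 by rewrite ltr_wpDl// nrm_ge0.
have [g Dg] := vD (e / (nrm y + 1)) (divr_gt0 e0 y1).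
rewrite ltr_pdivlMr// => /ltW vg; rewrite addr0 -[v](subrK g) dotDr (yD g Dg) addr0.
rewrite (le_trans (dot_norm_le _ _))// mulrC (le_trans _ vg)//.
by rewrite ler_wpM2l ?nrm_ge0// lerDl.
Qed.

Lemma null_near (R : realType) (V : prehilbert R) (v p g : V) e :
  null (v - p) -> nrm (p - g) < e -> nrm (v - g) < e.
Proof. by move=> vp pg; rewrite (le_lt_trans (nrm_tri p _ _))// vp add0r. Qed.

Section vanishing_integrals.
Context {R : realType} d {T : measurableType d}.
Variable mu : {measure set T -> \bar R}.
Variable y : T -> R.
Hypothesis Ly : L2 mu y.
Implicit Types (A P : set T) (G : set (set T)).

Let my : measurable_fun setT y. Proof. exact: L2_measurable Ly. Qed.

Lemma L2_indic A : measurable A -> (mu A < +oo)%E -> L2 mu (\1_A : T -> R).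
Proof.
move=> mA Afin; apply/L2P; split; first exact: measurable_indic.
rewrite (_ : (fun x => _) = \1_A).
  apply/integrableP; split; first exact/measurable_EFinP/measurable_indic.
  under eq_integral do rewrite gee0_abs ?lee_fin//.
  by rewrite integral_indic// setIT.
by apply/funext => x; rewrite indicE; case: (x \in A); rewrite ?expr1n ?expr0n.
Qed.

Lemma L2_integrable A : measurable A -> (mu A < +oo)%E -> mu.-integrable A (EFin \o y).
Proof.
move=> mA Afin; apply/integrable_mkcond => //.
have := L2_mul Ly (L2_indic mA Afin); congr (_.-integrable _ _).
apply/funext => x /=; rewrite patchE indicE.
by case: ifP => _; rewrite ?mulr1 ?mulr0.
Qed.

Lemma L2dot_indic A : measurable A ->
  (\int[mu]_x (y x * \1_A x)%:E = \int[mu]_(x in A) (y x)%:E)%E.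
Proof.
move=> mA; rewrite [RHS]integral_mkcond; apply: eq_integral => x _.
rewrite patchE indicE.
by case: ifP => _; rewrite ?mulr1 ?mulr0.
Qed.

(** The sets A for which the integral of y over the intersection of A and P vanishes form
    a Dynkin system; P has finite measure, so y is integrable on it. *)
Lemma vanish_sigma G P : (forall A, G A -> measurable A) -> setI_closed G ->
  measurable P -> (mu P < +oo)%E ->
  (\int[mu]_(x in P) (y x)%:E = 0)%E ->
  (forall A, G A -> \int[mu]_(x in A `&` P) (y x)%:E = 0)%E ->
  forall A, <<s G >> A -> measurable A /\ (\int[mu]_(x in A `&` P) (y x)%:E = 0)%E.
Proof.
move=> mG GI mP Pfin P0 G0.
have yP : mu.-integrable P (EFin \o y) by exact: L2_integrable.
pose H := [set A | measurable A /\ (\int[mu]_(x in A `&` P) (y x)%:E = 0)%E].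
apply: (@lambda_system_subset _ _ GI setT H) => //; last first.
  by move=> A GA; split; [exact: mG|exact: G0].
apply/dynkin_lambda_system; split.
- by split; rewrite ?setTI.
- move=> A [mA A0]; split; first exact: measurableC.
  have : (\int[mu]_(x in (A `&` P) `|` (~` A `&` P)) (y x)%:E = 0)%E.
    by rewrite -setIUl setUCr setTI.
  rewrite integral_setU_EFin.
  - by rewrite A0 add0e.
  - exact: measurableI.
  - by apply: measurableI => //; exact: measurableC.
  - by apply: measurable_funTS; exact: my.
  - apply/disj_set2P; rewrite setIACA setICr set0I//.
- move=> F tF HF; split; first by apply: bigcup_measurable => n _; exact: (HF n).1.
  rewrite setI_bigcupl integral_bigcup.
  - by apply: eseries0 => n _ _; exact: (HF n).2.
  - exact: trivIset_setIr.
  - by move=> n; apply: measurableI => //; exact: (HF n).1.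
  - apply: integrableS yP => //; first by rewrite -setI_bigcupl; apply: measurableI => //;
      apply: bigcup_measurable => n _; exact: (HF n).1.
    by move=> x [n _ []].
Qed.

(** The union is cut into the disjoint sets F n minus the previous ones, which are traces
    on F n of sets generated by G. *)
Lemma vanish_bigcup G (F : nat -> set T) : (forall A, G A -> measurable A) ->
  setI_closed G -> (forall A, G A -> \int[mu]_(x in A) (y x)%:E = 0)%E ->
  (forall n, G (F n)) -> (mu (\bigcup_n F n) < +oo)%E ->
  (\int[mu]_(x in \bigcup_n F n) (y x)%:E = 0)%E.
Proof.
move=> mG GI G0 GF Ffin.
have mF n : measurable (F n) by exact: mG.
have mU : measurable (\bigcup_n F n) by exact: bigcup_measurable.
have mS n : measurable (seqDU F n).
  by rewrite /seqDU; apply: measurableD => //; exact: bigsetU_measurable.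
rewrite seqDU_bigcup_eq integral_bigcup//; last first.
  by rewrite -seqDU_bigcup_eq; exact: L2_integrable.
apply: eseries0 => n _ _.
rewrite /seqDU setDE setIC.
have [] := @vanish_sigma G (F n) mG GI (mF n) _ (G0 _ (GF n)) _ (~` \big[setU/set0]_(k < n) F k).
- by apply: le_lt_trans Ffin; apply: le_measure; rewrite ?inE//; exact: bigcup_sup.
- by move=> A GA; apply: G0; exact: GI.
- move=> S [[S0 SC SU] GS].
  have S0' : S setT by rewrite -(setD0 setT); exact: SC.
  rewrite -setTD; apply: SC; elim/big_ind : _ => //; last by move=> k _; exact: GS.
  by move=> A B SA SB; rewrite -bigcup2E; apply: SU => -[|[|k]] //=.
by move=> _ ->.
Qed.

End vanishing_integrals.

Section density.
Context {R : realType} {X : ptopologicalType}.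
Variable mu : {measure set (borel X) -> \bar R}.

Definition open_exhaustion : Prop := exists O : nat -> set X,
  [/\ forall n, open (O n), forall n, (mu (O n) < +oo)%E & \bigcup_n O n = setT].

Lemma open_measurable (U : set X) : open U -> measurable (U : set (borel X)).
Proof. by move=> oU; exact: sub_sigma_algebra. Qed.

Definition indL2 (A : set (borel X)) (mA : measurable A) (fA : (mu A < +oo)%E) : L2ph mu :=
  toL2 (L2_indic mA fA).

(** A vector orthogonal to D is orthogonal to the indicators of open sets of finite
    measure, so its integral over every Borel subset of each W n vanishes. *)
Lemma L2_dense (D : linset (L2ph mu)) : open_exhaustion ->
  (forall (U : set X) (oU : open U) (fU : (mu U < +oo)%E) e, 0 < e ->
     exists2 f, D f & nrm (indL2 (open_measurable oU) fU - f) < e) ->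
  forall f e, 0 < e -> exists2 g, D g & nrm (f - g) < e.
Proof.
move=> [W [oW fW WT]] indD f e e0.
have [p [fp pD]] := projection D f (@L2_complete _ _ _ mu).
suff fp0 : null (f - p).
  have [g Dg pg] := pD e e0; exists g; [exact: Dg|exact: (null_near fp0 pg)].
set y := f - p in fp *.
have yU (U : set X) : open U -> (mu U < +oo)%E -> (\int[mu]_(x in U) (L2fun y x)%:E = 0)%E.
  move=> oU fU.
  suff : dot y (indL2 (open_measurable oU) fU) = 0.
    have := EFin_L2dot (L2funP y) (L2funP (indL2 (open_measurable oU) fU)).
    by rewrite L2dot_indic//; [move=> <- y0; congr EFin; exact: y0|exact: open_measurable].
  by apply: dot_limit0 fp _ => d; exact: indD.
have yW n : ae_eq mu (W n) (EFin \o L2fun y) (cst 0%E).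
  apply: integral_ae_eq => //.
  - exact: open_measurable.
  - by apply: L2_integrable => //; [exact: L2funP|exact: open_measurable].
  - move=> E EW mE; rewrite integral0.
    have [] := @vanish_sigma _ _ _ mu (L2fun y) (L2funP y) (@open X) (W n) open_measurable _
      (open_measurable (oW n)) (fW n) (yU _ (oW n) (fW n)) _ E mE.
    + by move=> A B; exact: openI.
    + move=> A oA; apply: yU; first exact: openI.
      apply: (le_lt_trans (le_measure _ _ _ (@subIsetr _ _ _)) (fW n)); rewrite inE.
        by apply: open_measurable; exact: openI.
      exact: open_measurable.
    + by move=> _; rewrite setIidl.
apply/nullP/(L2dot_eq0 (L2funP y)).
have := ae_foralln yW; apply: filterS => x yx _.
have [n _ Wnx] : (\bigcup_n W n) x by rewrite WT.
by have [] := yx n Wnx.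
Qed.

End density.

(** The part of the indicator of U that is orthogonal to D has a vanishing integral over
    the members of PP inside U, hence over their countable union U: it is orthogonal to
    the indicator of U, and so to itself. *)
Lemma ind_bigcup (R : realType) (X : ptopologicalType)
    (mu : {measure set (borel X) -> \bar R}) (D : linset (L2ph mu))
    (PP : set (set X)) (F : nat -> set X) (U : set X)
    (mU : measurable (U : set (borel X))) (fU : (mu U < +oo)%E) :
  setI_closed PP -> (forall P, PP P -> measurable (P : set (borel X))) ->
  (forall P (mP : measurable (P : set (borel X))) (fP : (mu P < +oo)%E), PP P ->
     forall e, 0 < e -> exists2 f, D f & nrm (indL2 mP fP - f) < e) ->
  (forall n, PP (F n)) -> U = \bigcup_n F n ->
  forall e, 0 < e -> exists2 f, D f & nrm (indL2 mU fU - f) < e.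
Proof.
move=> PI mPP PD PF UF e e0; set v := indL2 mU fU.
have [q [vq qD]] := projection D v (@L2_complete _ _ _ mu).
set y := v - q in vq.
have y0 P : PP P /\ P `<=` U -> (\int[mu]_(x in P) (L2fun y x)%:E = 0)%E.
  move=> [bP PU]; have mP := mPP P bP.
  have fP : (mu P < +oo)%E.
    by apply: (le_lt_trans _ fU); apply: le_measure; rewrite ?inE.
  suff : dot y (indL2 mP fP) = 0.
    have := EFin_L2dot (L2funP y) (L2funP (indL2 mP fP)).
    by rewrite L2dot_indic// => <- yP; congr EFin; exact: yP.
  by apply: (dot_limit0 vq); exact: PD.
have yU : (\int[mu]_(x in U) (L2fun y x)%:E = 0)%E.
  rewrite UF; apply: (@vanish_bigcup _ _ _ _ _ (L2funP y) [set P | PP P /\ P `<=` U]).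
  - by move=> P [bP _]; exact: mPP.
  - by move=> P Q [bP PU] [bQ _]; split; [exact: PI|move=> z [/PU]].
  - exact: y0.
  - by move=> n; split=> //; rewrite UF; exact: bigcup_sup.
  - by rewrite -UF.
have yv : dot y v = 0.
  have := EFin_L2dot (L2funP y) (L2funP v).
  by rewrite L2dot_indic// yU => -[].
have yq : dot y q = 0 by exact: (dot_limit0 vq).
have yn : null y by apply/nullP; rewrite {2}/y dotDr dotNr yv yq subrr.
have [g Dg qg] := qD _ e0; exists g; [exact: Dg|exact: (null_near yn qg)].
Qed.

(** * Topology of the glued space *)

Definition countable_base (X : topologicalType) (b : nat -> set X) : Prop :=
  (forall n, open (b n)) /\
  forall x (U : set X), open U -> U x -> exists n, b n x /\ b n `<=` U.

Lemma second_countable_base (X : ptopologicalType) :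
  @second_countable X -> exists b : nat -> set X, countable_base b.
Proof.
move=> [D cD [oD bD]].
have D0 : exists U, D U.
  by have [U /= [DU _] _] := bD point setT filterT; exists U.
have [f fD] : exists f : nat -> set X, range f = D.
  have /pfcard_geP[D0'|[f]] := cD.
    by have [U] := D0; rewrite D0'.
  by exists f; exact: image_eq.
exists f; split=> [n|x U oU Ux]; first by apply: oD; rewrite -fD; exists n.
have [V /= [DV Vx] VU] := bD x U (open_nbhs_nbhs (conj oU Ux)).
by move: DV; rewrite -fD => -[n _ fn]; exists n; rewrite fn.
Qed.

Lemma open_bigcup_base (X : topologicalType) (b : nat -> set X) (P : set X -> Prop)
  (U : set X) : P set0 ->
  (forall x, U x -> exists n, [/\ b n x, b n `<=` U & P (b n)]) ->
  exists F : nat -> set X, (forall n, P (F n)) /\ U = \bigcup_n F n.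
Proof.
move=> P0 Ub; exists (fun n => if `[< b n `<=` U /\ P (b n) >] then b n else set0).
split=> [n|]; first by case: asboolP => [[]|].
apply/seteqP; split=> x.
  by move=> /Ub[n [bx bU Pb]]; exists n => //; case: asboolP => // -[].
by move=> [n _]; case: asboolP => [[bU _]|//]; exact: bU.
Qed.

Lemma compact_tube (X G : topologicalType) (x : X) (O : set (X * G)) :
  compact [set: G] -> open O -> (forall g, O (x, g)) ->
  \forall x' \near x, forall g, O (x', g).
Proof.
move=> /compact_near_coveringP cG oO Ox.
apply: filterS (cG X (nbhs x) (fun x' g => O (x', g)) _ _).
  by move=> x' h g; exact: h.
move=> g _; have [[V W] /= [Vx Wg] VWO] : nbhs (x, g) O by exact: open_nbhs_nbhs.
by exists (W, V) => // -[g' x'] /= [Wg' Vx']; exact: (VWO (x', g')).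
Qed.

Section glue_topology.
Context {X G : ptopologicalType} (B : set X).
Local Notation Y := (glued G B).
Local Notation p := (@glue_pi X G B).
Local Notation phi := (@glue_phi X G B).

Lemma glue_open (U : set Y) : open U <-> open (p @^-1` U).
Proof. by []. Qed.

Lemma glue_pi_surj (z : Y) : exists x g, p (x, g) = z.
Proof.
case: z => [[[x xB] g]|[x xB]].
- exists x, g; rewrite /glue_pi /=; case: pselect => [Bx|nBx].
    by have := set_mem xB.
  by congr (inl (_, _)); congr exist; exact: Prop_irrelevance.
- exists x, point; rewrite /glue_pi /=; case: pselect => [Bx|nBx].
    by congr inr; congr exist; exact: Prop_irrelevance.
  by have := set_mem xB.
Qed.

Lemma glue_pi_cont : continuous p.
Proof. by apply/continuousP. Qed.

Lemma glue_cont (Z : topologicalType) (f : Y -> Z) : continuous (f \o p) -> continuous f.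
Proof. by move=> /continuousP h; apply/continuousP => U /h. Qed.

Lemma glue_phiK x g : phi (p (x, g)) = x.
Proof. exact: glue_piK. Qed.

Lemma glue_phi_cont : continuous phi.
Proof.
apply: glue_cont; rewrite (_ : _ \o _ = fst); last by apply/funext => -[x g]; exact: glue_phiK.
by move=> z; exact: cvg_fst.
Qed.

(** Over B the value is read at an arbitrary point of G: this is meaningful only where F
    does not depend on g, see [glue_liftE]. *)
Definition glue_lift (T : Type) (F : X -> G -> T) (z : Y) : T :=
  match z with inl u => F (set_val u.1) u.2 | inr x => F (set_val x) point end.

Lemma glue_liftE (T : Type) (F : X -> G -> T) x g :
  (B x -> F x g = F x point) -> glue_lift F (p (x, g)) = F x g.
Proof. by rewrite /glue_pi /=; case: pselect => //= Bx ->. Qed.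

Lemma glue_pi_B x g g' : B x -> p (x, g) = p (x, g').
Proof.
move=> Bx; rewrite /glue_pi /=; case: pselect => //= Bx'.
Qed.

Lemma glue_pi_inj x g x' g' : ~ B x -> p (x, g) = p (x', g') -> x = x' /\ g = g'.
Proof.
move=> nBx e; have xx : x = x' by rewrite -[x](glue_phiK x g) e glue_phiK.
subst x'; split=> //; move: e.
by rewrite /glue_pi /=; case: pselect => //= nBx' [].
Qed.

Lemma glue_pi_image (V : set X) (W : set G) : V `&` B = set0 ->
  p @^-1` (p @` (V `*` W)) = V `*` W.
Proof.
move=> VB; apply/seteqP; split=> [[x g]|[x g] [Vx Wg]]; last by exists (x, g).
move=> [[x' g'] /= [Vx' Wg'] /glue_pi_inj[]]; last by move=> <- <-.
by move=> Bx'; have : (V `&` B) x' by []; rewrite VB.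
Qed.

Lemma glue_phi_preimage (V : set X) : p @^-1` (phi @^-1` V) = V `*` setT.
Proof. by apply/seteqP; split=> [[x g]|[x g]] /=; rewrite ?glue_phiK// => -[]. Qed.

Lemma glue_phi_compact (K : set X) : compact [set: G] -> compact K -> compact (phi @^-1` K).
Proof.
move=> cG cK; have -> : phi @^-1` K = p @` (K `*` setT).
  apply/seteqP; split=> [z /= Kz|_ [[x g] /= [Kx _] <-]]; last by rewrite /= glue_phiK.
  have [x [g xg]] := glue_pi_surj z; exists (x, g) => //; split=> //=.
  by rewrite -(glue_phiK x g) xg.
apply: continuous_compact; last exact: compact_setX.
by apply: continuous_subspaceT; exact: glue_pi_cont.
Qed.

Lemma Cc_dominated (R : realType) (f : Y -> R) (g : X -> R) : compact [set: G] ->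
  Cc g -> continuous f -> (forall z, g (phi z) = 0 -> f z = 0) -> Cc f.
Proof.
move=> cG [_ cg] cf gf; split=> //.
have cK : closed (phi @^-1` closure [set x | g x != 0]).
  apply: closed_comp; last exact: closed_closure.
  by move=> z _; exact: glue_phi_cont.
apply: (@subclosed_compact _ _ _ (@closed_closure _ _) (glue_phi_compact cG cg)).
rewrite [X in _ `<=` X](closure_id _).1//.
apply: closure_subset => z /= fz; apply: subset_closure => /=.
by apply: contra_neq fz; exact: gf.
Qed.

Variables (bX : nat -> set X) (bG : nat -> set G).
Hypotheses (baseX : countable_base bX) (baseG : countable_base bG).
Hypotheses (cG : compact [set: G]) (cB : closed B).

(** Unions of whole fibres over an open set of X, and boxes that avoid B. They are stable
    under intersection, and form a base because G is compact: a neighbourhood of a point of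
    B contains the fibres over a neighbourhood in X ([glue_base_at]). *)
Definition basic (U : set Y) : Prop :=
  (exists2 V, open V & U = phi @^-1` V) \/
  (exists V W, [/\ open V, open W, V `&` B = set0 & U = p @` (V `*` W)]).

Lemma open_setX (V : set X) (W : set G) : open V -> open W -> open (V `*` W).
Proof.
move=> oV oW; rewrite openE => -[x g] [/= Vx Wg]; exists (V, W) => //=.
by split; exact: open_nbhs_nbhs.
Qed.

Lemma basic_open U : basic U -> open U.
Proof.
move=> [[V oV ->]|[V [W [oV oW VB ->]]]].
  by move/continuousP : glue_phi_cont; apply.
by apply/glue_open; rewrite glue_pi_image//; exact: open_setX.
Qed.

Lemma basicI U U' : basic U -> basic U' -> basic (U `&` U').
Proof.
have phi_im V V' W' : V' `&` B = set0 ->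
    phi @^-1` V `&` p @` (V' `*` W') = p @` ((V `&` V') `*` W').
  move=> _; apply/seteqP; split=> z.
    move=> [/= Vz [[x g] [/= V'x W'g] xg]]; exists (x, g) => //; split=> //; split=> //=.
    by move: Vz; rewrite -xg glue_phiK.
  move=> [[x g] [/= [Vx V'x] W'g] <-]; split; first by rewrite /= glue_phiK.
  by exists (x, g).
move=> [[V oV ->]|[V [W [oV oW VB ->]]]] [[V' oV' ->]|[V' [W' [oV' oW' VB' ->]]]].
- by left; exists (V `&` V') => //; exact: openI.
- right; exists (V `&` V'), W'; split=> //; first exact: openI.
    by rewrite -setIA VB' setI0.
  exact: phi_im.
- right; exists (V' `&` V), W; split=> //; first exact: openI.
    by rewrite -setIA VB setI0.
  by rewrite setIC; exact: phi_im.
- right; exists (V `&` V'), (W `&` W'); split; [exact: openI|exact: openI| |].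
    by rewrite -setIA VB' setI0.
  apply/seteqP; split=> z.
    move=> [[[x g] [/= Vx Wg] <-] [[x' g'] [/= Vx' Wg'] e]].
    have [||xx gg] := @glue_pi_inj x g x' g' => //.
      by move=> Bx; have : (V `&` B) x by []; rewrite VB.
    by subst x' g'; exists (x, g).
  by move=> [[x g] [/= [Vx V'x] [Wg W'g]] <-]; split; exists (x, g).
Qed.

Lemma glue_base_at (U : set Y) z : open U -> U z ->
  (exists n, [/\ (phi @^-1` bX n) z, phi @^-1` bX n `<=` U & basic (phi @^-1` bX n)]) \/
  (exists m n, [/\ bX m `&` B = set0, (p @` (bX m `*` bG n)) z,
    p @` (bX m `*` bG n) `<=` U & basic (p @` (bX m `*` bG n))]).
Proof.
move=> oU; have [x [g <-]] := glue_pi_surj z => Uz.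
have opU : open (p @^-1` U) by [].
have [Bx|nBx] := pselect (B x).
  left; have /nbhs_interior := @compact_tube _ _ x (p @^-1` U) cG opU
    ltac:(by move=> g' /=; rewrite (glue_pi_B g' g Bx)).
  move=> /nbhs_singleton Ix.
  have [n [bx bU]] := baseX.2 x _ (open_interior _) Ix.
  exists n; split; first by rewrite /= glue_phiK.
    move=> w /=; have [y [g' <-]] := glue_pi_surj w.
    by rewrite glue_phiK => /bU/interior_subset; exact.
  by left; exists (bX n) => //; exact: baseX.1.
right; have [[V W] /= [Vx Wg] VWU] : nbhs (x, g) (p @^-1` U) by exact: open_nbhs_nbhs.
have := Vx; rewrite nbhsE => -[V' [oV' V'x] V'V].
have := Wg; rewrite nbhsE => -[W' [oW' W'g] W'W].
have [m [bm bmV]] := baseX.2 x (V' `&` ~` B) (openI oV' (closed_openC cB)) (conj V'x nBx).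
have [n [bn bnW]] := baseG.2 g W' oW' W'g.
have mB : bX m `&` B = set0.
  by apply/disjoints_subset => y /bmV[].
exists m, n; split=> //.
- by exists (x, g).
- move=> _ [[y h] [/= /bmV[V'y _] /bnW W'h] <-].
  by apply: (VWU (y, h)); split=> /=; [exact: V'V|exact: W'W].
- by right; exists (bX m), (bG n); split=> //; [exact: baseX.1|exact: baseG.1].
Qed.

Definition glue_base (k : nat) : set Y :=
  if unpickle k is Some (m, on) then
    if on is Some n then (if `[< bX m `&` B = set0 >] then p @` (bX m `*` bG n) else set0)
    else phi @^-1` bX m
  else set0.

Lemma glue_baseP : countable_base glue_base.
Proof.
split=> [k|z U oU Uz].
  rewrite /glue_base; case: unpickle => [[m [n|]]|]; last exact: open0.
    case: asboolP => mB; last exact: open0.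
    by apply: basic_open; right; exists (bX m), (bG n); split=> //; [exact: baseX.1|exact: baseG.1].
  by apply: basic_open; left; exists (bX m) => //; exact: baseX.1.
have [[n [bz bU _]]|[m [n [mB bz bU _]]]] := glue_base_at oU Uz.
  by exists (pickle (n, None : option nat)); rewrite /glue_base pickleK.
by exists (pickle (m, Some n)); rewrite /glue_base pickleK asboolT.
Qed.

Lemma open_basic (U : set Y) : open U -> exists F : nat -> set Y,
  (forall n, basic (F n)) /\ U = \bigcup_n F n.
Proof.
move=> oU; apply: (@open_bigcup_base _ glue_base).
  by left; exists set0; [exact: open0|rewrite preimage_set0].
move=> z Uz; have [[n [bz bU bb]]|[m [n [mB bz bU bb]]]] := glue_base_at oU Uz.
  by exists (pickle (n, None : option nat)); rewrite /glue_base pickleK.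
by exists (pickle (m, Some n)); rewrite /glue_base pickleK asboolT.
Qed.

(** Open sets of X * G need not belong to the product sigma-algebra a priori, but the
    preimage of an open set of the glued space is a countable union of boxes. *)
Lemma glue_pi_measurable : @measurable_fun _ _ (borel X * borel G)%type (borel Y) setT p.
Proof.
apply: (@measurability _ _ (borel X * borel G)%type (borel Y) setT p (@open Y)) => //.
move=> _ [U oU <-]; rewrite setTI.
have [F [bF ->]] := open_basic oU.
rewrite preimage_bigcup; apply: bigcup_measurable => n _.
have [[V oV ->]|[V [W [oV oW VB ->]]]] := bF n.
  rewrite glue_phi_preimage; apply: measurableX => //; exact: open_measurable.
by rewrite glue_pi_image//; apply: measurableX; exact: open_measurable.
Qed.

End glue_topology.

(** * Integration of images, products and continuous functions *)

Section change_of_variables.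
Context {R : realType} d d' {X : measurableType d} {Y : measurableType d'}.
Variables (mu : {measure set X -> \bar R}) (nu : {measure set Y -> \bar R}).
Variable phi : X -> Y.
Hypothesis mphi : measurable_fun setT phi.
Hypothesis nuE : forall A, measurable A -> nu A = mu (phi @^-1` A).

Lemma ge0_integral_image (f : Y -> \bar R) : measurable_fun setT f ->
  (forall y, 0 <= f y)%E -> (\int[nu]_y f y = \int[mu]_x f (phi x))%E.
Proof.
move=> mf f0.
have := ge0_integral_pushforward mphi mu measurableT mf (fun y _ => f0 y).
rewrite preimage_setT => <-; apply: eq_measure_integral => A mA _.
exact: nuE.
Qed.

Lemma integrable_image (f : Y -> R) : measurable_fun setT f ->
  nu.-integrable setT (EFin \o f) <-> mu.-integrable setT (EFin \o (f \o phi)).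
Proof.
move=> mf; have mfp : measurable_fun setT (f \o phi) by exact: measurableT_comp.
have e : (\int[nu]_y `|(f y)%:E| = \int[mu]_x `|(f (phi x))%:E|)%E.
  apply: (@ge0_integral_image (fun y => `|(f y)%:E|)%E) => [|y]; last exact: abse_ge0.
  by apply: measurableT_comp => //; exact/measurable_EFinP.
split=> /integrableP[_ fi]; apply/integrableP; split; try exact/measurable_EFinP.
  by rewrite /= -e.
by rewrite /= e.
Qed.

Lemma Rintegral_image (f : Y -> R) : measurable_fun setT f ->
  mu.-integrable setT (EFin \o (f \o phi)) -> \int[nu]_y f y = \int[mu]_x f (phi x).
Proof.
move=> mf fi; congr fine.
have := @integral_pushforward _ _ X Y R phi mphi mu setT (EFin \o f) _ _ measurableT.
rewrite preimage_setT => <-//; last exact/measurable_EFinP.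
by apply: eq_measure_integral => A mA _; exact: nuE.
Qed.

Lemma L2_image (f : Y -> R) : measurable_fun setT f -> L2 nu f <-> L2 mu (f \o phi).
Proof.
move=> mf; rewrite !L2P.
have := @integrable_image (fun y => f y ^+ 2) (measurable_funX 2 mf).
move=> [h1 h2]; split=> [[_ /h1]|[_ /h2]]; split=> //.
exact: measurableT_comp.
Qed.

Lemma L2dot_image (f g : Y -> R) : L2 nu f -> L2 nu g ->
  L2dot nu f g = L2dot mu (f \o phi) (g \o phi).
Proof.
move=> Lf Lg; apply: (@Rintegral_image (fun y => f y * g y)).
  apply: measurable_funM; [exact: (L2_measurable Lf)|exact: (L2_measurable Lg)].
apply: L2_mul; [exact/(L2_image (L2_measurable Lf))|exact/(L2_image (L2_measurable Lg))].
Qed.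

End change_of_variables.

Section continuous_measurable.
Context {R : realType} {X : ptopologicalType}.

Lemma continuous_borel (f : X -> R) : continuous f -> measurable_fun (setT : set (borel X)) f.
Proof.
move=> /continuousP cf.
apply: (@measurability _ _ (borel X) _ setT f _ (RGenOInfty.measurableE R)).
move=> _ [_ [a ->] <-]; rewrite setTI; apply: open_measurable.
by apply: cf; exact: interval_open.
Qed.

Lemma continuous_borelY (Y : ptopologicalType) (f : X -> Y) : continuous f ->
  measurable_fun (setT : set (borel X)) (f : borel X -> borel Y).
Proof.
move=> /continuousP cf.
apply: (@measurability _ _ (borel X) (borel Y) setT f (@open Y)) => //.
by move=> _ [U oU <-]; rewrite setTI; apply: open_measurable; exact: cf.
Qed.

Lemma compact_fun_bounded (f : X -> R) : compact [set: X] -> continuous f ->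
  exists2 M, 0 < M & forall x, `|f x| <= M.
Proof.
move=> cX cf; have : compact (f @` setT).
  by apply: continuous_compact => //; exact: continuous_subspaceT.
move=> /compact_bounded[M [_ hM]]; exists (`|M| + 1); first by rewrite ltr_wpDl.
by move=> x; apply: (hM (`|M| + 1)); [rewrite (le_lt_trans (ler_norm _))// ltrDl|exists x].
Qed.

Lemma continuous_integrable (nu : probability (borel X) R) (f : X -> R) :
  compact [set: X] -> continuous f -> nu.-integrable setT (EFin \o f).
Proof.
move=> cX cf; have [M M0 fM] := compact_fun_bounded cX cf.
apply: measurable_bounded_integrable => //.
- by rewrite (le_lt_trans (probability_le1 _ _))// ltry.
- exact: continuous_borel.
- exists M; split; first exact: num_real.
  by move=> N MN x _ /=; rewrite (le_trans (fM x))// ltW.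
Qed.

Lemma continuous_sum (n : nat) (f : 'I_n -> X -> R) : (forall k, continuous (f k)) ->
  continuous (fun x => \sum_(k < n) f k x).
Proof.
elim: n f => [|n ih] f cf.
  by under eq_fun do rewrite big_ord0; exact: cst_continuous.
under eq_fun do rewrite big_ord_recl.
move=> x; apply: cvgD; first exact: cf.
by apply: (ih (fun k => f (lift ord0 k))) => k; exact: cf.
Qed.

End continuous_measurable.

Lemma Rintegral_sum (R : realType) d (T : measurableType d) (mu : {measure set T -> \bar R})
  (n : nat) (f : 'I_n -> T -> R) : (forall k, mu.-integrable setT (EFin \o f k)) ->
  mu.-integrable setT (EFin \o (fun x => \sum_(k < n) f k x)) /\
  \int[mu]_x (\sum_(k < n) f k x) = \sum_(k < n) \int[mu]_x f k x.
Proof.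
elim: n f => [|n ih] f fi.
  split.
    rewrite (_ : EFin \o _ = cst 0%E); first exact: integrable0.
    by apply/funext => x /=; rewrite big_ord0.
  under eq_Rintegral do rewrite big_ord0.
  by rewrite Rintegral_cst// mul0r big_ord0.
have [ii ie] := ih (fun k => f (lift ord0 k)) (fun k => fi _).
have e : (fun x => \sum_(k < n.+1) f k x) =
    (fun x => f ord0 x + \sum_(k < n) f (lift ord0 k) x).
  by apply/funext => x; rewrite big_ord_recl.
rewrite e; split; last by rewrite RintegralD// ie big_ord_recl.
have := integrableD measurableT (fi ord0) ii.
by congr (_.-integrable _ _).
Qed.

Section product_integral.
Context {R : realType} {X G : ptopologicalType}.
Variables (mu : {measure set (borel X) -> \bar R}) (nu : probability (borel G) R).

Lemma prod_integral (m : {sigma_finite_measure set (borel X) -> \bar R})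
    (a : X -> R) (b : G -> R) :
  m.-integrable setT (EFin \o a) -> nu.-integrable setT (EFin \o b) ->
  (m \x nu)%E.-integrable setT (EFin \o (fun z : borel X * borel G => a z.1 * b z.2)) /\
  \int[(m \x nu)%E]_z (a z.1 * b z.2) = (\int[m]_x a x) * (\int[nu]_g b g).
Proof.
move=> ia ib; pose ab (z : borel X * borel G) : R := a z.1 * b z.2.
have ma : measurable_fun (setT : set (borel X)) a.
  by apply/measurable_EFinP; case/integrableP : ia.
have mb : measurable_fun (setT : set (borel G)) b.
  by apply/measurable_EFinP; case/integrableP : ib.
have mab : measurable_fun (setT : set (borel X * borel G)) (fun z => a z.1 * b z.2).
  by apply: measurable_funM; [exact: (measurableT_comp ma)|exact: (measurableT_comp mb)].
have iab : (m \x nu)%E.-integrable setT (EFin \o (fun z : borel X * borel G => a z.1 * b z.2)).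
  apply/integrableP; split; first exact/measurable_EFinP.
  rewrite fubini_tonelli1; last 2 first.
  - by apply: measurableT_comp => //; exact/measurable_EFinP.
  - by move=> z; exact: abse_ge0.
  rewrite /fubini_F.
  have nb x : (\int[nu]_y `|(EFin \o ab) (x, y)| =
      `|(a x)%:E| * \int[nu]_y `|(b y)%:E|)%E.
    rewrite -ge0_integralZl//; last by apply: measurableT_comp => //; exact/measurable_EFinP.
    by apply: eq_integral => y _; rewrite /= normrM.
  under eq_integral do rewrite nb.
  have : (\int[nu]_y `|(b y)%:E| < +oo)%E by case/integrableP : ib.
  have : (0 <= \int[nu]_y `|(b y)%:E|)%E by apply: integral_ge0 => y _; exact: abse_ge0.
  case: (\int[nu]_y _)%E => // r r0 _.
  rewrite ge0_integralZr//; last by apply: measurableT_comp => //; exact/measurable_EFinP.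
  have : (\int[m]_x `|(a x)%:E| < +oo)%E by case/integrableP : ia.
  have : (0 <= \int[m]_x `|(a x)%:E|)%E by apply: integral_ge0 => y _; exact: abse_ge0.
  by case: (\int[m]_x _)%E => // t t0 _; rewrite -EFinM ltry.
split=> //.
rewrite /Rintegral -integral12_prod_meas1//.
have nb x : (fubini_F nu (EFin \o ab) x =
    (a x)%:E * \int[nu]_y (b y)%:E)%E.
  by rewrite /fubini_F -integralZl//; apply: eq_integral => y _; rewrite /= EFinM.
rewrite [in LHS](eq_integral (fun x : borel X => (a x)%:E * \int[nu]_y (b y)%:E)%E);
  last by move=> x _; exact: nb.
have /fineK <- := integrable_fin_num measurableT ib.
rewrite integralZr// fineM//; exact: (integrable_fin_num measurableT ia).
Qed.

(** A name for mu under which its sigma-finiteness, which is a hypothesis, can be declared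
    as a structure, as the Fubini theorem requires. *)
Definition sf_copy (sf : sigma_finite setT mu) : set (borel X) -> \bar R := mu.

HB.instance Definition _ sf := Measure.copy (sf_copy sf) mu.
HB.instance Definition _ sf :=
  Measure_isSigmaFinite.Build _ _ _ (sf_copy sf) sf.

Lemma prod_integral_sf (sf : sigma_finite setT mu) (a : X -> R) (b : G -> R) :
  mu.-integrable setT (EFin \o a) -> nu.-integrable setT (EFin \o b) ->
  (mu \x nu)%E.-integrable setT (EFin \o (fun z : borel X * borel G => a z.1 * b z.2)) /\
  \int[(mu \x nu)%E]_z (a z.1 * b z.2) = (\int[mu]_x a x) * (\int[nu]_g b g).
Proof.
exact: (@prod_integral (sf_copy sf)).
Qed.

End product_integral.

(** * Forms on a core and their integrals over the fibre *)

Record posform (R : realType) (T : Type) (D : set (T -> R))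
    (F : (T -> R) -> (T -> R) -> R) : Prop := PosForm {
  pf_lin : forall c f g h, D f -> D g -> D h -> F (c *: f + g) h = c * F f h + F g h ;
  pf_sym : forall f g, D f -> D g -> F f g = F g f ;
  pf_ge0 : forall f, D f -> 0 <= F f f }.

Record function_space (R : realType) (T : Type) (D : set (T -> R)) : Prop :=
  FunctionSpace {
  fs_0 : D 0 ;
  fs_lin : forall c f g, D f -> D g -> D (c *: f + g) }.

Section posform.
Context {R : realType} {T : Type} (D : set (T -> R)) (F : (T -> R) -> (T -> R) -> R).
Hypotheses (DD : function_space D) (FF : posform D F).

Lemma fs_Z c f : D f -> D (c *: f).
Proof. by move=> Df; rewrite -[_ *: _]addr0; apply: fs_lin => //; exact: fs_0. Qed.

Lemma fs_D f g : D f -> D g -> D (f + g).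
Proof. by move=> Df Dg; rewrite -[f]scale1r; exact: fs_lin. Qed.

Lemma fs_B f g : D f -> D g -> D (f - g).
Proof. by move=> Df Dg; rewrite addrC -scaleN1r; exact: fs_lin. Qed.

Lemma fs_sum n (f : 'I_n -> T -> R) : (forall k, D (f k)) -> D (\sum_(k < n) f k).
Proof.
move=> Df; elim/big_ind : _ => //; [exact: fs_0|exact: fs_D].
Qed.

Lemma fs_comb n (f : 'I_n -> T -> R) (c : 'I_n -> R) :
  (forall k, D (f k)) -> D (fun x => \sum_(k < n) f k x * c k).
Proof.
move=> Df; rewrite (_ : (fun x => _) = \sum_(k < n) c k *: f k); last first.
  by apply/funext => x; rewrite fct_sumE; apply: eq_bigr => k _; rewrite mulrC.
by apply: fs_sum => k; exact: fs_Z.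
Qed.

Lemma pf_0l h : D h -> F 0 h = 0.
Proof.
move=> Dh; have D0 := fs_0 DD; have := pf_lin FF (-1) D0 D0 Dh.
by rewrite scaler0 addr0 mulN1r addNr.
Qed.

Lemma pf_Z c f h : D f -> D h -> F (c *: f) h = c * F f h.
Proof.
move=> Df Dh; have := pf_lin FF c Df (fs_0 DD) Dh.
by rewrite addr0 (pf_0l Dh) addr0.
Qed.

Lemma pf_D f g h : D f -> D g -> D h -> F (f + g) h = F f h + F g h.
Proof. by move=> Df Dg Dh; have := pf_lin FF 1 Df Dg Dh; rewrite scale1r mul1r. Qed.

Lemma pf_comb n (f : 'I_n -> T -> R) (c : 'I_n -> R) h : (forall k, D (f k)) -> D h ->
  F (fun x => \sum_(k < n) f k x * c k) h = \sum_(k < n) c k * F (f k) h.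
Proof.
move=> Df Dh.
rewrite (_ : (fun x => _) = \sum_(k < n) c k *: f k); last first.
  by apply/funext => x; rewrite fct_sumE; apply: eq_bigr => k _; rewrite mulrC.
have [] : D (\sum_(k < n) c k *: f k) /\
    F (\sum_(k < n) c k *: f k) h = \sum_(k < n) c k * F (f k) h; last by [].
elim/big_ind2 : _ => [|f1 x1 f2 x2 [D1 e1] [D2 e2]|k _].
- by split; [exact: fs_0|exact: pf_0l].
- by split; [exact: fs_D|rewrite pf_D// e1 e2].
- by split; [exact: fs_Z|rewrite pf_Z].
Qed.

Lemma pf_sqB f h : D f -> D h -> F (f - h) (f - h) = F f f - 2 * F f h + F h h.
Proof.
move=> Df Dh; have DN : D (- h) by rewrite -scaleN1r; exact: fs_Z.
have Dfh := fs_B Df Dh.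
rewrite pf_D// -(scaleN1r h) pf_Z//; last by rewrite scaleN1r.
rewrite scaleN1r (pf_sym FF Df Dfh) (pf_sym FF Dh Dfh).
rewrite !pf_D// -(scaleN1r h) !pf_Z// (pf_sym FF Dh Df); ring.
Qed.

End posform.

Section fibre.
Context {R : realType} {X G : ptopologicalType} (B : set X).
Variable nu : probability (borel G) R.
Hypothesis cG : compact [set: G].
Local Notation Y := (glued G B).
Local Notation p := (@glue_pi X G B).

(** The condition that defines the core of the next level from the core D: the pull-back
    of f to X * G is in the algebraic tensor product of D and C(G). *)
Definition tensor_rep (D : set (X -> R)) (f : Y -> R) (n : nat)
    (fk : 'I_n -> X -> R) (hk : 'I_n -> G -> R) : Prop :=
  [/\ forall k, D (fk k), forall k, continuous (hk k)
    & forall x g, f (p (x, g)) = \sum_(k < n) fk k x * hk k g].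

Definition tensor (D : set (X -> R)) (f : Y -> R) : Prop :=
  exists n (fk : 'I_n -> X -> R) (hk : 'I_n -> G -> R), tensor_rep D f fk hk.

Definition fsec (f : Y -> R) (g : G) : X -> R := fun x => f (p (x, g)).

Definition fmean (h : G -> R) (f : Y -> R) : X -> R :=
  fun x => \int[nu]_g (h g * f (p (x, g))).

Definition fibre_form (F : (X -> R) -> (X -> R) -> R) (f w : Y -> R) : R :=
  \int[nu]_g F (fsec f g) (fsec w g).

Lemma fsec_lin c f w g : fsec (c *: f + w) g = c *: fsec f g + fsec w g.
Proof. by []. Qed.

Lemma contM (f w : G -> R) : continuous f -> continuous w -> continuous (fun g => f g * w g).
Proof. by move=> cf cw g; apply: cvgM; [exact: cf|exact: cw]. Qed.

Lemma nu_int (f : G -> R) : continuous f -> nu.-integrable setT (EFin \o f).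
Proof. exact: continuous_integrable. Qed.

Lemma nu_sum (n : nat) (f : 'I_n -> G -> R) : (forall k, continuous (f k)) ->
  \int[nu]_g (\sum_(k < n) f k g) = \sum_(k < n) \int[nu]_g f k g.
Proof.
move=> cf; have fi k : nu.-integrable setT (EFin \o f k) by exact: nu_int.
exact: (Rintegral_sum fi).2.
Qed.

Section tensor.
Implicit Types (h : G -> R) (f w : Y -> R).
Variables (D : set (X -> R)).
Hypothesis DD : function_space D.

Lemma tensor_sec f g : tensor D f -> D (fsec f g).
Proof.
move=> [n [fk [hk [Df ch e]]]]; rewrite /fsec.
rewrite (_ : (fun x => _) = fun x => \sum_(k < n) fk k x * hk k g); last exact/funext.
exact: (fs_comb DD (fun k => hk k g)).
Qed.

Lemma tensor_fibre_cont f x : tensor D f -> continuous (fun g => f (p (x, g))).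
Proof.
move=> [n [fk [hk [Df ch e]]]].
rewrite (_ : (fun g => _) = fun g => \sum_(k < n) fk k x * hk k g); last exact/funext.
apply: continuous_sum => k; apply: contM => //; exact: cst_continuous.
Qed.

Lemma fmean_int h f x : continuous h -> tensor D f ->
  nu.-integrable setT (EFin \o (fun g => h g * f (p (x, g)))).
Proof. by move=> ch tf; apply: nu_int; apply: contM => //; exact: tensor_fibre_cont. Qed.

Lemma fmean_lin c h f (f' : Y -> R) : continuous h -> tensor D f -> tensor D f' ->
  fmean h (c *: f + f') = c *: fmean h f + fmean h f'.
Proof.
move=> ch tf tf'; apply/funext => x; rewrite /fmean.
have i1 := fmean_int x ch tf; have i2 := fmean_int x ch tf'.
have i3 : nu.-integrable setT (EFin \o (fun g => c * (h g * f (p (x, g))))).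
  apply: nu_int; apply: contM; first exact: cst_continuous.
  by apply: contM => //; exact: tensor_fibre_cont.
transitivity (\int[nu]_g (c * (h g * f (p (x, g))) + h g * f' (p (x, g)))).
  apply: eq_Rintegral => g _.
  have -> : (c *: f + f') (p (x, g)) = c * f (p (x, g)) + f' (p (x, g)) by [].
  by ring.
by rewrite RintegralD// RintegralZl.
Qed.

Lemma fmean_rep h f n (fk : 'I_n -> X -> R) hk : continuous h -> tensor_rep D f fk hk ->
  fmean h f = fun x => \sum_(k < n) fk k x * \int[nu]_g (h g * hk k g).
Proof.
move=> ch [Df chk e]; apply/funext => x; rewrite /fmean.
transitivity (\int[nu]_g (\sum_(k < n) fk k x * (h g * hk k g))).
  by apply: eq_Rintegral => g _; rewrite e mulr_sumr; apply: eq_bigr => k _; ring.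
rewrite (@nu_sum n (fun k g => fk k x * (h g * hk k g))).
  by apply: eq_bigr => k _; rewrite RintegralZl//; apply: nu_int; exact: contM.
by move=> k; apply: contM; [exact: cst_continuous|exact: contM].
Qed.

Lemma fmean_tensor h f : continuous h -> tensor D f -> D (fmean h f).
Proof.
move=> ch [n [fk [hk r]]]; rewrite (fmean_rep ch r); apply: (fs_comb DD).
by case: r.
Qed.

Lemma tensor_space : function_space (tensor D).
Proof.
split.
  exists 0%N, (fun=> 0), (fun=> 0); split=> [[]//|[]//|x g].
  by rewrite big_ord0.
move=> c f w [n [fk [hk [Df ch e]]]] [m [wk [lk [Dw cl e']]]].
exists (n + m)%N,
  (fun k : 'I_(n + m) => match fintype.split k with inl i => c *: fk i | inr i => wk i end),
  (fun k : 'I_(n + m) => match fintype.split k with inl i => hk i | inr i => lk i end); split.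
- by move=> k; case: fintype.split => i //; exact: (fs_Z DD).
- by move=> k; case: fintype.split => i.
- move=> x g; rewrite !fctE e e' big_split_ord /=; congr (_ + _).
    rewrite /GRing.scale /= mulr_sumr; apply: eq_bigr => k _.
    by rewrite -[lshift _ _]/(unsplit (inl k)) unsplitK mulrA.
  by apply: eq_bigr => k _; rewrite -[rshift _ _]/(unsplit (inr k)) unsplitK.
Qed.

Section form.
Variable F : (X -> R) -> (X -> R) -> R.
Hypothesis FF : posform D F.

Lemma fsec_comb f (w : X -> R) g n (fk : 'I_n -> X -> R) hk : tensor_rep D f fk hk -> D w ->
  F (fsec f g) w = \sum_(k < n) hk k g * F (fk k) w.
Proof.
move=> [Df ch e] Dw; rewrite /fsec.
rewrite (_ : (fun x => _) = fun x => \sum_(k < n) fk k x * hk k g); last exact/funext.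
exact: (pf_comb DD FF (fun k => hk k g)).
Qed.

Lemma fsec_cont1 f (w : X -> R) : tensor D f -> D w -> continuous (fun g => F (fsec f g) w).
Proof.
move=> [n [fk [hk r]]] Dw.
rewrite (_ : (fun g => _) = fun g => \sum_(k < n) hk k g * F (fk k) w); last first.
  by apply/funext => g; exact: fsec_comb.
case: r => _ ch _; apply: continuous_sum => k; apply: contM => //; exact: cst_continuous.
Qed.

Lemma fsec_cont f w : tensor D f -> tensor D w ->
  continuous (fun g => F (fsec f g) (fsec w g)).
Proof.
move=> [n [fk [hk r]]] tw.
rewrite (_ : (fun g => _) = fun g => \sum_(k < n) hk k g * F (fsec w g) (fk k)); last first.
  apply/funext => g; rewrite (fsec_comb g r (tensor_sec g tw)).
  apply: eq_bigr => k _; congr (_ * _); apply: (pf_sym FF); last exact: tensor_sec.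
  by case: r.
case: r => Df ch _; apply: continuous_sum => k; apply: contM => //.
exact: fsec_cont1.
Qed.

Lemma fmean_pair h f v : continuous h -> tensor D f -> D v ->
  F (fmean h f) v = \int[nu]_g (h g * F (fsec f g) v).
Proof.
move=> ch tf Dv; have [n [fk [hk r]]] := tf; have [Df chk e] := r.
have ik k : nu.-integrable setT (EFin \o (fun g => h g * hk k g)) by apply: nu_int; exact: contM.
rewrite (fmean_rep ch r) (pf_comb DD FF)//.
transitivity (\int[nu]_g (\sum_(k < n) F (fk k) v * (h g * hk k g))).
  rewrite (@nu_sum n (fun k g => F (fk k) v * (h g * hk k g))).
    by apply: eq_bigr => k _; rewrite RintegralZl// mulrC.
  by move=> k; apply: contM; [exact: cst_continuous|exact: contM].
apply: eq_Rintegral => g _; rewrite (fsec_comb g r Dv) mulr_sumr.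
by apply: eq_bigr => k _; ring.
Qed.

(** The weighted fibre mean is adjoint to the tensor product with a function of G. *)
Lemma fibre_pair f w n (wk : 'I_n -> X -> R) hk : tensor D f -> tensor_rep D w wk hk ->
  fibre_form F f w = \sum_(k < n) F (fmean (hk k) f) (wk k).
Proof.
move=> tf r; have [Dw ch e] := r.
have Df g := tensor_sec g tf.
transitivity (\int[nu]_g (\sum_(k < n) hk k g * F (fsec f g) (wk k))).
  apply: eq_Rintegral => g _; rewrite (pf_sym FF)//; last first.
    by apply: tensor_sec; exists n, wk, hk.
  rewrite (fsec_comb g r (Df g)); apply: eq_bigr => k _.
  by congr (_ * _); exact: (pf_sym FF).
rewrite (@nu_sum n (fun k g => hk k g * F (fsec f g) (wk k))).
  by apply: eq_bigr => k _; rewrite fmean_pair.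
by move=> k; apply: contM => //; exact: fsec_cont1.
Qed.

Lemma fibre_posform : posform (tensor D) (fibre_form F).
Proof.
split.
- move=> c f f' w tf tf' tw.
  have i1 := fsec_cont tf tw; have i2 := fsec_cont tf' tw.
  rewrite /fibre_form -RintegralZl//; last exact: nu_int.
  rewrite -RintegralD//; [|apply: nu_int; apply: contM => //; exact: cst_continuous|exact: nu_int].
  apply: eq_Rintegral => g _; rewrite fsec_lin (pf_lin FF)//; exact: tensor_sec.
- move=> f w tf tw; apply: eq_Rintegral => g _; apply: (pf_sym FF); exact: tensor_sec.
- move=> f tf; apply: Rintegral_ge0 => g _; apply: (pf_ge0 FF); exact: tensor_sec.
Qed.

Lemma Rintegral_prob (c : R) : \int[nu]_g c = c.
Proof. by rewrite Rintegral_cst//= probability_setT mulr1. Qed.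

(** With t = fmean h f, expand the integral over the fibre of the nonnegative
    F (h g *: f_g - t) (h g *: f_g - t). *)
Lemma fmean_bound h f M : continuous h -> (forall g, `|h g| <= M) -> tensor D f ->
  F (fmean h f) (fmean h f) <= M ^+ 2 * fibre_form F f f.
Proof.
move=> ch hM tf; set t := fmean h f.
have Dt : D t by exact: fmean_tensor.
have i1 := fsec_cont tf tf; have i2 := fsec_cont1 tf Dt.
have I1 : continuous (fun g => M ^+ 2 * F (fsec f g) (fsec f g)).
  by apply: contM => //; exact: cst_continuous.
have I2 : continuous (fun g => 2 * (h g * F (fsec f g) t)).
  by apply: contM; [exact: cst_continuous|exact: contM].
have e : F t t = \int[nu]_g (h g * F (fsec f g) t) by exact: fmean_pair.
have : 0 <= \int[nu]_g (M ^+ 2 * F (fsec f g) (fsec f g) - 2 * (h g * F (fsec f g) t) + F t t).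
  apply: Rintegral_ge0 => g _.
  have Df := tensor_sec g tf.
  have Dh := fs_Z DD (h g) Df; have := pf_ge0 FF (fs_B DD Dh Dt).
  rewrite (pf_sqB DD FF Dh Dt) (pf_Z DD FF (h g) Df Dh) (pf_Z DD FF (h g) Df Dt).
  rewrite (pf_sym FF Df Dh) (pf_Z DD FF (h g) Df Df).
  have := pf_ge0 FF Df; set x := F (fsec f g) (fsec f g) => x0.
  have h2 : h g * h g <= M ^+ 2.
    rewrite -expr2 -(ger0_norm (sqr_ge0 (h g))) normrX ler_pXn2r ?nnegrE//.
    exact: le_trans (hM g).
  have : h g * h g * x <= M ^+ 2 * x by rewrite ler_wpM2r.
  rewrite mulrA; lra.
rewrite RintegralD ?RintegralB ?RintegralZl//; last 6 first.
- exact: nu_int i1.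
- by apply: nu_int; exact: contM.
- exact: nu_int I1.
- exact: nu_int I2.
- have := nu_int (fun g => cvgB (I1 g) (I2 g)); exact.
- by apply: nu_int; exact: cst_continuous.
rewrite Rintegral_prob -e -/(fibre_form F f f); lra.
Qed.

End form.
End tensor.
End fibre.

(** * Urysohn functions and approximation of indicators *)

Section compact_support.
Context {R : realType} {X : ptopologicalType}.
Implicit Types f g : X -> R.

Lemma Cc_sub f g : continuous f -> Cc g -> (forall x, g x = 0 -> f x = 0) -> Cc f.
Proof.
move=> cf [_ cg] gf; split=> //.
apply: (@subclosed_compact _ _ _ (@closed_closure _ _) cg).
by apply: closure_subset => x /=; apply: contra_neq; exact: gf.
Qed.

Lemma Cc_support f (C : set X) : continuous f -> compact C -> closed C ->
  (forall x, ~ C x -> f x = 0) -> Cc f.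
Proof.
move=> cf cC clC fC; split=> //.
apply: (@subclosed_compact _ _ _ (@closed_closure _ _) cC).
rewrite [X in _ `<=` X](closure_id C).1//; apply: closure_subset => x /= fx.
by apply: contrapT => /fC /eqP; exact/negP.
Qed.

Lemma cont_lin c f g : continuous f -> continuous g -> continuous (c *: f + g).
Proof.
move=> cf cg x; apply: cvgD; last exact: cg.
by apply: cvgM; [exact: cvg_cst|exact: cf].
Qed.

Lemma Cc_space : function_space (@Cc R X).
Proof.
split.
  split; first exact: cst_continuous.
  rewrite (_ : [set _ | _] = set0) ?closure0; first exact: compact0.
  by apply/seteqP; split=> x //=; rewrite eqxx.
move=> c f g [cf kf] [cg kg]; split; first exact: cont_lin.
apply: (@subclosed_compact _ _ _ (@closed_closure _ _) (compactU kf kg)).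
rewrite -closureU; apply: closure_subset => x /= fgx.
have [fx0|] := eqVneq (f x) 0; last by left.
right; apply: contra_neq fgx => gx0.
have -> : (c *: f + g) x = c * f x + g x by [].
by rewrite fx0 gx0 mulr0 addr0.
Qed.

(** Complete regularity gives for each point x of K a function that is 1 at x; finitely
    many of the sets where these functions exceed 1/2 cover K, and twice their sum,
    truncated at 1, is the function. *)
Lemma urysohn_compact (K U : set X) : locally_compact [set: X] -> hausdorff_space X ->
  compact K -> open U -> K `<=` U -> exists f : X -> R,
  [/\ Cc f, forall x, 0 <= f x <= 1, forall x, K x -> f x = 1 & forall x, ~ U x -> f x = 0].
Proof.
move=> lcX hX cK oU KU.
have /choice[g gP] : forall x : X, exists g : X -> R, K x ->
    [/\ Cc g, forall y, 0 <= g y, g x = 1 & forall y, ~ U y -> g y = 0].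
  move=> x; have [Kx|nKx] := pselect (K x); last by exists (fun=> 0).
  have [C xC [cC clC]] := lcX x I.
  pose V := U `&` C^°.
  have oV : open V by apply: openI => //; exact: open_interior.
  have Vx : V x.
    have xC' : \forall y \near x, [set: X] y -> C y by exact: xC.
    have nC : nbhs x C by apply: filterS xC' => y; exact.
    by split; [exact: KU|exact: nbhs_singleton (nbhs_interior nC)].
  have nVx : ~ (~` V) x by apply.
  have := @locally_compact_completely_regular X R lcX hX x (~` V) (open_closedC oV) nVx.
  move=> /(@uniform_separatorP _ R)[u [cu ur u0 u1]].
  exists (fun y => 1 - u y) => _.
  have uV y : ~ V y -> u y = 1 by move=> Vy; apply: u1; exists y.
  have cu1 : continuous (fun y => 1 - u y).
    by move=> y; apply: cvgB; [exact: cvg_cst|exact: cu].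
  split=> //.
  - apply: (Cc_support cu1 cC clC) => y Cy; rewrite uV ?subrr// => -[_ /interior_subset].
    exact: Cy.
  - by move=> y; rewrite subr_ge0; have /ur := imageT u y; rewrite /= in_itv/= => /andP[].
  - by rewrite (u0 (u x)) ?subr0//; exists x.
  - by move=> y Uy; rewrite uV ?subrr// => -[].
have gc x : K x -> continuous (g x) by move=> /gP[[]].
have : cover_compact K by rewrite -compact_cover.
move=> /(_ X K (fun x => g x @^-1` [set r | 2^-1 < r]))[||D' DK Dcov].
- move=> x Kx; have /continuousP := gc x Kx; apply; exact: open_gt.
- by move=> x Kx; exists x => //=; have [_ _ -> _] := gP x Kx; rewrite invf_lt1// ltr1n.
pose s : seq X := finmap.enum_fset D'.
have sK x : x \in s -> K x by move=> /DK; rewrite inE.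
pose S : X -> R := \sum_(x <- s) g x.
have SC : Cc S.
  rewrite /S big_seq; elim/big_ind : _ => [|f1 f2 h1 h2|x /sK Kx].
  - exact: fs_0 Cc_space.
  - exact: fs_D Cc_space _ _ h1 h2.
  - by have [] := gP x Kx.
have SE y : S y = \sum_(x <- s) g x y by rewrite /S fct_sumE.
have S0 y : 0 <= S y.
  by rewrite SE big_seq; apply: sumr_ge0 => x /sK Kx; have [_ + _ _] := gP x Kx; exact.
have cS : continuous (fun y => 2 * S y).
  by move=> y; apply: cvgM; [exact: cvg_cst|exact: SC.1].
exists (fun y => Num.min (2 * S y) 1); split.
- apply: (Cc_sub _ SC) => [y|y ->]; last by rewrite mulr0; apply/min_idPl.
  by apply: (@continuous_min _ _ (fun y => 2 * S y) (fun=> 1)); [exact: cS|exact: cst_continuous].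
- move=> y; rewrite le_min ler01 andbT ge_min lexx orbT andbT.
  by rewrite mulr_ge0.
- move=> y /Dcov[x /= xs gxy]; apply/min_idPr.
  have : g x y <= S y.
    rewrite SE (big_rem x)//= lerDl big_seq; apply: sumr_ge0 => z /mem_rem/sK Kz.
    by have [_ + _ _] := gP z Kz; exact.
  by move: gxy; lra.
- move=> y Uy; rewrite SE big_seq big1 ?mulr0; first by apply/min_idPl.
  by move=> x /sK Kx; have [_ _ _] := gP x Kx; exact.
Qed.

End compact_support.

Section regularity.
Context {R : realType} {X : ptopologicalType}.
Variable mu : {measure set (borel X) -> \bar R}.

Lemma closed_measurable (K : set X) : closed K -> measurable (K : set (borel X)).
Proof.
move=> cK; rewrite -[K]setCK; apply: measurableC; apply: open_measurable.
exact: closed_openC.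
Qed.

Lemma inner_regular (U : set X) (e : R) : hausdorff_space X -> radon mu -> open U ->
  (mu U < +oo)%E -> 0 < e -> exists K : set X,
  [/\ compact K, K `<=` U, measurable (K : set (borel X)) & (mu (U `\` K) < e%:E)%E].
Proof.
move=> hX [_ inn _] oU fU e0.
have mU : (mu U \is a fin_num)%E by rewrite ge0_fin_numE.
have := @ub_ereal_sup_adherent R [set mu K | K in [set K : set X | compact K /\ K `<=` U]] e e0.
rewrite -inn// => /(_ mU)[_ [K [cK KU] <-] h]; exists K.
have mK : measurable (K : set (borel X)) by apply: closed_measurable; exact: compact_closed.
split=> //; rewrite (measureD (open_measurable oU) mK)//.
have fK : mu K \is a fin_num.
  rewrite ge0_fin_numE//; apply: le_lt_trans fU.
  by apply: le_measure; rewrite ?inE//; exact: open_measurable.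
rewrite (_ : U `&` K = K); last by rewrite setIC; apply/setIidPl.
by rewrite lteBlDr// lteBlDl// in h *.
Qed.

Lemma ind_approx (U K : set X) (f : X -> R) : open U -> measurable (K : set (borel X)) ->
  (mu U < +oo)%E -> K `<=` U -> measurable_fun (setT : set (borel X)) f ->
  (forall x, 0 <= f x <= 1) -> (forall x, K x -> f x = 1) -> (forall x, ~ U x -> f x = 0) ->
  L2dot mu (f - \1_U) (f - \1_U) <= fine (mu (U `\` K)).
Proof.
move=> oU mK fU KU mf f01 fK f0.
have mU := open_measurable oU.
have mUK : measurable (U `\` K : set (borel X)) by exact: measurableD.
have fUK : (mu (U `\` K) < +oo)%E.
  by apply: le_lt_trans fU; apply: le_measure; rewrite ?inE//; exact: subDsetl.
have ii : mu.-integrable setT (EFin \o (\1_(U `\` K) : borel X -> R)).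
  apply/integrableP; split; first exact/measurable_EFinP/measurable_indic.
  under eq_integral do rewrite gee0_abs ?lee_fin//.
  by rewrite integral_indic// setIT.
have le x : (f x - \1_U x) * (f x - \1_U x) <= \1_(U `\` K) x.
  rewrite !indicE; have [Ux|nUx] := pselect (U x).
    rewrite (mem_set Ux) /=; have [Kx|nKx] := pselect (K x).
      by rewrite fK// subrr mul0r.
    rewrite mem_set//=; have /andP[a b] := f01 x; nra.
  by rewrite memNset// f0// subrr mul0r.
have mg : measurable_fun (setT : set (borel X)) (fun x => (f x - \1_U x) * (f x - \1_U x)).
  by apply: measurable_funM; apply: measurable_funB => //; exact: measurable_indic.
have ig : mu.-integrable setT (EFin \o (fun x => (f x - \1_U x) * (f x - \1_U x))).
  apply: le_integrable ii => //; first exact/measurable_EFinP.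
  move=> x _ /=; rewrite lee_fin ger0_norm; last by rewrite -expr2 sqr_ge0.
  by rewrite ger0_norm.
have -> : fine (mu (U `\` K)) = \int[mu]_x \1_(U `\` K) x.
  by rewrite /Rintegral integral_indic// setIT.
by apply: (le_Rintegral measurableT ig ii) => x _; exact: le.
Qed.

End regularity.

(** * One step of the construction *)

(** What is preserved along the sequence of spaces. [cf_clos] is closability. [cf_ind]
    yields density in L^2; the approximating functions vanish outside U so that they can be
    multiplied by functions of the fibre and still be functions on the glued space, see
    [step_rect]. *)
Record core_form_on (R : realType) (X : ptopologicalType)
    (mu : {measure set (borel X) -> \bar R}) (E : bform R X) : Prop := CoreFormOn {
  cf_base : exists b : nat -> set X, countable_base b ;
  cf_exh : open_exhaustion mu ;
  cf_fs : function_space (fdom E) ;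
  cf_pf : posform (fdom E) E ;
  cf_Cc : fdom E `<=` @Cc R X ;
  cf_L2 : fdom E `<=` L2 mu ;
  cf_clos : forall u : nat -> X -> R, (forall n, fdom E (u n)) ->
    (forall e, 0 < e -> exists N, forall m n, (N <= m)%N -> (N <= n)%N ->
       E (u m - u n) (u m - u n) < e) ->
    (forall e, 0 < e -> exists N, forall n, (N <= n)%N -> L2dot mu (u n) (u n) < e) ->
    forall w, fdom E w -> rtends (fun n => E (u n) w) 0 ;
  cf_ind : forall U : set X, open U -> (mu U < +oo)%E -> forall e, 0 < e ->
    exists f, [/\ fdom E f, forall x, ~ U x -> f x = 0 &
      L2dot mu (f - \1_U) (f - \1_U) < e] }.

Lemma L2_posform (R : realType) d (T : measurableType d)
  (mu : {measure set T -> \bar R}) : posform (L2 mu) (L2dot mu).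
Proof.
split; first by move=> c f g h Lf Lg Lh; exact: L2dotP.
  by move=> f g _ _; exact: L2dotC.
by move=> f _; exact: L2dot_ge0.
Qed.

Lemma posform_sub (R : realType) (T : Type) (D D' : set (T -> R)) F :
  D `<=` D' -> posform D' F -> posform D F.
Proof.
move=> DD' [l s g]; split.
- by move=> c f h k /DD' Df /DD' Dh /DD' Dk; exact: l.
- by move=> f h /DD' Df /DD' Dh; exact: s.
- by move=> f /DD' Df; exact: g.
Qed.

Section step.
Context {R : realType} {X G : ptopologicalType} (B : set X).
Variables (mu : {measure set (borel X) -> \bar R}) (nu : probability (borel G) R).
Variable mu' : {measure set (borel (glued G B)) -> \bar R}.
Variable E : bform R X.
Local Notation Y := (glued G B).
Local Notation p := (@glue_pi X G B).
Local Notation phi := (@glue_phi X G B).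
Hypotheses (cG : compact [set: G]) (hG : hausdorff_space G).
Hypothesis baseG : exists b : nat -> set G, countable_base b.
Hypothesis nu_radon : radon nu.
Hypothesis cB : closed B.
Hypothesis muE : forall A : set (borel Y), measurable A ->
  mu' A = (mu \x nu)%E (p @^-1` A).
Hypothesis HE : core_form_on mu E.

Definition step_form : bform R Y :=
  BForm [set f | Cc f /\ tensor (fdom E) f] (fibre_form nu E).

Let DE : set (X -> R) := fdom E.
Let fsE : function_space DE := cf_fs HE.
Let pfE : posform DE E := cf_pf HE.
Let pfL : posform DE (L2dot mu) := posform_sub (cf_L2 HE) (L2_posform mu).

Let mp : @measurable_fun _ _ (borel X * borel G)%type (borel Y) setT p.
Proof.
have [bX hX] := cf_base HE; have [bG hG'] := baseG.
exact: (glue_pi_measurable hX hG' cG cB).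
Qed.

Lemma exhaustion_sigma_finite : open_exhaustion mu -> sigma_finite setT mu.
Proof.
move=> [W [oW fW WT]]; exists W; first by rewrite WT.
by move=> n; split; [exact: open_measurable|exact: fW].
Qed.

Let sfmu : sigma_finite setT mu := exhaustion_sigma_finite (cf_exh HE).

Lemma mu_phi (A : set (borel X)) : measurable A -> mu' (phi @^-1` A) = mu A.
Proof.
move=> mA; rewrite muE; last first.
  rewrite -[X in measurable X]setTI.
  exact: (continuous_borelY (@glue_phi_cont X G B)).
rewrite glue_phi_preimage; transitivity (mu A * nu setT)%E.
  exact: (product_measure1E (sf_copy sfmu) nu mA measurableT).
by rewrite probability_setT mule1.
Qed.

Lemma step_exhaustion : open_exhaustion mu'.
Proof.
have [W [oW fW WT]] := cf_exh HE.
exists (fun n => phi @^-1` W n); split.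
- by move=> n; move/continuousP : (@glue_phi_cont X G B); apply.
- by move=> n; rewrite mu_phi//; exact: open_measurable.
- by rewrite -preimage_bigcup WT preimage_setT.
Qed.

Lemma step_space : function_space (fdom step_form).
Proof.
split; first by split; [exact: fs_0 Cc_space|exact: fs_0 (tensor_space B fsE)].
move=> c f g [cf tf] [cg tg]; split; first exact: (fs_lin Cc_space).
exact: (fs_lin (tensor_space B fsE)).
Qed.

Lemma step_posform : posform (fdom step_form) step_form.
Proof.
apply: (@posform_sub _ _ _ (tensor DE) (fibre_form nu E)); first by move=> f [].
exact: fibre_posform.
Qed.

(** By Fubini the L^2 product of tensors is the fibre form of L2dot, so that the results
    on fibre forms apply to the form and to the L^2 product alike. *)
Lemma tensor_prod (f w : Y -> R) : tensor DE f -> tensor DE w ->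
  (mu \x nu)%E.-integrable setT
    (EFin \o (fun z : borel X * borel G => f (p z) * w (p z))) /\
  \int[(mu \x nu)%E]_z (f (p z) * w (p z)) = fibre_form nu (L2dot mu) f w.
Proof.
move=> tf tw; have [n [fk [hk [Df ch e]]]] := tf; have [m [wl [ll [Dw cl e']]]] := tw.
pose t k l (z : borel X * borel G) : R := (fk k z.1 * wl l z.1) * (hk k z.2 * ll l z.2).
have tP k l : (mu \x nu)%E.-integrable setT (EFin \o t k l) /\
    \int[(mu \x nu)%E]_z t k l z = L2dot mu (fk k) (wl l) * \int[nu]_g (hk k g * ll l g).
  apply: (prod_integral_sf sfmu).
    exact: (L2_mul (cf_L2 HE (Df k)) (cf_L2 HE (Dw l))).
  by apply: nu_int => //; exact: (contM (ch k) (cl l)).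
have tE z : f (p z) * w (p z) = \sum_(l < m) \sum_(k < n) t k l z.
  case: z => x g; rewrite e e' mulr_sumr; apply: eq_bigr => l _.
  by rewrite mulr_suml; apply: eq_bigr => k _; rewrite /t /=; ring.
have tsum l := Rintegral_sum (fun k => (tP k l).1).
have [i1 i2] := Rintegral_sum (fun l => (tsum l).1).
have -> : (fun z => f (p z) * w (p z)) = (fun z => \sum_(l < m) \sum_(k < n) t k l z).
  by apply/funext.
split=> //; rewrite i2.
have rw : tensor_rep DE w wl ll by split.
rewrite (fibre_pair nu cG fsE pfL tf rw).
apply: eq_bigr => l _; rewrite (tsum l).2 (fmean_pair nu cG fsE pfL)//.
under eq_bigr do rewrite (tP _ _).2.
transitivity (\int[nu]_g (\sum_(k < n) L2dot mu (fk k) (wl l) * (hk k g * ll l g))).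
  rewrite (@nu_sum _ _ nu cG n (fun k g => L2dot mu (fk k) (wl l) * (hk k g * ll l g))).
    apply: eq_bigr => k _; rewrite RintegralZl//; apply: nu_int => //; exact: (contM (ch k) (cl l)).
  by move=> k; apply: contM; [exact: cst_continuous|exact: (contM (ch k) (cl l))].
apply: eq_Rintegral => g _.
have r : tensor_rep DE f fk hk by split.
by rewrite (fsec_comb fsE pfL g r (Dw l)) mulr_sumr; apply: eq_bigr => k _; ring.
Qed.

Lemma step_L2 : fdom step_form `<=` L2 mu'.
Proof.
move=> f [cf tf]; have mf := continuous_borel cf.1.
apply/(L2_image mp muE mf)/L2P; split; first exact: (measurableT_comp mf mp).
have [+ _] := tensor_prod tf tf; by congr (_.-integrable _ _).
Qed.

Lemma step_L2dot f w : fdom step_form f -> fdom step_form w ->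
  L2dot mu' f w = fibre_form nu (L2dot mu) f w.
Proof.
move=> Df Dw; rewrite (L2dot_image mp muE (step_L2 Df) (step_L2 Dw)).
exact: (tensor_prod Df.2 Dw.2).2.
Qed.

(** Against a tensor w with factors wk and hk, the form of u n is a sum of forms of level
    i of the means of u n with weights hk; by [fmean_bound] these means satisfy the
    hypotheses of closability below. *)
Lemma step_clos (u : nat -> Y -> R) : (forall n, fdom step_form (u n)) ->
    (forall e, 0 < e -> exists N, forall m n, (N <= m)%N -> (N <= n)%N ->
       step_form (u m - u n) (u m - u n) < e) ->
    (forall e, 0 < e -> exists N, forall n, (N <= n)%N -> L2dot mu' (u n) (u n) < e) ->
    forall w, fdom step_form w -> rtends (fun n => step_form (u n) w) 0.
Proof.
move=> Du cu u0 w [cw [n [wk [hk r]]]]; have [Dw ch e] := r.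
rewrite (_ : (fun _ => _) = fun j => \sum_(k < n) E (fmean nu (hk k) (u j)) (wk k)); last first.
  by apply/funext => j; exact: (fibre_pair nu cG fsE pfE (Du j).2 r).
suff h k : rtends (fun j => E (fmean nu (hk k) (u j)) (wk k)) 0.
  by have := rtends_sum h; rewrite [X in rtends _ X]big1.
have [M M0 hM] := compact_fun_bounded cG (ch k).
have M2 : 0 < M ^+ 2 by rewrite exprn_gt0.
apply: (cf_clos HE) => //.
- by move=> j; exact: (fmean_tensor nu cG fsE (ch k) (Du j).2).
- move=> d d0; have [N hN] := cu (d / M ^+ 2) (divr_gt0 d0 M2).
  exists N => i j Ni Nj; have := hN i j Ni Nj; rewrite ltr_pdivlMr// => h.
  have Dij := fs_B step_space (Du i) (Du j).
  have -> : fmean nu (hk k) (u i) - fmean nu (hk k) (u j) = fmean nu (hk k) (u i - u j).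
    rewrite [in RHS]addrC -[- u j]scaleN1r (fmean_lin nu cG _ (ch k) (Du j).2 (Du i).2).
    by rewrite scaleN1r addrC.
  apply: le_lt_trans h; rewrite mulrC.
  exact: (fmean_bound nu cG fsE pfE (ch k) hM Dij.2).
- move=> d d0; have [N hN] := u0 (d / M ^+ 2) (divr_gt0 d0 M2).
  exists N => j Nj; have := hN j Nj; rewrite ltr_pdivlMr// => h.
  apply: le_lt_trans h; rewrite mulrC step_L2dot//.
  exact: (fmean_bound nu cG fsE pfL (ch k) hM (Du j).2).
Qed.

Lemma compact_locally_compact (Z : topologicalType) : compact [set: Z] ->
  locally_compact [set: Z].
Proof.
move=> cZ z _; exists setT; first exact: filterT.
by split=> //; exact: closedT.
Qed.

(** From a c - b d = (a - b) c + b (c - d), with 0 <= c <= 1 and b^2 = b. *)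
Lemma prod_ind_bound (f : X -> R) (h : G -> R) (V : set X) (W : set G) :
  DE f -> continuous h -> (forall g, 0 <= h g <= 1) ->
  open V -> open W -> (mu V < +oo)%E ->
  (mu \x nu)%E.-integrable setT (EFin \o (fun z : borel X * borel G =>
    (f z.1 * h z.2 - \1_V z.1 * \1_W z.2) * (f z.1 * h z.2 - \1_V z.1 * \1_W z.2))) ->
  \int[(mu \x nu)%E]_z
    ((f z.1 * h z.2 - \1_V z.1 * \1_W z.2) * (f z.1 * h z.2 - \1_V z.1 * \1_W z.2)) <=
  2 * L2dot mu (f - \1_V) (f - \1_V) +
  2 * fine (mu V) * L2dot nu (h - \1_W) (h - \1_W).
Proof.
move=> Df ch h01 oV oW fV ii.
have mV := open_measurable oV; have mW := open_measurable oW.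
have LfV : L2 mu (f - \1_V) by apply: L2B; [exact: (cf_L2 HE Df)|exact: L2_indic].
have LhW : L2 nu (h - \1_W).
  apply: L2B; last by apply: L2_indic => //; rewrite (le_lt_trans (probability_le1 _ _))// ltry.
  apply/L2P; split; first exact: continuous_borel.
  by apply: nu_int => //; exact: (contM ch ch).
have i1 := prod_integral_sf sfmu (L2_mul LfV LfV) (nu_int nu cG (@cst_continuous _ _ (1 : R))).
have iV : mu.-integrable setT (EFin \o (\1_V : borel X -> R)).
  apply/integrableP; split; first exact/measurable_EFinP/measurable_indic.
  under eq_integral do rewrite gee0_abs ?lee_fin//.
  by rewrite integral_indic// setIT.
have i2 := prod_integral_sf sfmu iV (L2_mul LhW LhW).
have e1 : L2dot mu (f - \1_V) (f - \1_V) = \int[(mu \x nu)%E]_z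
    ((f - \1_V) z.1 * (f - \1_V) z.1 * 1).
  by rewrite i1.2 Rintegral_prob mulr1.
have e2 : fine (mu V) * L2dot nu (h - \1_W) (h - \1_W) =
    \int[(mu \x nu)%E]_z (\1_V z.1 * ((h - \1_W) z.2 * (h - \1_W) z.2)).
  by rewrite i2.2; congr (_ * _); rewrite /Rintegral integral_indic// setIT.
rewrite -mulrA e2 e1 -mulrDr -RintegralD//; [|exact: i1.1|exact: i2.1].
have i12 := integrableD measurableT i1.1 i2.1.
rewrite -RintegralZl//.
apply: le_Rintegral => //.
  exact: (integrableZl measurableT 2 i12).
move=> [x g] _ /=; have /andP[h0 h1] := h01 g.
have -> : (f - \1_V) x = f x - \1_V x by [].
have -> : (h - \1_W) g = h g - \1_W g by [].
have : (\1_V x : R) * \1_V x = \1_V x by rewrite indicE; case: (x \in V); rewrite ?mulr1 ?mulr0.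
set a := f x; set b := \1_V x; set c := h g in h0 h1 *; set d := \1_W g => bb.
have -> : a * c - b * d = (a - b) * c + b * (c - d) by ring.
have h2 : 0 <= ((a - b) * c - b * (c - d)) ^+ 2 by exact: sqr_ge0.
have h3 : (a - b) ^+ 2 * c ^+ 2 <= (a - b) ^+ 2 * 1.
  by rewrite ler_wpM2l ?sqr_ge0// expr_le1.
have h4 : b * b * ((c - d) * (c - d)) = b * ((c - d) * (c - d)) by rewrite bb.
rewrite -h4; move: h2 h3; lra.
Qed.

(** The product of a function f of the core, supported in V, and of a function h of the
    fibre vanishes over B, so it defines a function on the glued space. *)
Lemma step_rect (V : set X) (W : set G) (e : R) : open V -> open W -> V `&` B = set0 ->
  (mu V < +oo)%E -> 0 < e -> exists f, [/\ fdom step_form f,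
    forall z, ~ (p @` (V `*` W)) z -> f z = 0 &
    L2dot mu' (f - \1_(p @` (V `*` W))) (f - \1_(p @` (V `*` W))) < e].
Proof.
move=> oV oW VB fV e0; set P := p @` (V `*` W).
have fW : (nu W < +oo)%E by rewrite (le_lt_trans (probability_le1 _ (open_measurable oW)))// ltry.
have v0 : 0 <= fine (mu V) by exact: fine_ge0.
have v1 : 0 < fine (mu V) + 1 by rewrite ltr_wpDl.
have d0 : 0 < e / 4 / (fine (mu V) + 1) by rewrite !divr_gt0.
have [f [Df fV0 fe]] := cf_ind HE oV fV (divr_gt0 e0 (ltr0n R 4)).
have [K [cK KW mK Ke]] := inner_regular hG nu_radon oW fW d0.
have [h [[ch _] h01 hK hW]] := @urysohn_compact R G K W (compact_locally_compact cG) hG cK oW KW.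
have he : L2dot nu (h - \1_W) (h - \1_W) < e / 4 / (fine (mu V) + 1).
  apply: (le_lt_trans (ind_approx oW mK fW KW (continuous_borel ch) h01 hK hW)).
  by rewrite -lte_fin fineK// ge0_fin_numE// (lt_trans Ke)// ltry.
pose F : Y -> R := glue_lift (fun x g => f x * h g).
have FE x g : F (p (x, g)) = f x * h g.
  rewrite /F glue_liftE// => Bx; rewrite fV0 ?mul0r// => Vx.
  by have : (V `&` B) x by []; rewrite VB.
have tF : tensor DE F.
  exists 1%N, (fun=> f), (fun=> h); split=> // x g.
  by rewrite FE big_ord_recl big_ord0 addr0.
have cF : continuous F.
  apply: glue_cont; rewrite (_ : _ \o _ = fun z => f z.1 * h z.2); last first.
    by apply/funext => -[x g]; exact: FE.
  move=> z; apply: cvgM.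
    by apply: continuous_comp; [exact: cvg_fst|exact: (cf_Cc HE Df).1].
  by apply: continuous_comp; [exact: cvg_snd|exact: ch].
have DF : fdom step_form F.
  split=> //; apply: (Cc_dominated cG (cf_Cc HE Df) cF) => z.
  by have [x [g <-]] := glue_pi_surj z; rewrite glue_phiK FE => ->; rewrite mul0r.
have oP : open P.
  by apply/glue_open; rewrite glue_pi_image//; exact: open_setX.
have PE x g : (\1_P (p (x, g)) : R) = \1_V x * \1_W g.
  have PI : P (p (x, g)) <-> V x /\ W g.
    by rewrite -[P _]/((p @^-1` P) (x, g)) glue_pi_image.
  rewrite !indicE; have [Vx|nVx] := pselect (V x); last first.
    by rewrite (memNset nVx) mul0r memNset// => /PI[].
  have [Wg|nWg] := pselect (W g); last by rewrite (memNset nWg) mulr0 memNset// => /PI[].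
  by rewrite (mem_set Vx) (mem_set Wg) mulr1 mem_set//; exact/PI.
have mP := open_measurable oP.
have fP : (mu' P < +oo)%E.
  rewrite muE// glue_pi_image//.
  have -> : (mu \x nu)%E (V `*` W) = (mu V * nu W)%E.
    exact: (product_measure1E (sf_copy sfmu) nu (open_measurable oV) (open_measurable oW)).
  by rewrite lte_mul_pinfty// ge0_fin_numE.
exists F; split=> //.
  move=> z; have [x [g <-]] := glue_pi_surj z => nP; rewrite FE.
  have [Vx|Vx] := pselect (V x); last by rewrite fV0// mul0r.
  by rewrite hW ?mulr0// => Wg; apply: nP; exists (x, g).
have LFP : L2 mu' (F - \1_P) by apply: L2B; [exact: step_L2|exact: L2_indic].
rewrite (L2dot_image mp muE LFP LFP).
have eqn : (F - \1_P) \o p = fun z => f z.1 * h z.2 - \1_V z.1 * \1_W z.2.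
  by apply/funext => -[x g] /=; rewrite -FE -PE.
rewrite eqn.
have LFp := (L2_image mp muE (L2_measurable LFP)).1 LFP.
have {}LFp := L2_mul LFp LFp.
rewrite eqn in LFp.
apply: (le_lt_trans (prod_ind_bound Df ch h01 oV oW fV LFp)).
move: he fe; set x := L2dot nu _ _; set y := L2dot mu _ _.
rewrite ltr_pdivlMr// => hx hy.
have x0 : 0 <= x by exact: L2dot_ge0.
by move: v0 v1 hx; set m := fine (mu V); nra.
Qed.

Lemma step_lift (f : X -> R) : DE f -> fdom step_form (f \o phi).
Proof.
move=> Df; have cf : continuous (f \o phi).
  by move=> z; apply: continuous_comp; [exact: glue_phi_cont|exact: (cf_Cc HE Df).1].
split; first by apply: (Cc_dominated cG (cf_Cc HE Df) cf).
exists 1%N, (fun=> f), (fun=> fun=> 1); split=> // [_|x g]; first exact: cst_continuous.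
by rewrite /= glue_phiK big_ord_recl big_ord0 addr0 mulr1.
Qed.

Lemma step_basic (P : set Y) (e : R) : basic P -> (mu' P < +oo)%E -> 0 < e ->
  exists f, [/\ fdom step_form f, forall z, ~ P z -> f z = 0 &
    L2dot mu' (f - \1_P) (f - \1_P) < e].
Proof.
move=> bP fP e0; have mP := open_measurable (basic_open bP).
case: bP fP mP => [[V oV ->]|[V [W [oV oW VB ->]]]] fP mP.
  have fV : (mu V < +oo)%E by rewrite -mu_phi//; exact: open_measurable.
  have [f [Df f0 fe]] := cf_ind HE oV fV e0.
  exists (f \o phi); split; first exact: step_lift.
    by move=> z nz; exact: f0.
  apply: le_lt_trans fe; rewrite le_eqVlt; apply/orP; left; apply/eqP.
  have Lf : L2 mu (f - \1_V).
    by apply: L2B; [exact: (cf_L2 HE Df)|apply: L2_indic => //; exact: open_measurable].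
  apply/esym.
  have mphi := continuous_borelY (@glue_phi_cont X G B).
  exact: (L2dot_image mphi (fun A mA => esym (mu_phi mA)) Lf Lf).
(* a box of finite measure over a set of infinite measure is null *)
have [fV|] := ltP (mu V) +oo%E; first exact: step_rect.
rewrite leye_eq => /eqP V_oo; exists 0; split=> //; first exact: fs_0 step_space.
have mV := open_measurable oV; have mW := open_measurable oW.
have PE : mu' (p @` (V `*` W)) = (mu V * nu W)%E.
  rewrite muE// glue_pi_image//.
  exact: (product_measure1E (sf_copy sfmu) nu mV mW).
have P0 : mu' (p @` (V `*` W)) = 0%E.
  rewrite PE; move: fP; rewrite PE V_oo.
  have : (0 <= nu W)%E by [].
  rewrite le_eqVlt => /predU1P[<- _|W0]; first by rewrite mule0.
  by rewrite gt0_mulye// ltxx.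
suff -> : L2dot mu' (0 - \1_(p @` (V `*` W))) (0 - \1_(p @` (V `*` W))) = 0 by [].
have i0 : L2 mu' (\1_(p @` (V `*` W))) by exact: L2_indic.
apply/(L2dot_eq0 (L2B (L20 _) i0)).
exists (p @` (V `*` W)); split=> // z /= nz; apply: contrapT => nPz; apply: nz => _.
have -> : (0 - \1_(p @` (V `*` W))) z = 0 - (\1_(p @` (V `*` W)) z : R) by [].
by rewrite indicE memNset// subrr.
Qed.

(** An open set is a countable union of basic ones, and [ind_bigcup] is applied to the
    subspace of core functions that vanish outside U. *)
Lemma step_ind (U : set Y) : open U -> (mu' U < +oo)%E -> forall e, 0 < e ->
  exists f, [/\ fdom step_form f, forall z, ~ U z -> f z = 0 &
    L2dot mu' (f - \1_U) (f - \1_U) < e].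
Proof.
move=> oU fU e e0; have mU := open_measurable oU.
pose DU (v : L2ph mu') := exists f, [/\ fdom step_form f, forall z, ~ U z -> f z = 0 & L2fun v = f].
have DU0 : DU 0 by exists 0; split=> //; exact: fs_0 step_space.
have DUP a x y : DU x -> DU y -> DU (a *: x + y).
  move=> [f [Df f0 xf]] [g [Dg g0 yg]]; exists (a *: f + g); split.
  - exact: (fs_lin step_space).
  - move=> z nz; have -> : (a *: f + g) z = a * f z + g z by [].
    by rewrite f0// g0// mulr0 addr0.
  - by rewrite L2fun_lin xf yg.
pose D := LinSet DU0 DUP.
have approx (f : Y -> R) (Lf : L2 mu' f) (A : set Y) (mA : measurable (A : set (borel Y)))
    (fA : (mu' A < +oo)%E) d : 0 < d ->
    L2dot mu' (f - \1_A) (f - \1_A) < d ^+ 2 -> nrm (indL2 mA fA - toL2 Lf) < d.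
  by move=> d0 h; rewrite nrmB nrm_lt_sq ?(ltW d0).
have [bX hX] := cf_base HE; have [bG hG'] := baseG.
have [F [bF UF]] := open_basic hX hG' cG cB oU.
have se : 0 < Num.sqrt e by rewrite sqrtr_gt0.
have [||P mP fP [bP PU] d d0||g [f [Df f0 gf]] vg] := @ind_bigcup _ _ mu' D
    [set P | basic P /\ P `<=` U] F U mU fU _ _ _ _ UF _ se.
- by move=> P Q [bP PU] [bQ _]; split; [exact: basicI|move=> z [/PU]].
- by move=> P [/basic_open oP _]; exact: open_measurable.
- have d2 : 0 < d ^+ 2 by rewrite exprn_gt0.
  have [f [Df f0 fd]] := step_basic bP fP d2.
  exists (toL2 (step_L2 Df)); last exact: approx.
  by exists f; split=> // z nUz; apply: f0 => /PU.
- by move=> n; split=> //; rewrite UF; exact: bigcup_sup.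
exists f; split=> //.
move: vg; rewrite nrmB nrm_lt_sq ?(ltW se)// sqr_sqrtr ?(ltW e0)//.
by apply: le_lt_trans; rewrite -gf le_eqVlt; apply/orP; left.
Qed.

Theorem step_core : core_form_on mu' step_form.
Proof.
split.
- have [bX hX] := cf_base HE; have [bG hG'] := baseG.
  by exists (@glue_base X G B bX bG); exact: glue_baseP.
- exact: step_exhaustion.
- exact: step_space.
- exact: step_posform.
- by move=> f [].
- exact: step_L2.
- exact: step_clos.
- exact: step_ind.
Qed.

End step.

(** * The initial form *)

Section form_prehilbert.
Context {R : realType} {T : Type} (D : set (T -> R)) (F : (T -> R) -> (T -> R) -> R).
Hypotheses (DD : function_space D) (FF : posform D F).

Definition fs_linset : linset (T -> R) := LinSet (fs_0 DD) (fs_lin DD).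

Lemma form_phP a (x y z : sublmod fs_linset) :
  F (\val (a *: x + y)) (\val z) = a * F (\val x) (\val z) + F (\val y) (\val z).
Proof.
by rewrite linearP; exact: (pf_lin FF a (sublmod_in x) (sublmod_in y) (sublmod_in z)).
Qed.

Definition form_ph : prehilbert R :=
  @PreHilbert R (sublmod fs_linset) (fun x y => F (\val x) (\val y))
    (fun x y => pf_sym FF (sublmod_in x) (sublmod_in y)) form_phP
    (fun x => pf_ge0 FF (sublmod_in x)).

Definition infs f (Df : D f) : form_ph := @insl R _ fs_linset f Df.

Lemma pf_cauchy_schwarz f g : D f -> D g -> `|F f g| <= Num.sqrt (F f f) * Num.sqrt (F g g).
Proof. by move=> Df Dg; exact: (dot_norm_le (infs Df) (infs Dg)). Qed.

End form_prehilbert.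

(** The Markov property truncates at 0 and 1 only; this combination of two truncations of
    multiples of t also flattens t near 0 and near 1. *)
Lemma truncation (R : realFieldType) (t : R) :
  let f := 2 * (3 / 4 * Num.min (Num.max (4 / 3 * t) 0) 1 -
                1 / 4 * Num.min (Num.max (4 * t) 0) 1) in
  [/\ 0 <= f <= 1, t <= 1 / 4 -> f = 0 & 3 / 4 <= t -> f = 1].
Proof.
move=> f; rewrite /f.
have [a|a] := leP (4 / 3 * t) 0; have [b|b] := leP (4 * t) 0; try by lra.
  by rewrite !min_l ?ler01//; split; [apply/andP; split|..]; lra.
have [c|c] := leP (4 / 3 * t) 1; have [d|d] := leP (4 * t) 1;
  split; try (apply/andP; split); lra.
Qed.

Section level0.
Context {R : realType} {X : ptopologicalType}.
Variables (mu : {measure set (borel X) -> \bar R}) (E : bform R X).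
Hypotheses (lcX : locally_compact [set: X]) (scX : @second_countable X).
Hypotheses (hX : hausdorff_space X) (mu_radon : radon mu).
Hypothesis regE : regular_dirichlet_form mu E.

Let dirE : dirichlet_form mu E. Proof. by case: regE. Qed.

Lemma dirichlet_L2 : fdom E `<=` L2 mu. Proof. by case: dirE => -[]. Qed.

Lemma dirichlet_space : function_space (fdom E).
Proof.
case: dirE => -[_ _ lin dens] _ _ _.
have linE (c : R) f g : fdom E f -> fdom E g -> fdom E (c *: f + g).
  exact: lin.
split=> //; have [_ h] := dens 0 (L20 mu).
have [g Dg _] := h 1 ltr01.
by rewrite -[0](addNr g) -scaleN1r; exact: linE.
Qed.

Lemma dirichlet_posform : posform (fdom E) E.
Proof.
by case: dirE => _ [bil sym ge0] _ _; split.
Qed.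

Lemma dirichlet_markov (a : R) f : 0 < a -> fdom E f ->
  fdom E (fun x => Num.min (Num.max (a * f x) 0) 1).
Proof.
case: dirE => _ _ _ mark a0 Df.
by have [] := mark _ (fs_Z dirichlet_space a Df).
Qed.

Definition core0 : bform R X := BForm (fdom E `&` @Cc R X) E.

Let Dsub : fdom core0 `<=` fdom E. Proof. by move=> f []. Qed.

Lemma core0_exhaustion : open_exhaustion mu.
Proof.
have [b [ob hb]] := second_countable_base scX.
exists (fun n => if `[< (mu (b n) < +oo)%E >] then b n else set0); split.
- by move=> n; case: asboolP => _; [exact: ob|exact: open0].
- by move=> n; case: asboolP => // _; rewrite measure0 ltry.
- apply/seteqP; split=> // x _; have [C xC [cC clC]] := @lcX x I.
  have xC' : \forall y \near x, [set: X] y -> C y by exact: xC.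
  have nC : nbhs x C by apply: filterS xC' => y; exact.
  have [n [bx bC]] := hb x C^° ltac:(exact: open_interior) (nbhs_singleton (nbhs_interior nC)).
  exists n => //; case: asboolP => // -[].
  case: mu_radon => fin _ _; apply: le_lt_trans (fin C cC).
  apply: le_measure; rewrite ?inE; [exact: open_measurable|exact: closed_measurable|].
  by move=> y /bC/interior_subset.
Qed.

(** The limit provided by the completeness of E vanishes almost everywhere, hence
    pairs to 0 with the domain. *)
Lemma core0_clos (u : nat -> X -> R) : (forall n, fdom core0 (u n)) ->
    (forall e, 0 < e -> exists N, forall m n, (N <= m)%N -> (N <= n)%N ->
       core0 (u m - u n) (u m - u n) < e) ->
    (forall e, 0 < e -> exists N, forall n, (N <= n)%N -> L2dot mu (u n) (u n) < e) ->
    forall w, fdom core0 w -> rtends (fun n => core0 (u n) w) 0.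
Proof.
move=> Du cu u0 w [Dw _].
have DE n : fdom E (u n) := (Du n).1.
have Lu n : L2 mu (u n) := dirichlet_L2 (DE n).
have small (g h : X -> R) e : L2 mu g -> L2 mu h -> 0 < e ->
    L2dot mu g g < e ^+ 2 -> L2dot mu h h < e ^+ 2 -> L2dot mu (g - h) (g - h) < (2 * e) ^+ 2.
  move=> Lg Lh e0 ge he.
  have gn : nrm (toL2 Lg) < e by rewrite nrm_lt_sq// ltW.
  have hn : nrm (toL2 Lh) < e by rewrite nrm_lt_sq// ltW.
  have := le_lt_trans (nrmD (toL2 Lg) (- toL2 Lh)) (ltrD gn (_ : nrm (- toL2 Lh) < e)).
  rewrite nrmN => /(_ hn); rewrite nrm_lt_sq ?addr_ge0 ?(ltW e0)//.
  by rewrite (_ : e + e = 2 * e) //; ring.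
have L0 e : 0 < e -> exists N, forall m n, (N <= m)%N -> (N <= n)%N ->
    L2dot mu (u m - u n) (u m - u n) < e.
  move=> e0; pose d := Num.sqrt e / 2.
  have d0 : 0 < d by rewrite divr_gt0// sqrtr_gt0.
  have [N hN] := u0 (d ^+ 2) ltac:(by rewrite exprn_gt0).
  exists N => m n Nm Nn; have := small _ _ d (Lu m) (Lu n) d0 (hN m Nm) (hN n Nn).
  by rewrite /d mulrC divfK ?pnatr_eq0// sqr_sqrtr// ltW.
case: dirE => -[_ aeE _ _] [_ _ _] compl _.
have [|f Df uf] := compl u DE.
  move=> e e0; have e2 : 0 < e / 2 by rewrite divr_gt0.
  have [N hN] := cu _ e2; have [M hM] := L0 _ e2.
  exists (maxn N M) => m n; rewrite !geq_max => /andP[Nm Mm] /andP[Nn Mn].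
  rewrite /form1 [e]splitr; apply: ltrD; [exact: hN|exact: hM].
have Lf := dirichlet_L2 Df.
have {}uf e : 0 < e -> exists N, forall n, (N <= n)%N ->
    E (u n - f) (u n - f) < e /\ L2dot mu (u n - f) (u n - f) < e.
  move=> e0; have /cvgrPdist_lt /(_ e e0)[N _ hN] := uf; exists N => n Nn.
  have := hN n Nn; rewrite sub0r normrN.
  have a0 := pf_ge0 dirichlet_posform (fs_B dirichlet_space (DE n) Df).
  have b0 := L2dot_ge0 mu (u n - f).
  rewrite ger0_norm; last exact: addr_ge0.
  by move=> h; split; apply: le_lt_trans h; rewrite /form1 ?lerDl ?lerDr.
have f0 : f = 0 %[ae mu].
  apply/(L2dot_eq0 Lf)/eqP; rewrite eq_le L2dot_ge0 andbT.
  apply/ler_addgt0Pl => e e0; rewrite addr0; pose d := Num.sqrt e / 2.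
  have d0 : 0 < d by rewrite divr_gt0// sqrtr_gt0.
  have d2 : 0 < d ^+ 2 by rewrite exprn_gt0.
  have [N hN] := u0 _ d2; have [M hM] := uf _ d2.
  have h1 := hN (maxn N M) (leq_maxl _ _); have [_ h2] := hM (maxn N M) (leq_maxr _ _).
  have := small _ _ d (Lu _) (L2B (Lu _) Lf) d0 h1 h2.
  rewrite opprB addrC subrK /d mulrC divfK ?pnatr_eq0// sqr_sqrtr ?(ltW e0)//.
  exact: ltW.
have Ef : E f w = 0.
  have [_ ->] := aeE f 0 Df (L20 mu) f0; last exact: Dw.
  exact: (pf_0l dirichlet_space dirichlet_posform).
move=> e e0; pose s := Num.sqrt (E w w) + 1.
have s0 : 0 < s by rewrite ltr_wpDl// sqrtr_ge0.
have [N hN] := uf ((e / s) ^+ 2) ltac:(by rewrite exprn_gt0// divr_gt0).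
exists N => n /hN[h _]; rewrite subr0.
have Duf := fs_B dirichlet_space (DE n) Df.
have -> : core0 (u n) w = E (u n - f) w.
  rewrite -[in LHS](subrK f (u n)) [LHS](pf_D dirichlet_posform Duf Df Dw) Ef.
  by rewrite addr0.
apply: (le_lt_trans (pf_cauchy_schwarz dirichlet_space dirichlet_posform Duf Dw)).
have : Num.sqrt (E (u n - f) (u n - f)) < e / s.
  by rewrite -[ltRHS]ger0_norm ?divr_ge0 ?ltW// -sqrtr_sqr ltr_sqrt// exprn_gt0// divr_gt0.
rewrite ltr_pdivlMr//; apply: le_lt_trans.
by rewrite ler_wpM2l ?sqrtr_ge0// lerDl.
Qed.

(** Take a Urysohn function of a compact set K with U minus K of small measure. Regularity
    gives a function of the core within 1/4 of it, and [truncation] makes this function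
    equal to 1 on K and to 0 outside U without leaving the domain. *)
Lemma core0_ind (U : set X) : open U -> (mu U < +oo)%E -> forall e, 0 < e ->
  exists f, [/\ fdom core0 f, forall x, ~ U x -> f x = 0 &
    L2dot mu (f - \1_U) (f - \1_U) < e].
Proof.
move=> oU fU e e0.
have [K [cK KU mK Ke]] := inner_regular hX mu_radon oU fU e0.
have [h [Ch h01 hK hU]] := @urysohn_compact R X K U lcX hX cK oU KU.
case: regE => _ _ /(_ h Ch (1 / 4))[|g [Dg Cg] hg]; first by rewrite divr_gt0.
pose tr (a : R) x := Num.min (Num.max (a * g x) 0) 1.
pose f : X -> R := 2 *: ((3 / 4) *: tr (4 / 3) - (1 / 4) *: tr 4).
have fE x : f x = 2 * (3 / 4 * Num.min (Num.max (4 / 3 * g x) 0) 1 -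
                1 / 4 * Num.min (Num.max (4 * g x) 0) 1) by [].
have Df : fdom E f.
  have s := dirichlet_space.
  apply: (fs_Z s); apply: (fs_B s); apply: (fs_Z s); apply: dirichlet_markov => //.
have ctr a : continuous (tr a).
  move=> x; apply: (@continuous_min R X (fun x => Num.max (a * g x) 0) (fun=> 1)).
    apply: (@continuous_max R X (fun x => a * g x) (fun=> 0)).
      by apply: cvgM; [exact: cvg_cst|exact: Cg.1].
    exact: cst_continuous.
  exact: cst_continuous.
have cf : continuous f.
  move=> x; apply: cvgM; first exact: cvg_cst.
  by apply: cvgB; (apply: cvgM; [exact: cvg_cst|exact: ctr]).
have f0 x : g x = 0 -> f x = 0.
  move=> gx; have [_ z _] := truncation (g x); rewrite fE; apply: z.
  by rewrite gx divr_ge0.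
exists f; split.
- by split=> //; exact: (Cc_sub cf Cg).
- move=> x nUx; have [_ z _] := truncation (g x); rewrite fE; apply: z.
  have := hg x; rewrite hU// sub0r normrN => /(le_lt_trans (ler_norm _)); exact: ltW.
- apply: (@le_lt_trans _ _ (fine (mu (U `\` K)))); last first.
    by rewrite -lte_fin fineK// ge0_fin_numE// (lt_trans Ke)// ltry.
  apply: ind_approx => //.
  + exact: continuous_borel.
  + by move=> x; rewrite fE; have [] := truncation (g x).
  + move=> x Kx; have [_ _ o] := truncation (g x); rewrite fE; apply: o.
    have := hg x; rewrite hK// => /(le_lt_trans (ler_norm _)); lra.
  + move=> x nUx; have [_ z _] := truncation (g x); rewrite fE; apply: z.
    have := hg x; rewrite hU// sub0r normrN => /(le_lt_trans (ler_norm _)); exact: ltW.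
Qed.

Theorem core0_core : core_form_on mu core0.
Proof.
split.
- exact: second_countable_base.
- exact: core0_exhaustion.
- split; first by split; [exact: fs_0 dirichlet_space|exact: fs_0 Cc_space].
  move=> c f g [Df Cf] [Dg Cg]; split; first exact: (fs_lin dirichlet_space).
  exact: (fs_lin Cc_space).
- exact: posform_sub Dsub dirichlet_posform.
- by move=> f [].
- by move=> f [Df _]; exact: dirichlet_L2.
- exact: core0_clos.
- exact: core0_ind.
Qed.

End level0.

(** * Closures of forms and their generators *)

Lemma rtends_cvg (R : realType) (a : nat -> R) (l : R) : rtends a l <-> a @ \oo --> l.
Proof.
split=> [h|/cvgrPdist_lt h].
  apply/cvgrPdist_lt => e /h[N hN]; exists N => // n Nn /=; rewrite distrC; exact: hN.
by move=> e /h[N _ hN]; exists N => n Nn; rewrite distrC; exact: hN.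
Qed.

Lemma rtends_cauchy (R : realType) (a : nat -> R) :
  (forall e, 0 < e -> exists N, forall m n, (N <= m)%N -> (N <= n)%N -> `|a m - a n| < e) ->
  exists l, rtends a l.
Proof.
move=> ca; suff : cvgn a by move=> /rtends_cvg h; exists (limn a).
apply/cauchy_cvgP/cauchy_exP => e e0; have [N hN] := ca e e0.
exists (a N); exists N => // n Nn /=; exact: hN.
Qed.

Lemma rtendsB (R : realType) (a b : nat -> R) (l l' : R) : rtends a l -> rtends b l' ->
  rtends (fun n => a n - b n) (l - l').
Proof.
move=> al bl; have := rtendsD al (rtendsZ (-1) bl).
by rewrite mulN1r; under eq_fun do rewrite mulN1r.
Qed.

Lemma cauchy_dot (R : realType) (K : prehilbert R) (u v : nat -> K) :
  cauchy u -> cauchy v -> exists l, rtends (fun n => dot (u n) (v n)) l.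
Proof.
move=> cu cv; apply: rtends_cauchy => e e0.
have [M M0 [N1 hM]] := cauchy_bounded cu; have [M' M'0 [N2 hM']] := cauchy_bounded cv.
have [N3 h3] := cu (e / 2 / M') ltac:(by rewrite !divr_gt0).
have [N4 h4] := cv (e / 2 / M) ltac:(by rewrite !divr_gt0).
exists (maxn (maxn N1 N2) (maxn N3 N4)) => m n; rewrite !geq_max.
move=> /andP[/andP[m1 m2] /andP[m3 m4]] /andP[/andP[n1 n2] /andP[n3 n4]].
have -> : dot (u m) (v m) - dot (u n) (v n) =
    dot (u m) (v m - v n) + dot (u m - u n) (v n) by rewrite !dotE; ring.
apply: (le_lt_trans (ler_normD _ _)); rewrite [e]splitr; apply: ltrD.
  apply: (le_lt_trans (dot_norm_le _ _)).
  have h := h4 m n m4 n4; rewrite ltr_pdivlMr// mulrC in h.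
  by apply: le_lt_trans h; rewrite ler_wpM2r ?nrm_ge0// hM.
apply: (le_lt_trans (dot_norm_le _ _)).
have h := h3 m n m3 n3; rewrite ltr_pdivlMr// in h.
by apply: le_lt_trans h; rewrite ler_wpM2l ?nrm_ge0// hM'.
Qed.

Lemma cauchyB (R : realType) (K : prehilbert R) (u v : nat -> K) :
  cauchy u -> cauchy v -> cauchy (fun n => u n - v n).
Proof.
move=> cu cv e e0; have e2 : 0 < e / 2 by rewrite divr_gt0.
have [N hN] := cu _ e2; have [M hM] := cv _ e2.
exists (maxn N M) => m n; rewrite !geq_max => /andP[m1 m2] /andP[n1 n2].
rewrite subr_swap; apply: (le_lt_trans (nrmD _ _)); rewrite nrmN [e]splitr.
by apply: ltrD; [exact: hN|exact: hM].
Qed.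

Lemma tendsB (R : realType) (K : prehilbert R) (u v : nat -> K) x y :
  tends u x -> tends v y -> tends (fun n => u n - v n) (x - y).
Proof.
move=> cu cv e e0; have e2 : 0 < e / 2 by rewrite divr_gt0.
have [N hN] := cu _ e2; have [M hM] := cv _ e2.
exists (maxn N M) => n; rewrite !geq_max => /andP[m1 m2].
rewrite subr_swap; apply: (le_lt_trans (nrmD _ _)); rewrite nrmN [e]splitr.
by apply: ltrD; [exact: hN|exact: hM].
Qed.

Lemma tends_cst (R : realType) (K : prehilbert R) (x : K) : tends (fun=> x) x.
Proof. by move=> e e0; exists 0%N => n _; rewrite subrr nrm0. Qed.

Section closure.
Context {R : realType} {K V : prehilbert R} (j : K -> V).
Hypothesis jP : forall a x y, j (a *: x + y) = a *: j x + j y.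
Hypothesis closj : closable_form j.

(** Replacing u by u' changes the products by those of u - u', whose image tends to 0,
    with a Cauchy sequence; closability makes them tend to 0. *)
Lemma closable_pair (u u' v v' : nat -> K) x y l l' :
  cauchy u -> cauchy u' -> cauchy v -> cauchy v' ->
  tends (j \o u) x -> tends (j \o u') x -> tends (j \o v) y -> tends (j \o v') y ->
  rtends (fun n => dot (u n) (v n)) l -> rtends (fun n => dot (u' n) (v' n)) l' -> l = l'.
Proof.
have key (a b c : nat -> K) p q : cauchy a -> cauchy b -> cauchy c ->
    tends (j \o a) p -> tends (j \o b) p -> tends (j \o c) q ->
    rtends (fun n => dot (a n - b n) (c n)) 0.
  move=> ca cb cc ap bp cq; have cab := cauchyB ca cb.
  have j0 : tends (j \o (fun n => a n - b n)) 0.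
    rewrite -(subrr p) (_ : _ \o _ = fun n => j (a n) - j (b n)); first exact: tendsB.
    by apply/funext => n /=; rewrite (jB jP).
  have := form_gen_pair (k := 0) cab _ cc cq; rewrite dot0l; apply=> w.
  by rewrite dot0l; exact: closj.
move=> cu cu' cv cv' ux ux' vy vy' ul ul'.
have h1 := key _ _ _ _ _ cu cu' cv ux ux' vy.
have h2 := key _ _ _ _ _ cv cv' cu' vy vy' ux'.
have h3 := rtendsB (rtendsB ul h1) h2.
rewrite !subr0 in h3; apply: (rtends_unique h3).
rewrite (_ : (fun n => _) = fun n => dot (u' n) (v' n)) //.
by apply/funext => n; rewrite !dotE !(dotC (u' n)); ring.
Qed.

End closure.

Section core_space.
Context {R : realType} {X : ptopologicalType}.
Variables (mu : {measure set (borel X) -> \bar R}) (E : bform R X).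
Hypotheses (fsE : function_space (fdom E)) (pfE : posform (fdom E) E).
Hypothesis LE : fdom E `<=` L2 mu.

Definition core_ph : prehilbert R := form_ph fsE pfE.

Definition core_map (x : core_ph) : L2ph mu := toL2 (LE (sublmod_in x)).

Lemma core_mapP c x y : core_map (c *: x + y) = c *: core_map x + core_map y.
Proof. by apply/LfuneqP. Qed.

Lemma core_nrm (x : core_ph) : nrm x = Num.sqrt (E (\val x) (\val x)).
Proof. by []. Qed.

Lemma core_nrmB (x y : core_ph) : nrm (x - y) = Num.sqrt (E (\val x - \val y) (\val x - \val y)).
Proof. by rewrite core_nrm linearB. Qed.

Lemma sqrt_small (x : R) : 0 <= x -> forall e, 0 < e -> (Num.sqrt x < e) = (x < e ^+ 2).
Proof.
by move=> x0 e e0; rewrite -[X in _ < X]ger0_norm ?ltW// -sqrtr_sqr ltr_sqrt// exprn_gt0.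
Qed.

Lemma form_small (u : nat -> core_ph) :
  cauchy u <-> (forall e, 0 < e -> exists N, forall m n, (N <= m)%N -> (N <= n)%N ->
    E (\val (u m) - \val (u n)) (\val (u m) - \val (u n)) < e).
Proof.
have ge x y : 0 <= E (\val (x : core_ph) - \val (y : core_ph)) (\val x - \val y).
  by apply: (pf_ge0 pfE); apply: (fs_B fsE); exact: sublmod_in.
split=> [cu e e0|h e e0].
  have se : 0 < Num.sqrt e by rewrite sqrtr_gt0.
  have [N hN] := cu _ se; exists N => m n Nm Nn; have := hN m n Nm Nn.
  by rewrite core_nrmB sqrt_small// sqr_sqrtr// ltW.
have e2 : 0 < e ^+ 2 by rewrite exprn_gt0.
have [N hN] := h _ e2; exists N => m n Nm Nn.
by rewrite core_nrmB sqrt_small//; exact: hN.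
Qed.

Lemma form_approxP (u : nat -> core_ph) (f : L2ph mu) :
  form_approx mu E (fun n => \val (u n)) (L2fun f) <-> cauchy u /\ tends (core_map \o u) f.
Proof.
have nE n : L2norm mu (\val (u n) \- L2fun f) = nrm (core_map (u n) - f).
  by rewrite L2ph_nrm.
split=> [[_ /form_small cu /rtends_cvg uf]|[cu uf]].
  split=> // e /uf[N hN]; exists N => n /hN; rewrite nE subr0; exact: le_lt_trans (ler_norm _).
split; [by move=> n; exact: sublmod_in|exact/form_small|].
apply/rtends_cvg => e /uf[N hN]; exists N => n /hN.
by rewrite nE subr0 ger0_norm// nrm_ge0.
Qed.

Hypothesis closE : closable_form core_map.

Lemma form_closure_approx (h : L2ph mu) : fdom (form_closure mu E) (L2fun h) <->
  exists u : nat -> core_ph, cauchy u /\ tends (core_map \o u) h.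
Proof.
split=> [[_ [u uh]]|[u uh]].
  have Du n : fdom E (u n) by case: uh.
  by exists (fun n => infs fsE pfE (Du n)); apply/form_approxP.
by split; [exact: L2funP|exists (fun n => \val (u n)); exact/form_approxP].
Qed.

Lemma form_closure_val (h w : L2ph mu) (u v : nat -> core_ph) l :
  cauchy u -> tends (core_map \o u) h -> cauchy v -> tends (core_map \o v) w ->
  rtends (fun n => dot (u n) (v n)) l -> form_closure mu E (L2fun h) (L2fun w) = l.
Proof.
move=> cu uh cv vw uvl; apply: xget_unique.
  exists (fun n => \val (u n)), (fun n => \val (v n)); split; try exact/form_approxP.
  exact/rtends_cvg.
move=> l' [u' [v' [uh' vw' /rtends_cvg ul']]].
have Du n : fdom E (u' n) by case: uh'.
have Dv n : fdom E (v' n) by case: vw'.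
have [cu' {}uh'] := (form_approxP (fun n => infs fsE pfE (Du n)) h).1 uh'.
have [cv' {}vw'] := (form_approxP (fun n => infs fsE pfE (Dv n)) w).1 vw'.
by apply: (closable_pair core_mapP closE cu' cu cv' cv uh' uh vw' vw ul').
Qed.

(** By [closable_pair] the value chosen in [form_closure] is the only possible one, and it
    is the limit along any pair of approximating sequences. *)
Theorem generator_closure (h k : L2ph mu) :
  generator mu (form_closure mu E) (L2fun h) (L2fun k) <-> form_gen core_map h k.
Proof.
split=> [[/form_closure_approx[u [cu uh]] _ hk]|[u [cu uh uk]]].
  exists u; split=> // w.
  have wc := @tends_cauchy _ _ _ _ (tends_cst w).
  have [l ul] := cauchy_dot cu wc.
  have jw : tends (core_map \o fun=> w) (core_map w) by exact: tends_cst.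
  have Dw : fdom (form_closure mu E) (L2fun (core_map w)).
    by apply/form_closure_approx; exists (fun=> w).
  suff <- : l = dot k (core_map w) by [].
  by rewrite -(form_closure_val cu uh wc jw ul); exact: hk.
split; [by apply/form_closure_approx; exists u|exact: L2funP|move=> w' Dw].
have Lw : L2 mu w' by case: Dw.
have [v [cv vw]] := (form_closure_approx (toL2 Lw)).1 Dw.
exact: (form_closure_val cu uh cv vw (form_gen_pair cu uk cv vw)).
Qed.

End core_space.

Lemma generator_L2 (R : realType) (X : ptopologicalType)
  (mu : {measure set (borel X) -> \bar R}) (E : bform R X) h k :
  fdom E `<=` L2 mu -> generator mu E h k -> L2 mu h /\ L2 mu k.
Proof. by move=> DL [/DL]. Qed.

Lemma form_closure_L2 (R : realType) (X : ptopologicalType)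
  (mu : {measure set (borel X) -> \bar R}) (E : bform R X) : fdom (form_closure mu E) `<=` L2 mu.
Proof. by move=> f []. Qed.

Section map_range.
Context {R : realType} {K V : prehilbert R} (j : K -> V).
Hypothesis jP : forall a x y, j (a *: x + y) = a *: j x + j y.

Lemma range_set0 : range j 0.
Proof. by exists (0 - 0) => //; rewrite (jB jP) subrr. Qed.

Lemma range_setP a x y : range j x -> range j y -> range j (a *: x + y).
Proof. by move=> [u _ <-] [v _ <-]; exists (a *: u + v). Qed.

Definition range_linset : linset V := LinSet range_set0 range_setP.

End map_range.

Section core_on.
Context {R : realType} {X : ptopologicalType}.
Variables (mu : {measure set (borel X) -> \bar R}) (E : bform R X).
Hypothesis HE : core_form_on mu E.

Local Notation j := (@core_map R X mu E (cf_fs HE) (cf_pf HE) (cf_L2 HE)).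

Lemma core_on_closable : closable_form j.
Proof.
move=> u cu u0 w.
apply: (cf_clos HE (u := fun n => \val (u n))) => [n|||]; try exact: sublmod_in.
- exact: (form_small _).1 cu.
- move=> e e0; have se : 0 < Num.sqrt e by rewrite sqrtr_gt0.
  have [N hN] := u0 _ se; exists N => n /hN.
  by rewrite subr0 nrm_lt_sq ?(ltW se)// sqr_sqrtr// ltW.
Qed.

Lemma core_on_dense v e : 0 < e -> exists x, nrm (v - j x) < e.
Proof.
pose D := range_linset (@core_mapP R X mu E (cf_fs HE) (cf_pf HE) (cf_L2 HE)).
move=> e0; have [|_ [x _ <-] h] := @L2_dense _ _ mu D (cf_exh HE) _ v e e0; last by exists x.
move=> U oU fU d d0; have d2 : 0 < d ^+ 2 by rewrite exprn_gt0.
have [f [Df _ fd]] := cf_ind HE oU fU d2.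
exists (j (infs (cf_fs HE) (cf_pf HE) Df)); first by exists (infs (cf_fs HE) (cf_pf HE) Df).
by rewrite nrmB nrm_lt_sq// ltW.
Qed.

End core_on.

Section regular_generator.
Context {R : realType} {X : ptopologicalType}.
Variables (mu : {measure set (borel X) -> \bar R}) (E : bform R X).
Hypothesis regE : regular_dirichlet_form mu E.
Hypotheses (fs0 : function_space (fdom (core0 E))) (pf0 : posform (fdom (core0 E)) (core0 E)).
Hypothesis L0 : fdom (core0 E) `<=` L2 mu.

Let fsE := dirichlet_space regE.
Let pfE := dirichlet_posform regE.
Let LE := dirichlet_L2 regE.
Local Notation K := (core_ph fsE pfE).
Local Notation K0 := (core_ph fs0 pf0).
Local Notation j := (@core_map R X mu E fsE pfE LE).
Local Notation j0 := (@core_map R X mu (core0 E) fs0 pf0 L0).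

Let inK (x : K0) : K := infs fsE pfE (sublmod_in x).1.

Lemma form1_small (x : K) e : 0 < e -> form1 mu E (\val x) (\val x) < e ^+ 2 ->
  nrm x < e /\ nrm (j x) < e.
Proof.
move=> e0 h; rewrite !nrm_lt_sq ?(ltW e0)//.
split; apply: le_lt_trans h; rewrite /form1.
  by rewrite lerDl L2dot_ge0.
by rewrite lerDr (pf_ge0 pfE)//; exact: sublmod_in.
Qed.

Lemma regular_approx (h : K) : exists u : nat -> K0,
  tends (inK \o u) h /\ tends (j0 \o u) (j h).
Proof.
have /choice[u uh] : forall n : nat, exists x : K0,
    nrm (inK x - h) < n.+1%:R^-1 /\ nrm (j0 x - j h) < n.+1%:R^-1.
  move=> n; have n0 : 0 < (n.+1%:R : R)^-1 by rewrite invr_gt0 ltr0n.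
  case: regE => _ /(_ (\val h) (sublmod_in h) (n.+1%:R^-1 ^+ 2))[|g [Dg Cg] hg _].
    by rewrite exprn_gt0.
  have D0 : fdom (core0 E) g by [].
  exists (infs fs0 pf0 D0); rewrite !(nrmB _ h) (nrmB _ (j h)).
  have := @form1_small (h - infs fsE pfE Dg) _ n0.
  by rewrite linearB => /(_ hg).
have lim e : 0 < e -> exists N, forall n, (N <= n)%N -> (n.+1%:R : R)^-1 < e.
  move=> e0; exists (Num.trunc e^-1) => n Nn; rewrite invf_plt ?posrE ?ltr0n//.
  by apply: (lt_le_trans (truncnS_gt _)); rewrite ler_nat ltnS.
exists u; split=> e /lim[N hN]; exists N => n /hN ne; have [h1 h2] := uh n.
  exact: lt_trans ne.
exact: lt_trans ne.
Qed.

(** Regularity says that the core is dense in the domain for the form norm. Conversely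
    the limit of a Cauchy sequence of the core is in the domain, because E is complete and
    is compatible with equality almost everywhere. *)
Lemma generator_regular (h k : L2ph mu) :
  generator mu E (L2fun h) (L2fun k) <-> form_gen j0 h k.
Proof.
have nrm0E (x y : K0) : nrm (inK x - inK y) = nrm (x - y) by rewrite !core_nrmB.
split=> [[Dh Lk hk]|[u [cu uh uk]]].
  have [u [uh ujh]] := regular_approx (infs fsE pfE Dh); exists u; split.
  - by move=> e /(tends_cauchy uh)[N hN]; exists N => m n Nm Nn; rewrite -nrm0E; exact: hN.
  - exact: ujh.
  - move=> w; have := rtends_dot (inK w) uh.
    have -> : dot (infs fsE pfE Dh : K) (inK w) = dot k (j0 w); last by [].
    by apply: hk; exact: (sublmod_in w).1.
have Lu n : L2 mu (\val (u n)) := L0 (sublmod_in (u n)).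
case: (regE) => -[[_ aeE _ _] [_ _ _] compl _] _ _.
have DE n : fdom E (\val (u n)) := (sublmod_in (u n)).1.
have [|f Df uf] := compl _ DE.
  move=> e e0; pose d := Num.sqrt (e / 2).
  have e2 : 0 < e / 2 by rewrite divr_gt0.
  have d0 : 0 < d by rewrite sqrtr_gt0.
  have d2 : d ^+ 2 = e / 2 by rewrite sqr_sqrtr// ltW.
  have [N hN] := cu d d0; have [M hM] := tends_cauchy uh d0.
  exists (maxn N M) => m n; rewrite !geq_max => /andP[m1 m2] /andP[n1 n2].
  have := hN m n m1 n1; have := hM m n m2 n2; rewrite !nrm_lt_sq ?(ltW d0)// d2.
  move=> h1 h2; rewrite /form1 [e]splitr; apply: ltrD; last exact: h1.
  rewrite -[_ \- _]/(\val (u m) - \val (u n)) -linearB; exact: h2.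
pose F : K := infs fsE pfE Df.
have {}uf : tends (inK \o u) F /\ tends (j0 \o u) (j F).
  split=> e e0; have /cvgrPdist_lt /(_ (e ^+ 2))[|N _ hN] := uf; rewrite ?exprn_gt0//;
    exists N => n Nn; have := hN n Nn; rewrite /= sub0r normrN => /(le_lt_trans (ler_norm _)) h1;
    have := @form1_small (inK (u n) - F) e e0; rewrite linearB => /(_ h1)[] //.
have hf := (L2ph_null (j F) h).1 (tends_unique uf.2 uh).
have [Dh Eh] := aeE _ _ Df (L2funP h) hf.
split=> //; first exact: L2funP.
move=> w Dw; rewrite -Eh//.
have [v [vw vjw]] := regular_approx (infs fsE pfE Dw).
have EFv n : E f (\val (v n)) = dot k (j0 (v n)).
  apply: (rtends_unique (rtends_dot (inK (v n)) uf.1)); exact: uk.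
have h1 := rtends_dot F vw; have h2 := rtends_dot k vjw.
have -> : E f w = dot F (infs fsE pfE Dw) by [].
have -> : L2dot mu (L2fun k) w = dot (j (infs fsE pfE Dw)) k by rewrite dotC.
rewrite dotC; apply: (rtends_unique h1).
rewrite (_ : (fun n => _) = fun n => dot ((j0 \o v) n) k) //.
by apply/funext => n; rewrite [RHS]dotC -[RHS]EFv dotC.
Qed.

End regular_generator.

(** The spectrum of an operator on functions, with equality almost everywhere, in terms of
    the corresponding operator on vectors, with null differences. *)
Lemma spectrum_regular (R : realType) d (T : measurableType d)
    (mu : {measure set T -> \bar R}) (H : set (T -> R)) (A : (T -> R) -> (T -> R) -> Prop)
    (H' : set (L2ph mu)) (A' : L2ph mu -> L2ph mu -> Prop) :
  H `<=` L2 mu -> (forall h k, A h k -> L2 mu h /\ L2 mu k) ->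
  (forall v, H (L2fun v) <-> H' v) -> (forall h k, A (L2fun h) (L2fun k) <-> A' h k) ->
  closed_subspace H' -> selfadjoint H' A' ->
  spectrum mu H A = [set l | ~ regular_value A' l].
Proof.
move=> HL AL HE AE cH sA.
have cV := @L2_complete _ _ _ mu.
suff e l : resolvent_set mu H A l <-> regular_value A' l.
  by apply/seteqP; split=> l /= h /e.
rewrite (regular_valueP l cV cH sA); split=> -[surj [C hC]].
  split; last first.
    exists C => h k /AE/hC; rewrite !L2ph_nrm; exact.
  move=> f /HE/surj[h [k [Ahk fE]]]; have [Lh Lk] := AL h k Ahk.
  by exists (toL2 Lh), (toL2 Lk); split; [exact/AE|apply/L2ph_null].
split; last first.
  exists C => h k Ahk; have [Lh Lk] := AL h k Ahk.
  have /hC : A' (toL2 Lh) (toL2 Lk) by apply/AE.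
  by rewrite !L2ph_nrm.
move=> f Hf; have Lf := HL f Hf.
have /surj[h [k [Ahk /L2ph_null fE]]] : H' (toL2 Lf) by apply/HE.
by exists (L2fun h), (L2fun k); split; [exact/AE|exact: fE].
Qed.

(** * The projective limit *)

Section limit_topology.
Context {X : ptopologicalType} (s : barlow_evans X).
Local Notation Foo := (beFoo s).
Local Notation Phi := (bePhi s).

Lemma bephi_Phi i (z : Foo) : bephi s i (Phi i.+1 z) = Phi i z.
Proof.
have h : be_threads (set_val z) := set_valP z.
exact: (h i).
Qed.

Lemma cylinder_lift i m (V : set (beF s i)) : (i <= m)%N -> open V ->
  exists V' : set (beF s m), open V' /\ forall z, V (Phi i z) <-> V' (Phi m z).
Proof.
elim: m => [|m ih] im oV.
  have i0 : i = 0%N by apply/eqP; rewrite -leqn0.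
  by subst i; exists V.
move: im; rewrite leq_eqVlt => /predU1P[im|].
  by subst i; exists V.
rewrite ltnS => /ih/(_ oV)[V' [oV' VV']].
exists (bephi s m @^-1` V'); split.
  have cphi : continuous (bephi s m) by exact: glue_phi_cont.
  exact: ((continuousP _).1 cphi V' oV').
by move=> z; rewrite /= bephi_Phi.
Qed.

Definition cylinder (P : set Foo) : Prop :=
  exists i (V : set (beF s i)), open V /\ P = Phi i @^-1` V.

Lemma cylinderI : setI_closed cylinder.
Proof.
move=> _ _ [i [V [oV ->]]] [j [W [oW ->]]].
have [V' [oV' VV']] := cylinder_lift (leq_maxl i j) oV.
have [W' [oW' WW']] := cylinder_lift (leq_maxr i j) oW.
exists (maxn i j), (V' `&` W'); split; first exact: openI.
by apply/seteqP; split=> z; rewrite /= => -[/VV' ? /WW' ?].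
Qed.

(** Cylinders of different levels are compared at the higher one ([cylinder_lift]), so the
    sets that contain a cylinder around z form a filter; it converges to z coordinatewise. *)
Lemma open_cylinder (W : set Foo) z : open W -> W z ->
  exists i (V : set (beF s i)), [/\ open V, V (Phi i z) & Phi i @^-1` V `<=` W].
Proof.
move=> [A oA <-] Az.
pose F : set_system (prod_topology (beF s)) := [set S | exists i (V : set (beF s i)),
  [/\ open V, V (Phi i z) & forall z', V (Phi i z') -> S (set_val z')]].
have FF : Filter F.
  split.
  - by exists 0%N, setT; split=> //; exact: openT.
  - move=> S S' [i [V [oV Vz VS]]] [j [V' [oV' Vz' VS']]].
    have [U [oU VU]] := cylinder_lift (leq_maxl i j) oV.
    have [U' [oU' VU']] := cylinder_lift (leq_maxr i j) oV'.
    exists (maxn i j), (U `&` U'); split; first exact: openI.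
      by split; [exact/VU|exact/VU'].
    by move=> z' [/VU/VS ? /VU'/VS' ?].
  - by move=> S S' SS' [i [V [oV Vz VS]]]; exists i, V; split=> // z' /VS/SS'.
have Fz : F --> (set_val z : prod_topology (beF s)).
  apply/cvg_sup => i B [_ [[C oC <-] Cz CB]].
  by exists i, C; split=> // z' Cz'; exact: CB.
have [i [V [oV Vz VA]]] : F A by apply: Fz; exact: open_nbhs_nbhs.
by exists i, V; split=> // z' /VA.
Qed.

Lemma Phi_cont i : continuous (Phi i).
Proof.
apply/continuousP => V oV; exists ([set x : prod_topology (beF s) | V (x i)]) => //.
rewrite openE => x Vx /=.
have : nbhs (x : prod_topology (beF s)) --> nbhs x by apply: cvg_id.
move=> /cvg_sup /(_ i); apply; exists [set x : prod_topology (beF s) | V (x i)].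
by split=> //; exists V.
Qed.

(** One cylinder for each level suffices: the union of all cylinders of that level inside
    W. *)
Lemma open_cylinders (W : set Foo) : open W -> exists F : nat -> set Foo,
  (forall n, cylinder (F n)) /\ W = \bigcup_n F n.
Proof.
move=> oW.
exists (fun n => Phi n @^-1` \bigcup_(V in [set V | open V /\ Phi n @^-1` V `<=` W]) V).
split=> [n|].
  exists n, (\bigcup_(V in [set V | open V /\ Phi n @^-1` V `<=` W]) V); split=> //.
  by apply: bigcup_open => V [].
apply/seteqP; split=> z.
  by move=> /(open_cylinder oW)[n [V [oV Vz VW]]]; exists n => //; exists V.
by move=> [n _ [V [oV VW] Vz]]; exact: VW.
Qed.

End limit_topology.

(** * The tower of forms *)

Section tower_of_forms.
Context {R : realType} {F0 : ptopologicalType} (s : barlow_evans F0).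
Variable mu : forall i, {measure set (borel (beF s i)) -> \bar R}.
Variable muG : forall i, probability (borel (beG s i)) R.
Variable muoo : {measure set (borel (beFoo s)) -> \bar R}.
Variable E0 : bform R F0.
Hypothesis F0_lc : locally_compact [set: F0].
Hypothesis F0_sc : @second_countable F0.
Hypothesis F0_hd : hausdorff_space F0.
Hypothesis mu0_radon : radon (mu 0%N).
Hypothesis G_cpt : forall i, compact [set: beG s i].
Hypothesis G_sc : forall i, @second_countable (beG s i).
Hypothesis G_hd : forall i, hausdorff_space (beG s i).
Hypothesis muG_radon : forall i, radon (muG i).
Hypothesis B_closed : forall i, closed (beB s i).
Hypothesis muE : forall i (A : set (borel (beF s i.+1))), measurable A ->
     mu i.+1 A = (mu i \x muG i)%E (bepi s i @^-1` A).
Hypothesis muooE : forall i (A : set (borel (beF s i))), measurable A ->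
     muoo (bePhi s i @^-1` A) = mu i A.
Hypothesis E0_reg : regular_dirichlet_form (mu 0%N) E0.

Local Notation Phi := (bePhi s).
Local Notation core := (core_form muG E0).
Local Notation coreoo := (core_form_oo muG E0).

Lemma core_levels i : core_form_on (mu i) (core i).
Proof.
elim: i => [|i ih].
  exact: (@core0_core R F0 (mu 0%N) E0 F0_lc F0_sc F0_hd mu0_radon E0_reg).
exact: (@step_core R (beF s i) (beG s i) (beB s i) (mu i) (muG i) (mu i.+1) (core i)
  (G_cpt (i := i)) (G_hd (i := i)) (second_countable_base (G_sc i)) (muG_radon i) (@B_closed i)
  (muE (i := i)) ih).
Qed.

Let fsD i := cf_fs (core_levels i).
Let pfD i := cf_pf (core_levels i).

Lemma measurable_Phi i : measurable_fun (setT : set (borel (beFoo s)))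
  (Phi i : borel (beFoo s) -> borel (beF s i)).
Proof. exact: continuous_borelY (@Phi_cont _ s i). Qed.

Let nuPhi i (A : set (borel (beF s i))) (mA : measurable A) : mu i A = muoo (Phi i @^-1` A) :=
  esym (muooE mA).

Lemma L2_Phi i f : L2 (mu i) f -> L2 muoo (f \o Phi i).
Proof. by move=> Lf; exact: ((L2_image (@measurable_Phi i) (@nuPhi i) (L2_measurable Lf)).1 Lf). Qed.

Lemma L2dot_Phi i f g : L2 (mu i) f -> L2 (mu i) g ->
  L2dot muoo (f \o Phi i) (g \o Phi i) = L2dot (mu i) f g.
Proof. by move=> Lf Lg; rewrite (L2dot_image (@measurable_Phi i) (@nuPhi i) Lf Lg). Qed.

Definition phi_pull (i : nat) (u : beF s i -> R) : beF s i.+1 -> R := u \o bephi s i.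

Lemma phi_pull_Phi i u : phi_pull u \o Phi i.+1 = u \o Phi i.
Proof. by apply/funext => z /=; rewrite /phi_pull /= bephi_Phi. Qed.

Lemma phi_pull_dom i u : fdom (core i) u -> fdom (core i.+1) (phi_pull u).
Proof.
move=> Du.
exact: (step_lift (beB s i) (muG i) (G_cpt (i := i)) (core_levels i) Du).
Qed.

Lemma phi_pull_val i u v : fdom (core i) u -> fdom (core i) v ->
  core i.+1 (phi_pull u) (phi_pull v) = core i u v.
Proof.
move=> Du Dv; rewrite -[RHS](Rintegral_prob (muG i)); apply: eq_Rintegral => g _.
congr (core i _ _); apply/funext => x; rewrite /phi_pull /=; congr (_ _).
  exact: glue_phiK.
exact: glue_phiK.
Qed.

(** As Phi i preserves the measure, u and u' are equal almost everywhere, and closability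
    applies to the constant sequence u - u'. *)
Lemma core_null i u u' w : fdom (core i) u -> fdom (core i) u' -> fdom (core i) w ->
  u \o Phi i = u' \o Phi i -> core i u w = core i u' w.
Proof.
move=> Du Du' Dw uu; have Duu := fs_B (fsD i) Du Du'.
have Luu := cf_L2 (core_levels i) Duu.
have z0 : L2dot (mu i) (u - u') (u - u') = 0.
  rewrite -(L2dot_Phi Luu Luu).
  have -> : (u - u') \o Phi i = (u \o Phi i) - (u' \o Phi i) by [].
  rewrite uu subrr /L2dot; under eq_Rintegral do rewrite mulr0.
  by rewrite Rintegral_cst// mul0r.
have t0 : rtends (fun=> core i (u - u') w) 0.
  apply: (cf_clos (core_levels i) (u := fun=> u - u')) => // e e0; exists 0%N => *.
    rewrite subrr (pf_0l (fsD i) (pfD i))//; exact: fs_0.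
  by rewrite z0.
have h : core i (u - u') w = 0 by exact: rtends_unique (rtends_cst _) t0.
rewrite -[u in LHS](subrK u') (pf_D (pfD i) Duu Du' Dw) h add0r//.
Qed.

Lemma core_at_level i m u : (i <= m)%N -> fdom (core i) u ->
  exists u', fdom (core m) u' /\ u' \o Phi m = u \o Phi i.
Proof.
elim: m => [|m ih] im Du.
  have i0 : i = 0%N by apply/eqP; rewrite -leqn0.
  by subst i; exists u.
move: im; rewrite leq_eqVlt => /predU1P[im|].
  by subst i; exists u.
rewrite ltnS => /ih/(_ Du)[u' [Du' uu]].
by exists (phi_pull u'); split; [exact: phi_pull_dom|rewrite phi_pull_Phi].
Qed.

(** This makes the value of the form at infinity well defined: the lower level is raised
    to the other one. *)
Lemma core_unique i j u v u' v' : fdom (core i) u -> fdom (core i) v ->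
  fdom (core j) u' -> fdom (core j) v' ->
  u \o Phi i = u' \o Phi j -> v \o Phi i = v' \o Phi j -> core i u v = core j u' v'.
Proof.
wlog ij : i j u v u' v' / (i <= j)%N.
  move=> h Du Dv Du' Dv' uu vv; have [/h|/ltnW/h] := leqP i j; first exact.
  by move=> hji; apply/esym; exact: hji.
elim: j u' v' ij => [|j ih] u' v' ij Du Dv Du' Dv' uu vv.
  have i0 : i = 0%N by apply/eqP; rewrite -leqn0.
  subst i; rewrite (core_null Du Du' Dv uu).
  rewrite (pf_sym (pfD _) Du' Dv) (pf_sym (pfD _) Du' Dv').
  exact: core_null.
move: ij; rewrite leq_eqVlt => /predU1P[ij|].
  subst i; rewrite (core_null Du Du' Dv uu).
  rewrite (pf_sym (pfD _) Du' Dv) (pf_sym (pfD _) Du' Dv').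
  exact: core_null.
rewrite ltnS => ij.
have [u1 [Du1 uu1]] := core_at_level ij Du; have [v1 [Dv1 vv1]] := core_at_level ij Dv.
rewrite (ih u1 v1)// -(phi_pull_val Du1 Dv1).
have Lu := phi_pull_dom Du1; have Lv := phi_pull_dom Dv1.
rewrite (core_null Lu Du' Lv); last by rewrite phi_pull_Phi uu1.
rewrite (pf_sym (pfD _) Du' Lv) (pf_sym (pfD _) Du' Dv').
by apply: core_null => //; rewrite phi_pull_Phi vv1.
Qed.

Lemma coreoo_val i u v : fdom (core i) u -> fdom (core i) v ->
  coreoo (u \o Phi i) (v \o Phi i) = core i u v.
Proof.
move=> Du Dv; apply: xget_unique; first by exists i, u, v.
by move=> l [j [u' [v' [Du' Dv' uu vv ->]]]]; exact: core_unique.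
Qed.

Lemma coreoo_common f g : fdom coreoo f -> fdom coreoo g ->
  exists i u v, [/\ fdom (core i) u, fdom (core i) v, f = u \o Phi i & g = v \o Phi i].
Proof.
move=> [i [u Du ->]] [j [v Dv ->]].
have [u' [Du' uu]] := core_at_level (leq_maxl i j) Du.
have [v' [Dv' vv]] := core_at_level (leq_maxr i j) Dv.
by exists (maxn i j), u', v'; rewrite uu vv.
Qed.

Lemma coreoo_space : function_space (fdom coreoo).
Proof.
split; first by exists 0%N, 0; [exact: fs_0 (fsD 0)|].
move=> c f g /coreoo_common h /h[i [u [v [Du Dv -> ->]]]].
by exists i, (c *: u + v); first exact: (fs_lin (fsD i)).
Qed.

Lemma coreoo_posform : posform (fdom coreoo) coreoo.
Proof.
split.
- move=> c f g h Df Dg Dh.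
  have [i [u [v [Du Dv fu gv]]]] := coreoo_common Df Dg.
  have [j [u' [w [Du' Dw uu' hw]]]] := coreoo_common Df Dh.
  have [u1 [Du1 e1]] := core_at_level (leq_maxl i j) Du.
  have [v1 [Dv1 e2]] := core_at_level (leq_maxl i j) Dv.
  have [w1 [Dw1 e3]] := core_at_level (leq_maxr i j) Dw.
  rewrite fu gv hw -e1 -e2 -e3.
  have -> : c *: (u1 \o Phi (maxn i j)) + (v1 \o Phi (maxn i j)) =
     (c *: u1 + v1) \o Phi (maxn i j) by [].
  rewrite !coreoo_val//; last exact: (fs_lin (fsD _)).
  exact: (pf_lin (pfD _)).
- move=> f g Df Dg; have [i [u [v [Du Dv -> ->]]]] := coreoo_common Df Dg.
  by rewrite !coreoo_val//; exact: (pf_sym (pfD i)).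
- move=> f Df; have [i [u [v [Du Dv -> _]]]] := coreoo_common Df Df.
  by rewrite !coreoo_val//; exact: (pf_ge0 (pfD i)).
Qed.

Lemma coreoo_L2 f : fdom coreoo f -> L2 muoo f.
Proof. by move=> [i [u Du ->]]; apply: L2_Phi; exact: (cf_L2 (core_levels i)). Qed.

(** The function q is the mean of u over the fibres of the levels i + 1, ..., j. *)
Lemma coreoo_project i j u : (i <= j)%N -> fdom (core j) u -> exists q, fdom (core i) q /\
  forall x, fdom (core i) x -> coreoo (x \o Phi i) (u \o Phi j) = core i x q /\
    L2dot muoo (x \o Phi i) (u \o Phi j) = L2dot (mu i) x q.
Proof.
elim: j u => [|j ih] u ij Du.
  have i0 : i = 0%N by apply/eqP; rewrite -leqn0.
  subst i; exists u; split=> // x Dx; rewrite coreoo_val// L2dot_Phi//;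
    exact: (cf_L2 (core_levels _)).
move: ij; rewrite leq_eqVlt => /predU1P[ij|].
  subst i; exists u; split=> // x Dx; rewrite coreoo_val// L2dot_Phi//;
    exact: (cf_L2 (core_levels _)).
rewrite ltnS => ij.
pose q1 : beF s j -> R := fmean (muG j) (fun=> 1) u.
have tu : tensor (fdom (core j)) u by case: Du.
have Dq1 : fdom (core j) q1.
  exact: (fmean_tensor (muG j) (G_cpt (i := j)) (fsD j) (@cst_continuous _ _ (1 : R)) tu).
have [q [Dq qP]] := ih q1 ij Dq1; exists q; split=> // x Dx.
have [x1 [Dx1 xx]] := core_at_level ij Dx.
have [<- <-] := qP x Dx; rewrite -xx.
have Lx := phi_pull_dom Dx1.
have r : tensor_rep (fdom (core j)) (phi_pull x1) (fun _ : 'I_1 => x1) (fun=> fun=> 1 : R).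
  split=> // [_|y g]; first exact: cst_continuous.
  by rewrite big_ord_recl big_ord0 addr0 mulr1 /phi_pull /=; congr (x1 _); exact: glue_phiK.
have key F : posform (fdom (core j)) F -> fibre_form (muG j) F (phi_pull x1) u = F x1 q1.
  move=> pF; have tl : tensor (fdom (core j)) (phi_pull x1) by case: Lx.
  rewrite (pf_sym (fibre_posform (beB s j) (muG j) (G_cpt (i := j)) (fsD j) pF) tl tu).
  rewrite (fibre_pair (muG j) (G_cpt (i := j)) (fsD j) pF tu r) big_ord_recl big_ord0 addr0.
  exact: (pf_sym pF).
split.
  rewrite [RHS]coreoo_val// -(phi_pull_Phi x1) coreoo_val//; exact: (key _ (pfD j)).
have pL := posform_sub (cf_L2 (core_levels j)) (L2_posform (mu j)).
have L2D := cf_L2 (core_levels j).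
have L2D' := cf_L2 (core_levels j.+1).
rewrite [RHS](L2dot_Phi (L2D _ Dx1) (L2D _ Dq1)) -(phi_pull_Phi x1).
rewrite (L2dot_Phi (L2D' _ Lx) (L2D' _ Du)).
rewrite -(key _ pL).
exact: (step_L2dot (G_cpt (i := j)) (second_countable_base (G_sc j)) (@B_closed j)
  (muE (i := j)) (core_levels j) Lx Du).
Qed.

Local Notation V := (L2ph muoo).
Local Notation W i := (L2ph (mu i)).
Local Notation K i := (core_ph (fsD i) (pfD i)).
Local Notation Koo := (core_ph coreoo_space coreoo_posform).
Local Notation jj i :=
  (@core_map R (beF s i) (mu i) (core i) (fsD i) (pfD i) (cf_L2 (core_levels i))).
Local Notation joo := (@core_map R (beFoo s) muoo coreoo coreoo_space coreoo_posform coreoo_L2).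

(** ** Reduction of the operator at infinity *)

Definition pull i (u : W i) : V := toL2 (L2_Phi (L2funP u)).

Lemma pullP i c (x y : W i) : pull (c *: x + y) = c *: pull x + pull y.
Proof. by apply/LfuneqP. Qed.

Lemma pull_dot i (x y : W i) : dot (pull x) (pull y) = dot x y.
Proof. by apply: L2dot_Phi; exact: L2funP. Qed.

Lemma coreoo_in i u : fdom (core i) u -> fdom coreoo (u \o Phi i).
Proof. by move=> Du; exists i, u. Qed.

Definition core_pull i (x : K i) : Koo :=
  infs coreoo_space coreoo_posform (coreoo_in (sublmod_in x)).

Lemma core_pullP i c (x y : K i) : core_pull (c *: x + y) = c *: core_pull x + core_pull y.
Proof.
apply/val_inj; rewrite linearP.
have e : \val (c *: x + y) = c *: \val x + \val y by rewrite linearP.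
by rewrite -[LHS]/(\val (c *: x + y) \o Phi i) e.
Qed.

Lemma core_pull_dot i (x y : K i) : dot (core_pull x) (core_pull y) = dot x y.
Proof. by apply: coreoo_val; exact: sublmod_in. Qed.

Lemma core_pull_map i (x : K i) : joo (core_pull x) = pull (jj i x).
Proof. by apply/LfuneqP. Qed.

Lemma core_pull_surj (w : Koo) : exists i (x : K i), w = core_pull x.
Proof.
have [i [u Du wu]] := sublmod_in w; exists i, (infs (fsD i) (pfD i) Du).
exact/val_inj.
Qed.

Lemma core_adjoint i : exists Q : Koo -> K i,
  (forall x y, dot (core_pull x) y = dot x (Q y)) /\
  (forall x y, dot (pull (jj i x)) (joo y) = dot (jj i x) (jj i (Q y))).
Proof.
suff /choice[Q QP] : forall y : Koo, exists q : K i, forall x : K i,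
    dot (core_pull x) y = dot x q /\ dot (pull (jj i x)) (joo y) = dot (jj i x) (jj i q).
  by exists Q; split=> x y; have [] := QP y x.
move=> y; have [k [u Du yu]] := sublmod_in y.
have [u' [Du' uu]] := core_at_level (leq_maxr i k) Du.
have [q [Dq qP]] := coreoo_project (leq_maxl i k) Du'.
exists (infs (fsD i) (pfD i) Dq) => x.
have [h1 h2] := qP (\val x) (sublmod_in x).
have e : \val y = u' \o Phi (maxn i k) by rewrite uu.
split; first by rewrite -[RHS]h1 -e.
by rewrite -[RHS]h2 -e.
Qed.

(** Closability is tested against one w, which comes from a level i: there
    [closable_project] applies. *)
Lemma joo_closable : closable_form joo.
Proof.
move=> u cu u0 w; have [i [x ->]] := core_pull_surj w.
have [Q [Q1 Q2]] := core_adjoint i.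
exact: (closable_project (@pull_dot i) (@core_pull_dot i) Q1 Q2
  (@core_on_closable _ _ _ _ (core_levels i)) cu u0).
Qed.

Lemma muoo_exhaustion : open_exhaustion muoo.
Proof.
have [C [oC fC CT]] := cf_exh (core_levels 0); exists (fun n => Phi 0 @^-1` C n); split.
- by move=> n; exact: ((continuousP _).1 (@Phi_cont _ s 0%N)).
- by move=> n; rewrite muooE//; exact: open_measurable.
- by rewrite -preimage_bigcup CT preimage_setT.
Qed.

(** Cylinders are approximated at their level, and open sets are countable unions of
    cylinders. *)
Lemma joo_dense v e : 0 < e -> exists x, nrm (v - joo x) < e.
Proof.
move=> e0.
pose D := range_linset (@core_mapP R (beFoo s) muoo coreoo coreoo_space coreoo_posform coreoo_L2).
have [|_ [x _ <-] h] := @L2_dense _ _ muoo D muoo_exhaustion _ v e e0; last by exists x.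
move=> U oU fU d d0.
have [F [cF UF]] := open_cylinders oU.
apply: (@ind_bigcup _ _ muoo D (@cylinder _ s) F U) => //; first exact: cylinderI.
  move=> P [i [A [oA ->]]]; apply: open_measurable.
  exact: ((continuousP _).1 (@Phi_cont _ s i)).
move=> P mP fP [i [A [oA PE]]] c c0; have mA := open_measurable oA.
have fA : (mu i A < +oo)%E by rewrite -muooE// -PE.
have [x hx] := core_on_dense (core_levels i) (indL2 mA fA) c0.
exists (joo (core_pull x)); first by exists (core_pull x).
suff -> : indL2 mP fP = pull (indL2 mA fA).
  by rewrite core_pull_map (linear_nrmB _ _ (@pullP i) (@pull_dot i)).
by apply/LfuneqP => z; rewrite /= PE.
Qed.

Definition opoo := form_gen joo.
Definition op i := form_gen (jj i).

Lemma opoo_selfadjoint : selfadjoint setT opoo.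
Proof.
exact: (form_gen_selfadjoint (@core_mapP _ _ _ _ _ _ _) (@L2_complete _ _ _ muoo)
  joo_dense joo_closable).
Qed.

Lemma op_selfadjoint i : selfadjoint setT (@op i).
Proof.
exact: (form_gen_selfadjoint (@core_mapP _ _ _ _ _ _ _) (@L2_complete _ _ _ (mu i))
  (core_on_dense (core_levels i)) (@core_on_closable _ _ _ _ (core_levels i))).
Qed.

Lemma op_pull i h k : op h k -> opoo (@pull i h) (pull k).
Proof.
have [Q [Q1 Q2]] := core_adjoint i.
apply: (form_gen_transport (@pullP i) (@core_pullP i) (@pull_dot i) (@core_pull_dot i)
  (@core_pull_map i) Q1 Q2); exact: (@core_on_dense _ _ _ _ (core_levels i)).
Qed.

Lemma pull_up i (x : W i) : exists y : W i.+1, null (pull x - pull y).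
Proof.
have mx := L2_measurable (L2funP x).
have mb : measurable_fun (setT : set (borel (beF s i.+1)))
    (bephi s i : borel (beF s i.+1) -> borel (beF s i)).
  exact: continuous_borelY (@glue_phi_cont _ _ _).
have Lb : L2 (mu i.+1) (phi_pull (L2fun x)).
  apply/(L2_image (@measurable_Phi i.+1) (@nuPhi i.+1)); first exact: measurableT_comp mx mb.
  by rewrite phi_pull_Phi; apply: L2_Phi; exact: L2funP.
exists (toL2 Lb); rewrite (_ : pull (toL2 Lb) = pull x) ?subrr; first exact: null0.
by apply/LfuneqP => z; rewrite /= -[RHS]/((L2fun x \o Phi i) z) -phi_pull_Phi.
Qed.

Lemma pull_dense (v : V) e : 0 < e -> exists i (x : W i), nrm (v - pull x) < e.
Proof.
move=> /(joo_dense v)[w vw]; have [i [x wx]] := core_pull_surj w.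
by exists i, (jj i x); rewrite -core_pull_map -wx.
Qed.

Local Notation Lap := (Laplacian mu muG E0).
Local Notation Lapoo := (Laplacian_oo muG muoo E0).
Local Notation Dp := (Dprime mu muG muoo E0).
Local Notation Dbelow := (Dprime_below mu muG muoo E0).

Lemma Lap_L2 i h k : Lap i h k -> L2 (mu i) h /\ L2 (mu i) k.
Proof.
apply: generator_L2; case: i {h k} => [|i]; last exact: form_closure_L2.
exact: dirichlet_L2 E0_reg.
Qed.

Lemma Lap_op i (h k : W i) : Lap i (L2fun h) (L2fun k) <-> op h k.
Proof.
case: i h k => [|i] h k; last first.
  exact: (generator_closure (@core_on_closable _ _ _ _ (core_levels i.+1))).
exact: (generator_regular E0_reg (fsD 0) (pfD 0) (cf_L2 (core_levels 0))).
Qed.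

Lemma Lapoo_op (h k : V) : Lapoo (L2fun h) (L2fun k) <-> opoo h k.
Proof. exact: (generator_closure joo_closable). Qed.

(** Here and below, sets of functions up to equality almost everywhere are matched with
    the sets of vectors of the abstract tower. *)
Lemma pullback_tower_dom i (v : V) :
  pullback muoo (op_dom (Lap i)) (L2fun v) <-> tower_dom op pull i v.
Proof.
split=> [[_ [u [k uk] vu]]|[u [k [uk vu]]]].
  have [Lu Lk] := Lap_L2 uk; exists (toL2 Lu), (toL2 Lk).
  by split; [exact/Lap_op|exact/L2ph_null].
split; first exact: L2funP.
exists (L2fun u); first by exists (L2fun k); exact/Lap_op.
exact: (L2ph_null _ _).1 vu.
Qed.

Lemma orthogonal_orth (S T : set (beFoo s -> R)) (S' T' : set V) :
  S `<=` L2 muoo -> (forall v : V, S (L2fun v) <-> S' v) ->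
  (forall v : V, T (L2fun v) <-> T' v) ->
  forall v : V, orthogonal_part muoo S T (L2fun v) <-> orth S' T' v.
Proof.
move=> SL SS TT v; split=> -[/TT Tv vS]; split=> // g gS.
  by apply: vS; exact/SS.
by have := vS (toL2 (SL g gS)); apply; exact/SS.
Qed.

Lemma Dbelow_L2 i : Dbelow i `<=` L2 muoo.
Proof. by elim: i => [|i ih] // f [/ih//|[[]]]. Qed.

Lemma Dbelow_below i (v : V) : Dbelow i (L2fun v) <-> below op pull i v.
Proof.
elim: i v => [|i ih] v //=.
have h := orthogonal_orth (@Dbelow_L2 i) ih (@pullback_tower_dom i) v.
by split=> -[/ih|/h]; [left|right|left|right].
Qed.

Lemma Dprime_increment i (v : V) : Dp i (L2fun v) <-> increment op pull i v.
Proof. exact: orthogonal_orth (@Dbelow_L2 i) (@Dbelow_below i) (@pullback_tower_dom i) v. Qed.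

Let cV := @L2_complete _ _ _ muoo.
Let cW i := @L2_complete _ _ _ (mu i).

Lemma L2closure_increment i (v : V) :
  L2closure muoo (Dp i) (L2fun v) <-> increment_space pull i v.
Proof.
rewrite -(increment_closure cW opoo_selfadjoint op_selfadjoint pullP pull_dot op_pull pull_up).
split=> [[_ h] e /h[g Dg vg]|h].
  have Lg : L2 muoo g by case: Dg => -[].
  exists (toL2 Lg); first exact/Dprime_increment.
  by rewrite L2ph_nrm.
split; first exact: L2funP.
move=> e /h[g Dg vg]; exists (L2fun g); first exact/Dprime_increment.
by move: vg; rewrite L2ph_nrm.
Qed.

Lemma spectrum_level i : spectrum (mu i) (L2 (mu i)) (Lap i) =
  [set l | ~ regular_value (@op i) l].
Proof.
apply: (spectrum_regular (H' := setT)) => //.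
- exact: Lap_L2.
- by move=> v; split=> // _; exact: L2funP.
- exact: Lap_op.
- exact: op_selfadjoint.
Qed.

Lemma Lapoo_L2 h k : Lapoo h k -> L2 muoo h /\ L2 muoo k.
Proof. by apply: generator_L2; exact: form_closure_L2. Qed.

Lemma spectrum_limit : spectrum muoo (L2 muoo) Lapoo = [set l | ~ regular_value opoo l].
Proof.
apply: (spectrum_regular (H' := setT)) => //.
- exact: Lapoo_L2.
- by move=> v; split=> // _; exact: L2funP.
- exact: Lapoo_op.
- exact: opoo_selfadjoint.
Qed.

Lemma spectrum_increment i :
  spectrum muoo (L2closure muoo (Dp i)) (op_restrict Lapoo (Dp i)) =
  [set l | ~ regular_value (increment_op opoo op pull i) l].
Proof.
apply: (spectrum_regular (H' := increment_space pull i)).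
- by move=> f [].
- by move=> h k [_ /Lapoo_L2].
- exact: L2closure_increment.
- by move=> h k; split=> -[/Dprime_increment Dh /Lapoo_op hk].
- exact: (increment_space_closed cW pullP pull_dot).
- exact: (increment_selfadjoint cW opoo_selfadjoint op_selfadjoint pullP pull_dot op_pull pull_up).
Qed.

Let tower_regularP := tower_regular cW opoo_selfadjoint op_selfadjoint pullP pull_dot
  op_pull pull_dense.

Let increment_regularP := increment_regular cW opoo_selfadjoint op_selfadjoint pullP
  pull_dot op_pull pull_up.

Lemma closureP (S : set R) l :
  closure S l <-> forall d, 0 < d -> exists2 l', S l' & `|l' - l| < d.
Proof.
split=> [Sl d d0|h B /nbhs_ballP[d d0 dB]].
  have [l' [Sl' bl']] := Sl _ (nbhsx_ballx l d d0).
  by exists l' => //; rewrite distrC.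
by have [l' Sl' ll'] := h d d0; exists l'; split=> //; apply: dB; rewrite /ball /= distrC.
Qed.

Lemma spectrum_tower : spectrum muoo (L2 muoo) Lapoo =
    closure (\bigcup_i spectrum (mu i) (L2 (mu i)) (Lap i)) /\
  closure (\bigcup_i spectrum (mu i) (L2 (mu i)) (Lap i)) =
    closure (\bigcup_i spectrum muoo (L2closure muoo (Dp i)) (op_restrict Lapoo (Dp i))).
Proof.
split.
  rewrite spectrum_limit; apply/seteqP; split=> l.
    move=> nr; apply/closureP => d d0; apply: contrapT => no; apply: nr.
    apply/tower_regularP.
    exists d => // i l' ll'; apply: contrapT => nl'; apply: no.
    by exists l' => //; exists i => //; rewrite spectrum_level.
  move=> /closureP cl.
  move=> /tower_regularP[d d0 h].
  have [l' [i _]] := cl d d0; rewrite spectrum_level => nl' ll'.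
  exact: nl' (h i l' ll').
congr closure; apply/seteqP; split=> l.
  move=> [i _]; rewrite spectrum_level => nl; apply: contrapT => no; apply: nl.
  apply: (increment_regularP l).2 => k.
  apply: contrapT => nk; apply: no; exists k => //.
  by rewrite spectrum_increment.
move=> [i _]; rewrite spectrum_increment => nl; apply: contrapT => no; apply: nl.
apply: (increment_regularP l).1 => k.
apply: contrapT => nk; apply: no; exists k => //.
by rewrite spectrum_level.
Qed.

End tower_of_forms.

Theorem theorem5p1 (R : realType) (F0 : ptopologicalType)
  (s : barlow_evans F0)
  (mu : forall i, {measure set (borel (beF s i)) -> \bar R})
  (muG : forall i, probability (borel (beG s i)) R)
  (muoo : {measure set (borel (beFoo s)) -> \bar R})
  (E0 : bform R F0)
  (F0_lc : locally_compact [set: F0])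
  (F0_sc : @second_countable F0)
  (F0_hd : hausdorff_space F0)
  (mu0_sf : sigma_finite setT (mu 0%N))
  (mu0_radon : radon (mu 0%N))
  (mu0_supp : full_support (mu 0%N))
  (G_cpt : forall i, compact [set: beG s i])
  (G_sc : forall i, @second_countable (beG s i))
  (G_hd : forall i, hausdorff_space (beG s i))
  (muG_radon : forall i, radon (muG i))
  (muG_supp : forall i, full_support (muG i))
  (B_closed : forall i, closed (beB s i))
  (muE : forall i (A : set (borel (beF s i.+1))), measurable A ->
     mu i.+1 A = (mu i \x muG i)%E (bepi s i @^-1` A))
  (muooE : forall i (A : set (borel (beF s i))), measurable A ->
     muoo (bePhi s i @^-1` A) = mu i A)
  (E0_reg : regular_dirichlet_form (mu 0%N) E0) :
  let Delta i := Laplacian mu muG E0 i in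
  let Delta_oo := Laplacian_oo muG muoo E0 in
  let D' i := Dprime mu muG muoo E0 i in
  let sigma_i i := spectrum (mu i) (L2 (mu i)) (Delta i) in
  let sigma_D' i :=
    spectrum muoo (L2closure muoo (D' i)) (op_restrict Delta_oo (D' i)) in
  spectrum muoo (L2 muoo) Delta_oo = closure (\bigcup_i sigma_i i) /\
  closure (\bigcup_i sigma_i i) = closure (\bigcup_i sigma_D' i).
Proof.
exact: (spectrum_tower F0_lc F0_sc F0_hd mu0_radon G_cpt G_sc G_hd muG_radon B_closed muE muooE E0_reg).
Qed.
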